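(* Let $(M,g)$ be a compact oriented $m$-dimensional Riemannian manifold and $X$ a smooth vector field on $M$. Assume that the real numbers $\delta_1$ and $\delta_2$ have the same sign (both positive or both negative). Then $X:(M,g)\to(TM,g_S)$ is an interpolating sesqui-harmonic vector field if and only if $X$ is parallel.
   Context: $X$ is parallel if $\nabla X=0$, where $\nabla$ is the Levi-Civita connection of $(M,g)$. The Sasaki metric $g_S$ on $TM$ is determined by $g_S(Y^h,Z^h)=g_S(Y^v,Z^v)=g(Y,Z)\circ\pi$, $g_S(Y^v,Z^h)=0$, where $\pi:TM\to M$ is the projection and $Y^h,Y^v$ are the horizontal (with respect to $\nabla$) and vertical lifts. A vector field $X$ is viewed as the map $x\mapsto(x,X_x)$ from $(M,g)$ to $(TM,g_S)$, with tension field $\tau(X)$. The vector field $X$ is called an interpolating sesqui-harmonic vector field if the corresponding map is a critical point of $E_{\delta_1,\delta_2}(X)=\delta_1\int_M\|dX\|^2v_g+\delta_2\int_M\|\tau(X)\|^2v_g$, only considering variations through vector fields. Explicitly, $E_{\delta_1,\delta_2}(X)=\delta_1\,m\,\mathrm{Vol}(M)+\delta_1\int_M\|\nabla X\|^2v_g+\delta_2\int_M[\|S(X)\|^2+\|\bar\Delta X\|^2]v_g$, where, for a local orthonormal frame $\{e_i\}$, $\bar\Delta X=\sum_i(\nabla_{\nabla_{e_i}e_i}X-\nabla_{e_i}\nabla_{e_i}X)$, $S(X)=\sum_iR(\nabla_{e_i}X,X)e_i$, and $R(X,Y)Z=\nabla_X\nabla_YZ-\nabla_Y\nabla_XZ-\nabla_{[X,Y]}Z$.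 *)

(* Defs.v *)
From HB Require Import structures.
From mathcomp Require Import all_boot all_order all_algebra.
From mathcomp Require Import all_classical all_reals all_analysis.
Import Order.TTheory GRing.Theory Num.Theory.
Import numFieldNormedType.Exports.

Set Implicit Arguments.
Unset Strict Implicit.
Unset Printing Implicit Defensive.

Local Open Scope classical_set_scope.
Local Open Scope ring_scope.

(* Conventions.  Tangent vectors are row vectors, so a linear map acts by right
   multiplication and the rows of a Jacobian are the partial derivatives.
   Tensor fields on a manifold are given classically, by their components in
   every chart of an atlas together with the transformation law.  Total
   functions take irrelevant values outside the chart images. *)

Section Calculus.
Context {R : realType} {n : nat} {V : normedModType R}.

Definition partial (i : 'I_n) (f : 'rV[R]_n -> V) (x : 'rV[R]_n) : V :=
  'D_(delta_mx 0 i) f x.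

(* C^infinity on an open set U: all iterated partial derivatives of all orders
   exist and are continuous on U. *)
Definition smooth_on (U : set 'rV[R]_n) (f : 'rV[R]_n -> V) : Prop :=
  forall (s : seq 'I_n) (x : 'rV[R]_n), U x ->
    {for x, continuous (foldr partial f s)} /\
    forall i : 'I_n, derivable (foldr partial f s) x (delta_mx 0 i).

End Calculus.

(* For continuous compactly supported f this is the integral of f with respect
   to the n-dimensional Lebesgue measure (Fubini). *)
Fixpoint iterated_integral (R : realType) (n : nat) :
    ('rV[R]_n -> R) -> R :=
  match n return ('rV[R]_n -> R) -> R with
  | 0 => fun f => f 0
  | n'.+1 => fun f =>
      \int[@lebesgue_measure R]_t
        iterated_integral (fun y : 'rV[R]_n' => f (row_mx (t%:M : 'rV[R]_1) y))
  end.

Section LocalRiemannianGeometry.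
Context {R : realType}.

Definition inner (n : nat) (G : 'M[R]_n) (u v : 'rV[R]_n) : R :=
  (u *m G *m v^T) 0 0.

(* [christoffel G x k i j] is Gamma^k_{ij} at x, for the Levi-Civita connection
   of the metric with component matrix G. *)
Definition christoffel (n : nat) (G : 'rV[R]_n -> 'M[R]_n) (x : 'rV[R]_n)
    (k i j : 'I_n) : R :=
  2^-1 * \sum_l invmx (G x) k l *
    (partial i G x j l + partial j G x i l - partial l G x i j).

(* Row i is the covariant derivative of X along the i-th coordinate field. *)
Definition nabla (n : nat) (G : 'rV[R]_n -> 'M[R]_n)
    (X : 'rV[R]_n -> 'rV[R]_n) (x : 'rV[R]_n) : 'M[R]_n :=
  \matrix_(i, k) (partial i X x 0 k + \sum_j christoffel G x k i j * X x 0 j).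

(* Squared Hilbert-Schmidt norm of the differential of a map f from a domain
   with metric G to a domain with metric H. *)
Definition sqnorm_diff (n p : nat) (G : 'rV[R]_n -> 'M[R]_n)
    (H : 'rV[R]_p -> 'M[R]_p) (f : 'rV[R]_n -> 'rV[R]_p) (x : 'rV[R]_n) : R :=
  \sum_i \sum_j invmx (G x) i j *
    inner (H (f x)) (partial i f x) (partial j f x).

(* Tension field: trace with respect to G of the second fundamental form
   of f. *)
Definition tension (n p : nat) (G : 'rV[R]_n -> 'M[R]_n)
    (H : 'rV[R]_p -> 'M[R]_p) (f : 'rV[R]_n -> 'rV[R]_p) (x : 'rV[R]_n) :
    'rV[R]_p :=
  \row_a \sum_i \sum_j invmx (G x) i j *
    (partial i (partial j f) x 0 a
     - \sum_k christoffel G x k i j * partial k f x 0 a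
     + \sum_b \sum_c christoffel H (f x) a b c
         * partial i f x 0 b * partial j f x 0 c).

(* A point of the tangent bundle has coordinates z = row_mx x y, where x is the
   base point and y the vector; a tangent vector of the tangent bundle at z has
   components row_mx v w. *)
Section Sasaki.
Context {m : nat}.
Variable g : 'rV[R]_m -> 'M[R]_m.

(* v *m christoffel_mx z has components sum_{i,j} Gamma^k_{ij}(x) v^i y^j. *)
Definition christoffel_mx (z : 'rV[R]_(m + m)) : 'M[R]_m :=
  \matrix_(i, k) \sum_j christoffel g (lsubmx z) k i j * rsubmx z 0 j.

Definition horizontal_lift (z : 'rV[R]_(m + m)) (v : 'rV[R]_m) :
  'rV[R]_(m + m) := row_mx v (- (v *m christoffel_mx z)).

Definition vertical_lift (v : 'rV[R]_m) : 'rV[R]_(m + m) := row_mx 0 v.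

Definition bundle_proj_mx : 'M[R]_(m + m, m) := col_mx 1%:M 0.

(* Connection map: kills horizontal lifts, sends the vertical lift of v to v. *)
Definition connector_mx (z : 'rV[R]_(m + m)) : 'M[R]_(m + m, m) :=
  col_mx (christoffel_mx z) 1%:M.

(* The lemmas below show that this is the metric determined by the values of
   the Sasaki metric on horizontal and vertical lifts. *)
Definition sasaki (z : 'rV[R]_(m + m)) : 'M[R]_(m + m) :=
  bundle_proj_mx *m g (lsubmx z) *m bundle_proj_mx^T
  + connector_mx z *m g (lsubmx z) *m (connector_mx z)^T.

Lemma sasakiE z u v : inner (sasaki z) u v =
  inner (g (lsubmx z)) (u *m bundle_proj_mx) (v *m bundle_proj_mx)
  + inner (g (lsubmx z)) (u *m connector_mx z) (v *m connector_mx z).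
Proof. by rewrite /inner /sasaki mulmxDr mulmxDl mxE !trmx_mul !mulmxA. Qed.

Lemma horizontal_lift_proj z v : horizontal_lift z v *m bundle_proj_mx = v.
Proof. by rewrite mul_row_col mulmx1 mulmx0 addr0. Qed.

Lemma horizontal_lift_connector z v : horizontal_lift z v *m connector_mx z = 0.
Proof. by rewrite mul_row_col mulmx1 subrr. Qed.

Lemma vertical_lift_proj v : vertical_lift v *m bundle_proj_mx = 0.
Proof. by rewrite mul_row_col mul0mx mulmx0 addr0. Qed.

Lemma vertical_lift_connector z v : vertical_lift v *m connector_mx z = v.
Proof. by rewrite mul_row_col mul0mx mulmx1 add0r. Qed.

Lemma sasaki_hh z u v :
  inner (sasaki z) (horizontal_lift z u) (horizontal_lift z v)
  = inner (g (lsubmx z)) u v.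
Proof.
rewrite sasakiE !horizontal_lift_proj !horizontal_lift_connector.
by rewrite {2}/inner !mul0mx [X in _ + X]mxE addr0.
Qed.

Lemma sasaki_vv z u v :
  inner (sasaki z) (vertical_lift u) (vertical_lift v)
  = inner (g (lsubmx z)) u v.
Proof.
rewrite sasakiE !vertical_lift_proj !vertical_lift_connector.
by rewrite {1}/inner !mul0mx [X in X + _]mxE add0r.
Qed.

Lemma sasaki_vh z u v :
  inner (sasaki z) (vertical_lift u) (horizontal_lift z v) = 0.
Proof.
rewrite sasakiE vertical_lift_proj horizontal_lift_connector.
by rewrite /inner trmx0 mulmx0 !mul0mx !mxE addr0.
Qed.

Definition graph_map (X : 'rV[R]_m -> 'rV[R]_m) (x : 'rV[R]_m) :
  'rV[R]_(m + m) := row_mx x (X x).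

End Sasaki.
End LocalRiemannianGeometry.

Record chart (R : realType) (M : topologicalType) (m : nat) := Chart {
  chart_dom : set M;
  chart_map : M -> 'rV[R]_m;
  chart_inv : 'rV[R]_m -> M;
  chart_dom_open : open chart_dom;
  chart_map_open : open (chart_map @` chart_dom);
  chart_map_continuous : {within chart_dom, continuous chart_map};
  chart_inv_continuous :
    {within chart_map @` chart_dom, continuous chart_inv};
  chart_mapK : forall p, chart_dom p -> chart_inv (chart_map p) = p
}.

Section Manifold.
Context {R : realType} {M : topologicalType} {m : nat}.
Local Notation chart := (chart R M m).
Implicit Types (A : set chart) (c d : chart).

Definition chart_im c : set 'rV[R]_m := chart_map c @` chart_dom c.

Definition overlap c d : set 'rV[R]_m :=
  chart_map c @` (chart_dom c `&` chart_dom d).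

Definition transition c d : 'rV[R]_m -> 'rV[R]_m :=
  chart_map d \o chart_inv c.

Definition oriented_atlas A : Prop :=
  (forall p : M, exists2 c, A c & chart_dom c p) /\
  (forall c d, A c -> A d ->
     smooth_on (overlap c d) (transition c d) /\
     forall x, overlap c d x -> 0 < \det ('J (transition c d) x)).

Definition vector_field_rep := chart -> 'rV[R]_m -> 'rV[R]_m.
Definition metric_rep := chart -> 'rV[R]_m -> 'M[R]_m.

Definition smooth_vector_field A (X : vector_field_rep) : Prop :=
  (forall c, A c -> smooth_on (chart_im c) (X c)) /\
  (forall c d, A c -> A d -> forall x, overlap c d x ->
     X d (transition c d x) = X c x *m 'J (transition c d) x).

Definition riemannian_metric A (g : metric_rep) : Prop :=
  [/\ forall c, A c -> smooth_on (chart_im c) (g c),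
      forall c, A c -> forall x, chart_im c x -> (g c x)^T = g c x,
      forall c, A c -> forall x, chart_im c x ->
        forall v : 'rV[R]_m, v != 0 -> 0 < inner (g c x) v v
    & forall c d, A c -> A d -> forall x, overlap c d x ->
        g c x = 'J (transition c d) x *m g d (transition c d x)
                *m ('J (transition c d) x)^T].

Definition parallel A (g : metric_rep) (X : vector_field_rep) : Prop :=
  forall c, A c -> forall x, chart_im c x -> nabla (g c) (X c) x = 0.

(* Finite partition of unity by continuous functions, the k-th of which is
   supported in the domain of the chart pu_chart k. *)
Record partition_data := PartitionData {
  pu_size : nat;
  pu_chart : 'I_pu_size -> chart;
  pu_fun : 'I_pu_size -> M -> R
}.

Definition partition_of_unity A (P : partition_data) : Prop :=
  (forall k : 'I_(pu_size P),
     [/\ A (pu_chart k), continuous (pu_fun k),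
         forall p, 0 <= pu_fun k p
       & closure [set p | pu_fun k p != 0] `<=` chart_dom (pu_chart k)]) /\
  (forall p : M, \sum_(k < pu_size P) pu_fun k p = 1).

(* One exists as soon as M is compact Hausdorff and A covers M; the empty
   family is only a default value. *)
Definition chosen_partition A : partition_data :=
  match pselect (exists P, partition_of_unity A P) with
  | left e => projT1 (cid e)
  | right _ =>
      @PartitionData 0 (fun k => False_rect _ (notF (ltn_ord k)))
                       (fun _ _ => 0)
  end.

(* Integral against the Riemannian volume v_g of the function on M whose
   expression in each chart c is f c.  For such a function the value does not
   depend on the partition of unity. *)
Definition manifold_integral A (g : metric_rep)
    (f : chart -> 'rV[R]_m -> R) : R :=
  let P := chosen_partition A in
  \sum_(k < pu_size P)
    let c := pu_chart k in
    iterated_integral (fun x => if x \in chart_im c then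
      pu_fun k (chart_inv c x) * f c x * Num.sqrt (\det (g c x)) else 0).

Definition energy A (g : metric_rep) (d1 d2 : R) (X : vector_field_rep) : R :=
  d1 * manifold_integral A g (fun c =>
         sqnorm_diff (g c) (sasaki (g c)) (graph_map (X c)))
  + d2 * manifold_integral A g (fun c x =>
         let tau := tension (g c) (sasaki (g c)) (graph_map (X c)) x in
         inner (sasaki (g c) (graph_map (X c) x)) tau tau).

(* Smooth variation (V t), |t| < e, of X through vector fields; the coordinates
   of the domain are row_mx t x. *)
Definition variation A (X : vector_field_rep) (e : R)
    (V : R -> vector_field_rep) : Prop :=
  [/\ forall c, A c -> forall x, chart_im c x -> V 0 c x = X c x,
      forall t, `|t| < e -> smooth_vector_field A (V t)
    & forall c, A c ->
        smooth_on
          [set z : 'rV[R]_(1 + m) |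
             `|lsubmx z 0 0| < e /\ chart_im c (rsubmx z)]
          (fun z : 'rV[R]_(1 + m) => V (lsubmx z 0 0) c (rsubmx z))].

Definition interpolating_sesqui_harmonic A (g : metric_rep) (d1 d2 : R)
    (X : vector_field_rep) : Prop :=
  forall (e : R) (V : R -> vector_field_rep), 0 < e -> variation A X e V ->
    is_derive (0 : R) (1 : R) (fun t : R => energy A g d1 d2 (V t) : R) 0.

End Manifold.

Arguments vector_field_rep R M m : clear implicits.
Arguments metric_rep R M m : clear implicits.

(* Main.v *)
Require Import Defs.
From mathcomp Require Import all_boot all_order all_algebra.
From mathcomp Require Import all_classical all_reals all_analysis.
From mathcomp Require Import ring lra.
Import Order.TTheory GRing.Theory Num.Theory.
Import numFieldNormedType.Exports.
Set Implicit Arguments.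
Unset Strict Implicit.
Unset Printing Implicit Defensive.
Local Open Scope classical_set_scope.
Local Open Scope ring_scope.

(** Let [N] be the covariant derivative of a vector field [Y]. The differential of
    the graph of [Y] sends a vector to its horizontal lift plus the vertical lift
    of its covariant derivative, so its squared norm is [m + |N|^2]. The tension
    field of the graph has a vertical part that is linear in [Y] (minus the rough
    Laplacian) and a horizontal part that is quadratic in [Y] (minus the curvature
    term [S]); both vanish where [N] vanishes identically. Hence
      [E(s Y) = d1 (m Vol + s^2 a) + d2 (s^4 b + s^2 c)]
    where [a], [b], [c] are integrals of squared norms, [a] being that of [N].

    If [X] is critical, the variation [(1 + t) X] gives
    [2 (d1 a + d2 c) + 4 d2 b = 0]. As [d1] and [d2] have the same sign, [a] is
    zero, so [N] vanishes in the charts that carry the partition of unity. It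
    vanishes in all charts because it is a tensor.

    Conversely, let [X] be parallel and [V] a variation of [X]. The three densities
    are smooth in time and space, nonnegative, and zero at time zero, so their time
    derivative at time zero is zero and they are [o(t)] uniformly on compact sets.
    The energy then differs from that of [X] by [o(t)].

    The decomposition of the energy ([sqnorm_diff_graph], [sqnorm_tension_graph])
    is computed in coordinates. Pairing the tension field with horizontal and
    vertical lifts turns the Christoffel symbols of the Sasaki metric into symbols
    of the first kind ([inner_tension]), so its inverse never has to be known. The
    same remark, with the symmetry of second derivatives ([partialC]), gives
    tensoriality ([nabla_transition]). The integral in charts is controlled on
    continuous functions of compact support ([iterated_integral_linear],
    [iterated_integral_bounded], [iterated_integral_eq0]), and
    [family_little_o] provides the uniform estimate. *)

(** * Calculus of smooth functions on an open set *)

Section SmoothCalculus.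
Context {R : realType} {n : nat}.
Implicit Types (U : set 'rV[R]_n) (x v : 'rV[R]_n) (i j : 'I_n).

Section Values.
Context {V : normedModType R}.
Implicit Types f g h : 'rV[R]_n -> V.

Lemma near_eq_on U f g x : open U -> (forall y, U y -> f y = g y) -> U x ->
  {near x, f =1 g}.
Proof. by move=> oU fg Ux; near=> y; apply: fg; near: y; apply: open_nbhs_nbhs. 
Unshelve. all: by end_near. Qed.

Lemma partial_eq_on U f g x i : open U -> (forall y, U y -> f y = g y) -> U x ->
  partial i f x = partial i g x.
Proof.
by move=> oU fg Ux; apply: near_eq_derive; exact: near_eq_on fg Ux.
Qed.

Lemma derivable_eq_on U f g x v : open U -> (forall y, U y -> f y = g y) ->
  U x -> derivable f x v -> derivable g x v.
Proof.
by move=> oU fg Ux; apply: near_eq_derivable; exact: near_eq_on fg Ux.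
Qed.

Lemma continuous_eq_on U f g x : open U -> (forall y, U y -> f y = g y) ->
  U x -> {for x, continuous f} -> {for x, continuous g}.
Proof.
move=> oU fg Ux cf; rewrite /prop_for /continuous_at -(fg x Ux).
apply: cvg_trans cf; exact: (near_eq_cvg (near_eq_on oU fg Ux)).
Qed.

(** Iterated partial derivatives of a member of [S] agree on [U] with members of
    [S], because partial derivatives at a point of an open set are local. *)
Lemma smooth_on_coind U (S : ('rV[R]_n -> V) -> Prop) : open U ->
  (forall f, S f -> forall x, U x -> {for x, continuous f}) ->
  (forall f, S f -> forall i,
     (forall x, U x -> derivable f x (delta_mx 0 i)) /\
     exists2 h, S h & forall x, U x -> partial i f x = h x) ->
  forall f, S f -> smooth_on U f.
Proof.
move=> oU Sc Sd f Sf.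
have H s : exists2 h, S h & forall x, U x -> foldr (@partial R n V) f s x = h x.
  elim: s => [|i s [h Sh eh]]; first by exists f.
  have [_ [k Sk ek]] := Sd _ Sh i; exists k => // x Ux /=.
  by rewrite (partial_eq_on i oU eh Ux) ek.
move=> s x Ux; have [h Sh eh] := H s.
have he y : U y -> h y = foldr (@partial R n V) f s y by move=> Uy; rewrite eh.
split; first exact: (continuous_eq_on oU he Ux (Sc _ Sh _ Ux)).
by move=> i; apply: (derivable_eq_on oU he Ux); apply: (Sd _ Sh i).1.
Qed.

Lemma smooth_on_continuous U f x : smooth_on U f -> U x ->
  {for x, continuous f}.
Proof. by move=> sf Ux; have [] := sf [::] x Ux. Qed.

Lemma smooth_on_derivable U f x i : smooth_on U f -> U x ->
  derivable f x (delta_mx 0 i).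
Proof. by move=> sf Ux; have [_] := sf [::] x Ux. Qed.

Lemma smooth_on_partial U f i : smooth_on U f -> smooth_on U (partial i f).
Proof. by move=> sf s x Ux; rewrite -foldr_rcons; exact: sf. Qed.

Lemma smooth_on_eq U f g : open U -> (forall y, U y -> f y = g y) ->
  smooth_on U f -> smooth_on U g.
Proof.
move=> oU fg sf.
apply: (@smooth_on_coind U (fun g => exists2 f,
  smooth_on U f & forall y, U y -> f y = g y)) => //; last by exists f.
- move=> {}g [{}f {}sf {}fg] x Ux; apply: (continuous_eq_on oU fg Ux).
  exact: smooth_on_continuous sf Ux.
- move=> {}g [{}f {}sf {}fg] i; split.
    move=> x Ux; apply: (derivable_eq_on oU fg Ux).
    exact: smooth_on_derivable sf Ux.
  exists (partial i f); last first.
    by move=> x Ux; rewrite (partial_eq_on i oU fg Ux).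
  by exists (partial i f); first exact: (smooth_on_partial i sf).
Qed.

Lemma smooth_on_cst U (a : V) : open U -> smooth_on U (cst a).
Proof.
move=> oU.
apply: (@smooth_on_coind U (fun f => exists b, f = cst b)) => //.
- by move=> f [b ->] x Ux; exact: cst_continuous.
- move=> f [b ->] i; split; first by move=> x _; exact: derivable_cst.
  by exists (cst 0); [exists 0|move=> x _; exact: derive_cst].
- by exists a.
Qed.

End Values.

(** A subring-with-inverses of functions is closed under partial derivatives
    as soon as its generators are. *)
Inductive smooth_algebra U : ('rV[R]_n -> R) -> Prop :=
| smooth_algebra_base f of smooth_on U f : smooth_algebra U f
| smooth_algebra_add f g of smooth_algebra U f & smooth_algebra U g :
    smooth_algebra U (fun x => f x + g x)
| smooth_algebra_mul f g of smooth_algebra U f & smooth_algebra U g :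
    smooth_algebra U (fun x => f x * g x)
| smooth_algebra_inv f of smooth_algebra U f & (forall x, U x -> f x != 0) :
    smooth_algebra U (fun x => (f x)^-1).

Lemma smooth_algebraP U f : open U -> smooth_algebra U f -> smooth_on U f.
Proof.
move=> oU; move: f; apply: smooth_on_coind => //.
- move=> f; elim=> {f} [f sf x Ux|f g _ IHf _ IHg x Ux|f g _ IHf _ IHg x Ux|
    f _ IHf f0 x Ux].
  + exact: smooth_on_continuous sf Ux.
  + by apply: continuousD; [exact: IHf|exact: IHg].
  + by apply: continuousM; [exact: IHf|exact: IHg].
  + by apply: continuousV; [exact: f0|exact: IHf].
- move=> f Sf i; elim: Sf => {f} [f sf|f g Sf [df [f' Sf' ff']] Sg [dg [g' Sg' gg']]|
    f g Sf [df [f' Sf' ff']] Sg [dg [g' Sg' gg']]|f Sf [df [f' Sf' ff']] f0].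
  + split; first by move=> x Ux; exact: smooth_on_derivable sf Ux.
    by exists (partial i f); [constructor; exact: (smooth_on_partial i sf)|].
  + split; first by move=> x Ux; apply: derivableD; [exact: df|exact: dg].
    exists (fun x => f' x + g' x); first exact: smooth_algebra_add.
    move=> x Ux; rewrite /partial deriveD; [|exact: df|exact: dg].
    by rewrite -[X in X + _]/(partial i f x) ff' // -[X in _ + X]/(partial i g x) gg'.
  + split; first by move=> x Ux; apply: derivableM; [exact: df|exact: dg].
    exists (fun x => f x * g' x + g x * f' x).
      by apply: smooth_algebra_add; apply: smooth_algebra_mul.
    move=> x Ux; rewrite /partial deriveM; [|exact: df|exact: dg].
    by rewrite -[X in _ *: X + _]/(partial i g x) gg' // -[X in _ + _ *: X]/(partial i f x) ff'.
  + split.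
      move=> x Ux; apply: (derivableV (f := f)); [exact: f0|exact: df].
    exists (fun x => cst (-1) x * ((f x)^-1 * ((f x)^-1 * f' x))).
      have Si : smooth_algebra U (fun x => (f x)^-1) by apply: smooth_algebra_inv.
      do ![apply: smooth_algebra_mul => //].
      by apply: smooth_algebra_base; exact: smooth_on_cst.
    move=> x Ux; rewrite /partial (deriveV (f:=f)); [|exact: f0|exact: df].
    rewrite -[X in _ *: X]/(partial i f x) ff' //.
    rewrite !fctE /cst mulN1r scaleNr; congr (- _).
    by rewrite /GRing.scale /= expr2 invfM -mulrA.
Qed.

Lemma smooth_onD U (f g : 'rV[R]_n -> R) : open U -> smooth_on U f -> smooth_on U g ->
  smooth_on U (fun x => f x + g x).
Proof. by move=> oU sf sg; apply: smooth_algebraP => //; apply: smooth_algebra_add => //; exact: smooth_algebra_base. Qed.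

Lemma smooth_onM U (f g : 'rV[R]_n -> R) : open U -> smooth_on U f -> smooth_on U g ->
  smooth_on U (fun x => f x * g x).
Proof. by move=> oU sf sg; apply: smooth_algebraP => //; apply: smooth_algebra_mul => //; exact: smooth_algebra_base. Qed.

Lemma smooth_onV U (f : 'rV[R]_n -> R) : open U -> smooth_on U f ->
  (forall x, U x -> f x != 0) -> smooth_on U (fun x => (f x)^-1).
Proof. by move=> oU sf sg; apply: smooth_algebraP => //; apply: smooth_algebra_inv => //; exact: smooth_algebra_base. Qed.

Lemma smooth_onN U (f : 'rV[R]_n -> R) : open U -> smooth_on U f ->
  smooth_on U (fun x => - f x).
Proof.
move=> oU sf; under eq_fun do rewrite -mulN1r.
exact: (@smooth_onM U (cst (-1)) f oU (smooth_on_cst _ oU) sf).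
Qed.

Lemma smooth_onB U (f g : 'rV[R]_n -> R) : open U -> smooth_on U f -> smooth_on U g ->
  smooth_on U (fun x => f x - g x).
Proof. by move=> oU sf sg; exact: (smooth_onD oU sf (smooth_onN oU sg)). Qed.

Lemma smooth_on_sum U (I : Type) (r : seq I) (P : pred I) (F : I -> 'rV[R]_n -> R) :
  open U -> (forall k : I, smooth_on U (F k)) ->
  smooth_on U (fun x => \sum_(k <- r | P k) F k x).
Proof.
move=> oU sF; elim: r => [|k r IH].
  by under eq_fun do rewrite big_nil; exact: smooth_on_cst.
under eq_fun do rewrite big_cons.
by case: (P k); [exact: (smooth_onD oU (sF k) IH)|exact: IH].
Qed.

Lemma smooth_on_prod U (I : Type) (r : seq I) (P : pred I) (F : I -> 'rV[R]_n -> R) :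
  open U -> (forall k : I, smooth_on U (F k)) ->
  smooth_on U (fun x => \prod_(k <- r | P k) F k x).
Proof.
move=> oU sF; elim: r => [|k r IH].
  by under eq_fun do rewrite big_nil; exact: smooth_on_cst.
under eq_fun do rewrite big_cons.
by case: (P k); [exact: (smooth_onM oU (sF k) IH)|exact: IH].
Qed.

Lemma smooth_on_det U p (F : 'rV[R]_n -> 'M[R]_p) : open U ->
  (forall k l, smooth_on U (fun x => F x k l)) ->
  smooth_on U (fun x => \det (F x)).
Proof.
move=> oU sF; apply: smooth_on_sum => // s.
apply: (smooth_onM oU (smooth_on_cst _ oU)).
by apply: smooth_on_prod.
Qed.

Lemma smooth_on_invmx U p (F : 'rV[R]_n -> 'M[R]_p) : open U ->
  (forall k l, smooth_on U (fun x => F x k l)) ->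
  (forall x, U x -> F x \in unitmx) ->
  forall k l, smooth_on U (fun x => invmx (F x) k l).
Proof.
move=> oU sF Fu k l.
apply: (@smooth_on_eq _ _ (fun x => (\det (F x))^-1 * cofactor (F x) l k)) => //.
  by move=> x Ux; rewrite /invmx Fu // !mxE.
apply: (smooth_onM oU).
  apply: (smooth_onV oU (smooth_on_det oU sF)).
  by move=> x /Fu; rewrite unitmxE unitfE.
apply: (smooth_onM oU (smooth_on_cst _ oU)).
apply: (smooth_on_det oU) => a b.
by under eq_fun do rewrite !mxE; exact: sF.
Qed.

Section Entries.
Context {p q : nat}.
Implicit Types F : 'rV[R]_n -> 'M[R]_(p, q).

Lemma partial_entry F x i a b : derivable F x (delta_mx 0 i) ->
  partial i F x a b = partial i (fun y => F y a b) x.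
Proof. by move=> dF; rewrite /partial derive_mx // mxE. Qed.

Lemma smooth_on_entry U F a b : open U -> smooth_on U F ->
  smooth_on U (fun x => F x a b).
Proof.
move=> oU sF.
apply: (@smooth_on_coind _ U (fun f : 'rV[R]_n -> R =>
  exists2 F : 'rV[R]_n -> 'M[R]_(p, q), smooth_on U F & f = fun x => F x a b)) => //;
  last by exists F.
- move=> f [{}F {}sF ->] x Ux.
  apply: (@continuous_comp _ _ _ F (fun M : 'M[R]_(p,q) => M a b)).
    exact: smooth_on_continuous sF Ux.
  exact: coord_continuous.
- move=> f [{}F {}sF ->] i; split.
    by move=> x Ux; apply: (derivable_mxP _ _ _).1; exact: smooth_on_derivable sF Ux.
  exists (fun x => partial i F x a b); last first.
    by move=> x Ux; rewrite partial_entry //; exact: smooth_on_derivable sF Ux.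
  by exists (partial i F); first exact: (smooth_on_partial i sF).
Qed.

Lemma continuous_mx (T : topologicalType) (G : T -> 'M[R]_(p, q)) (x : T) :
  (forall a b, {for x, continuous (fun y => G y a b)}) ->
  {for x, continuous G}.
Proof.
move=> cG; apply/cvgrPdist_le => e e0; near=> y.
rewrite [leLHS]/Num.Def.normr/= mx_normrE (bigmax_le _ (ltW e0))//= => i _.
rewrite !mxE; move: i; near: y; apply: filter_forall => -[a b] /=.
by have /cvgrPdist_le/(_ _ e0) := cG a b.
Unshelve. all: by end_near. Qed.

Lemma smooth_on_mx U F : open U ->
  (forall a b, smooth_on U (fun x => F x a b)) -> smooth_on U F.
Proof.
move=> oU; move: F.
apply: (@smooth_on_coind _ U (fun F : 'rV[R]_n -> 'M[R]_(p, q) =>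
  forall a b, smooth_on U (fun x => F x a b))) => //.
- move=> {}F sF x Ux; apply: continuous_mx => a b.
  exact: smooth_on_continuous (sF a b) Ux.
- move=> {}F sF i; have dF x : U x -> derivable F x (delta_mx 0 i).
    by move=> Ux; apply/derivable_mxP => a b; exact: smooth_on_derivable (sF a b) Ux.
  split; first exact: dF.
  exists (partial i F); last by [].
  move=> a b; apply: (smooth_on_eq oU _ (smooth_on_partial i (sF a b))).
  by move=> x Ux; rewrite partial_entry; [|exact: dF].
Qed.

End Entries.

End SmoothCalculus.

Section Norms.
Context {R : realType} {n : nat}.
Implicit Types v : 'rV[R]_n.

Lemma coord_norm_le v j : `|v 0 j| <= `|v|.
Proof.
rewrite [leRHS]/Num.Def.normr/= mx_normrE.
by apply: le_trans (le_bigmax _ _ (0, j)).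
Qed.

Lemma rV_norm_le v e : 0 <= e -> (forall j, `|v 0 j| <= e) -> `|v| <= e.
Proof.
move=> e0 ve; rewrite [leLHS]/Num.Def.normr/= mx_normrE bigmax_le //.
by move=> -[i j] _ /=; rewrite ord1.
Qed.

Lemma norm_delta_le (i : 'I_n) : `|delta_mx 0 i : 'rV[R]_n| <= 1.
Proof.
apply: rV_norm_le => // j; rewrite mxE eqxx /=.
by case: eqP => _; rewrite ?normr0 ?normr1.
Qed.

End Norms.

Section AffineComposition.
Context {R : realType} {n p : nat} {V : normedModType R}.

(** The derivative along a line only sees the restriction to that line, so
    precomposing with an affine map needs no differentiability. *)
Lemma derive_affine (L : 'rV[R]_n -> 'rV[R]_p) (f : 'rV[R]_p -> V) x v w :
  (forall h : R, L (h *: v + x) = h *: w + L x) ->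
  'D_v (f \o L) x = 'D_w f (L x) /\
  (derivable f (L x) w -> derivable (f \o L) x v).
Proof.
move=> Lx; rewrite /derive /derivable.
set k1 := fun h => h^-1 *: _; set k2 := fun h => h^-1 *: _.
suff -> : k1 = k2 by [].
by apply/funext => h; rewrite /k1 /k2 /= Lx.
Qed.

Lemma smooth_on_affine (L : 'rV[R]_n -> 'rV[R]_p) (dir : 'I_n -> option 'I_p)
    (U : set 'rV[R]_p) (f : 'rV[R]_p -> V) :
  continuous L ->
  (forall i x (h : R), L (h *: delta_mx 0 i + x) =
     h *: (if dir i is Some j then delta_mx 0 j else 0) + L x) ->
  open U -> smooth_on U f -> smooth_on (L @^-1` U) (f \o L).
Proof.
move=> cL Ldir oU sf.
have oLU : open (L @^-1` U) by apply: open_comp => // x _; exact: cL.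
apply: (@smooth_on_coind _ _ _ (L @^-1` U)
  (fun h => exists2 f, smooth_on U f & h = f \o L)) => //; last by exists f.
- move=> _ [{}f {}sf ->] x Ux; apply: continuous_comp; first exact: cL.
  exact: smooth_on_continuous sf Ux.
- move=> _ [{}f {}sf ->] i; split.
    move=> x Ux; apply: (derive_affine f (Ldir i x)).2.
    case: (dir i) => [j|]; last exact: derivable0.
    exact: smooth_on_derivable sf Ux.
  case E : (dir i) => [j|].
    exists (partial j f \o L); first by exists (partial j f) => //; exact: smooth_on_partial.
    by move=> x Ux; rewrite /partial (derive_affine f (Ldir i x)).1 E.
  exists (cst 0 \o L); first by exists (cst 0) => //; exact: smooth_on_cst.
  by move=> x Ux; rewrite /partial (derive_affine f (Ldir i x)).1 E derive0.
Qed.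

End AffineComposition.

Section MeanValue.
Context {R : realType} {n : nat}.
Implicit Types (f : 'rV[R]_n -> R) (x y v : 'rV[R]_n) (i j : 'I_n).

Lemma derivable_along_line f x v (r : R) : derivable f (r *: v + x) v ->
  is_derive r 1 (fun t : R => f (t *: v + x)) ('D_v f (r *: v + x)).
Proof.
move=> df; have E (h : R) : (h *: 1 + r) *: v + x = h *: v + (r *: v + x).
  by rewrite scalerDl addrA [h *: 1]mulr1.
apply: DeriveDef; last first.
  rewrite /derive; set k1 := fun h => h^-1 *: _; set k2 := fun h => h^-1 *: _.
  by suff -> : k1 = k2 by []; apply/funext => h; rewrite /k1 /k2 /= E.
move: df; rewrite /derivable.
set k1 := fun h => h^-1 *: _; set k2 := fun h => h^-1 *: _.
by suff -> : k1 = k2 by []; apply/funext => h; rewrite /k1 /k2 /= E.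
Qed.

(** The mean value theorem is applied on [0, 1] to the reparametrised segment,
    so that the sign of [s] does not matter. *)
Lemma partial_mvt f x i (s : R) :
  (forall r : R, 0 <= r <= 1 -> derivable f ((r * s) *: delta_mx 0 i + x) (delta_mx 0 i)) ->
  exists r : R, 0 <= r <= 1 /\
    f (s *: delta_mx 0 i + x) - f x = s * partial i f ((r * s) *: delta_mx 0 i + x).
Proof.
move=> df; pose F (r : R) := f ((r * s) *: delta_mx 0 i + x).
have dF (r : R) : 0 <= r <= 1 ->
    is_derive r 1 F (partial i f ((r * s) *: delta_mx 0 i + x) * s).
  move=> r01; have := derivable_along_line (df r r01) => H.
  apply: (@is_derive1_comp _ (fun t : R => f (t *: delta_mx 0 i + x)) ( *%R^~ s)) => //.
  have := is_deriveM (is_derive_id r (1 : R)) (is_derive_cst s r (1 : R)).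
  by move=> /is_derive_eq; apply; rewrite scaler0 add0r [_ *: _]mulr1.
have [|||c c01] := @MVT_segment R F
    (fun r => partial i f ((r * s) *: delta_mx 0 i + x) * s) 0 1.
- by [].
- by move=> r; rewrite in_itv /= => /andP[/ltW r0 /ltW r1]; apply: dF; rewrite r0 r1.
- apply: derivable_within_continuous => r; rewrite in_itv /= => r01.
  by have [] := dF r r01.
rewrite /F mul1r mul0r scale0r add0r subr0 mulr1 => ->.
by exists c; rewrite in_itv /= in c01; rewrite mulrC.
Qed.

End MeanValue.

Section Differentiability.
Context {R : realType} {n : nat}.
Implicit Types (U : set 'rV[R]_n) (x y h : 'rV[R]_n) (i j : 'I_n).

Lemma near_close_on U (I : finType) (F : I -> 'rV[R]_n -> R) x (e : R) :
  open U -> U x -> (forall k, {for x, continuous (F k)}) -> 0 < e ->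
  exists2 d : R, 0 < d &
    forall h, `|h| < d -> U (h + x) /\ forall k, `|F k (h + x) - F k x| <= e.
Proof.
move=> oU Ux cF e0.
have : \forall y \near x, U y /\ forall k, `|F k y - F k x| <= e.
  near=> y; split; first by near: y; exact: open_nbhs_nbhs.
  move=> k; rewrite distrC; move: k; near: y; apply: filter_forall => k.
  by have /cvgrPdist_le/(_ _ e0) := cF k.
move=> /nbhs_ballP[d d0 H]; exists d => // h hd; apply: H.
by rewrite -ball_normE /= opprD addrCA subrr addr0 normrN.
Unshelve. all: by end_near. Qed.

Definition trunc (k : nat) h : 'rV[R]_n := \row_j (if (j < k)%N then h 0 j else 0).

Lemma truncS (k : 'I_n) h : trunc k.+1 h = h 0 k *: delta_mx 0 k + trunc k h.
Proof.
apply/rowP => j; rewrite !mxE eqxx /= ltnS leq_eqVlt.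
case: (eqVneq j k) => [->|jk]; first by rewrite eqxx /= ltnn mulr1 addr0.
have -> : (j == k :> nat) = false by apply/negbTE.
by rewrite /= mulr0 add0r.
Qed.

(** Move from [x] to [h + x] one coordinate at a time and apply the mean value
    theorem on each edge. *)
Lemma linear_approximation U (f : 'rV[R]_n -> R) x (e : R) : open U -> U x ->
  smooth_on U f -> 0 < e ->
  exists2 d : R, 0 < d & forall h, `|h| < d ->
    `|f (h + x) - f x - \sum_i h 0 i * partial i f x| <= e * `|h|.
Proof.
move=> oU Ux sf e0.
(* [n.+1] rather than [n], to divide by a positive number when [n] is 0 *)
have en0 : 0 < e / n.+1%:R by rewrite divr_gt0.
have [|d d0 H] := @near_close_on U _ (fun i => partial i f) x _ oU Ux _ en0.
  by move=> i; apply: smooth_on_continuous Ux; exact: smooth_on_partial.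
exists d => // h hd.
have trunc_le k : `|trunc k h| <= `|h|.
  apply: rV_norm_le => // j; rewrite mxE; case: ifP => _; first exact: coord_norm_le.
  by rewrite normr0.
have step (k : 'I_n) : `|f (trunc k.+1 h + x) - f (trunc k h + x) - h 0 k * partial k f x|
    <= e / n.+1%:R * `|h|.
  have in_ball (r : R) : 0 <= r <= 1 -> `|(r * h 0 k) *: delta_mx 0 k + trunc k h| < d.
    move=> /andP[r0 r1]; apply: le_lt_trans hd; apply: rV_norm_le => // j.
    rewrite !mxE eqxx /=; case: (eqVneq j k) => [->|jk].
      rewrite ltnn mulr1 addr0 normrM ger0_norm //.
      apply: le_trans (coord_norm_le h k).
      by rewrite ler_piMl.
    rewrite mulr0 add0r; case: ifP => _; first exact: coord_norm_le.
    by rewrite normr0.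
  have [|r [r01 E]] := @partial_mvt _ _ f (trunc k h + x) k (h 0 k).
    move=> r /in_ball /H[+ _]; rewrite -addrA => Ur.
    exact: smooth_on_derivable sf Ur.
  rewrite truncS -(addrA (_ *: _)) E -mulrBr normrM mulrC.
  have [_ /(_ k)] := H _ (in_ball r r01); rewrite -addrA => Hk.
  by apply: ler_pM => //; exact: coord_norm_le.
have sumE : f (h + x) - f x - \sum_i h 0 i * partial i f x =
    \sum_(k < n) (f (trunc k.+1 h + x) - f (trunc k h + x) - h 0 k * partial k f x).
  rewrite [RHS]big_split /= sumrN; congr (_ - _).
  rewrite -(big_mkord xpredT (fun k => f (trunc k.+1 h + x) - f (trunc k h + x))).
  rewrite telescope_sumr //; congr (f _ - f _).
    by congr (_ + _); apply/rowP => j; rewrite mxE ltn_ord.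
  have -> : trunc 0 h = 0 by apply/rowP => j; rewrite !mxE.
  by rewrite add0r.
rewrite sumE; apply: le_trans (ler_norm_sum _ _ _) _.
apply: (@le_trans _ _ (\sum_(k < n) e / n.+1%:R * `|h|)); first exact: ler_sum.
rewrite sumr_const card_ord -[_ *+ n]mulr_natr mulrAC ler_wpM2r //.
by rewrite -mulrA ler_piMr ?(ltW e0) // mulrC ler_pdivrMr // mul1r ler_nat.
Qed.

Lemma smooth_on_differentiable_rV U p (F : 'rV[R]_n -> 'rV[R]_p) x : open U ->
  smooth_on U F -> U x -> differentiable F x.
Proof.
move=> oU sF Ux.
pose J : 'M[R]_(n, p) := \matrix_(i, k) partial i (fun y => F y 0 k) x.
have cJ : continuous (mulmxr J : 'rV[R]_n -> 'rV[R]_p).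
  move=> y; apply: continuous_mx => a b.
  have -> : (fun y => mulmxr J y a b) = (fun y => \sum_i y a i * J i b).
    by apply/funext => z; rewrite mxE.
  apply: (@cvg_big _ _ +%R 0 xpredT _ _ (nbhs y) _ (fun i (z : 'rV[R]_n) => z a i * J i b)
    (fun i => y a i * J i b)) => [|i _]; first exact: add_continuous.
  by apply: cvgMr_tmp; exact: coord_continuous.
have := @diff_unique R 'rV[R]_n 'rV[R]_p F (mulmxr J) x cJ.
set expansion := (X in ((X -> _) -> _)) => dF_unique.
have dF : expansion.
  rewrite /expansion; apply/eqaddoP => e e0; near=> h.
  rewrite /= !fctE /= /shift /=.
  apply: rV_norm_le => [|k]; first by rewrite mulr_ge0 // ltW.
  rewrite !mxE.
  have -> : \sum_j h 0 j * J j k = \sum_j h 0 j * partial j (fun y => F y 0 k) x.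
    by apply: eq_bigr => j _; rewrite mxE.
  rewrite opprD addrA; move: k; near: h; apply: filter_forall => k.
  have [d d0 H] := linear_approximation oU Ux (smooth_on_entry 0 k oU sF) e0.
  by apply/nbhs_ballP; exists d => // h; rewrite -ball_normE /= sub0r normrN => /H.
by apply/diff_locallyP; rewrite dF_unique.
Unshelve. all: by end_near. Qed.

Lemma smooth_on_differentiable U (f : 'rV[R]_n -> R) x : open U ->
  smooth_on U f -> U x -> differentiable f x.
Proof.
move=> oU sf Ux.
have sF : smooth_on U (fun y => const_mx (f y) : 'rV[R]_1).
  apply: (smooth_on_mx oU) => a b.
  by have -> : (fun y => (const_mx (f y) : 'rV[R]_1) a b) = f by apply/funext => y; rewrite mxE.
have dF := smooth_on_differentiable_rV oU sF Ux.
have -> : f = (fun M : 'rV[R]_1 => M 0 0) \o (fun y => const_mx (f y) : 'rV[R]_1).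
  by apply/funext => y; rewrite /= mxE.
by apply: differentiable_comp => //; exact: differentiable_coord.
Qed.

(** Both mixed derivatives are limits of the same second difference. *)
Lemma second_difference U (f : 'rV[R]_n -> R) x i j (s : R) :
  smooth_on U f ->
  (forall a b : R, 0 <= a <= 1 -> 0 <= b <= 1 ->
     U ((b * s) *: delta_mx 0 j + ((a * s) *: delta_mx 0 i + x))) ->
  exists a b : R, [/\ 0 <= a <= 1, 0 <= b <= 1 &
    f (s *: delta_mx 0 j + (s *: delta_mx 0 i + x)) - f (s *: delta_mx 0 i + x)
      - (f (s *: delta_mx 0 j + x) - f x) =
    s * (s * partial j (partial i f)
       ((b * s) *: delta_mx 0 j + ((a * s) *: delta_mx 0 i + x)))].
Proof.
move=> sf HU; pose L (y : 'rV[R]_n) := s *: delta_mx 0 j + y.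
have H0 : 0 <= (0 : R) <= 1 by rewrite lexx ler01.
have H1 : 0 <= (1 : R) <= 1 by rewrite lexx ler01.
have LE y (h : R) : L (h *: delta_mx 0 i + y) = h *: delta_mx 0 i + L y.
  by rewrite /L addrCA.
have dL y : U (L y) -> derivable (f \o L) y (delta_mx 0 i).
  by move=> Uy; apply: (derive_affine f (LE y)).2; exact: smooth_on_derivable sf Uy.
have [|a [a01 Ea]] := @partial_mvt _ _ (fun y => (f \o L) y - f y) x i s.
  move=> r r01; apply: derivableB.
    by apply: dL; have := HU r 1 r01 H1; rewrite mul1r.
  apply: smooth_on_derivable sf _.
  by have := HU r 0 r01 H0; rewrite mul0r scale0r add0r.
have [|b [b01 Eb]] := @partial_mvt _ _ (partial i f) ((a * s) *: delta_mx 0 i + x) j s.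
  move=> r r01; apply: (@smooth_on_derivable _ _ _ U); first exact: smooth_on_partial.
  exact: HU.
exists a, b; split => //; rewrite -Eb.
transitivity ((f \o L) (s *: delta_mx 0 i + x) - f (s *: delta_mx 0 i + x) -
  ((f \o L) x - f x)) => //.
rewrite Ea; congr (_ * _); rewrite /partial deriveB; last 2 first.
- by apply: dL; have := HU a 1 a01 H1; rewrite mul1r.
- apply: smooth_on_derivable sf _.
  by have := HU a 0 a01 H0; rewrite mul0r scale0r add0r.
by rewrite (derive_affine f (LE _)).1.
Qed.

Lemma partialC U (f : 'rV[R]_n -> R) x i j : open U -> smooth_on U f -> U x ->
  partial i (partial j f) x = partial j (partial i f) x.
Proof.
move=> oU sf Ux; apply/eqP; rewrite -subr_eq0 -normr_le0; apply/ler_addgt0Pl => e e0.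
rewrite addr0.
pose F (k : bool) := if k then partial i (partial j f) else partial j (partial i f).
have e20 : 0 < e / 2 by rewrite divr_gt0.
have close (u p q : R) : `|u - p| <= e / 2 -> `|u - q| <= e / 2 -> `|p - q| <= e.
  move=> up uq; rewrite -(subrKA u) (le_trans (ler_normD _ _)) // [leRHS]splitr.
  by rewrite lerD // distrC.
have [|d d0 H] := @near_close_on U _ F x _ oU Ux _ e20.
  by case; apply: smooth_on_continuous Ux; do 2!apply: smooth_on_partial.
(* the points of the second difference are within [2 * s] of [x] *)
pose s := d / 3.
have s0 : 0 < s by rewrite divr_gt0.
have small (a b : R) (k l : 'I_n) : 0 <= a <= 1 -> 0 <= b <= 1 ->
    `|(b * s) *: delta_mx 0 k + (a * s) *: delta_mx 0 l : 'rV[R]_n| < d.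
  have B (c : R) (p : 'I_n) : 0 <= c <= 1 -> `|(c * s) *: delta_mx 0 p : 'rV[R]_n| <= s.
    move=> /andP[c0 c1]; rewrite normrZ ger0_norm; last by rewrite mulr_ge0 // ltW.
    rewrite -[leRHS]mulr1 ler_pM ?norm_delta_le //; first by rewrite mulr_ge0 // ltW.
    by rewrite ler_piMl // ltW.
  move=> a01 b01; apply: le_lt_trans (ler_normD _ _) _.
  apply: le_lt_trans (lerD (B _ _ b01) (B _ _ a01)) _.
  by rewrite /s; lra.
have [|a [b [a01 b01 E1]]] := @second_difference U f x i j s sf.
  by move=> a b a01 b01; rewrite addrA; apply: (H _ _).1; exact: small.
have [|a' [b' [a01' b01' E2]]] := @second_difference U f x j i s sf.
  by move=> a' b' a01' b01'; rewrite addrA; apply: (H _ _).1; exact: small.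
have E : partial j (partial i f) ((b * s) *: delta_mx 0 j + ((a * s) *: delta_mx 0 i + x)) =
  partial i (partial j f) ((b' * s) *: delta_mx 0 i + ((a' * s) *: delta_mx 0 j + x)).
  apply: (mulfI (lt0r_neq0 s0)); apply: (mulfI (lt0r_neq0 s0)).
  apply: etrans (esym E1) (etrans _ E2).
  have swap (a1 a2 a3 a4 : R) : a1 - a2 - (a3 - a4) = a1 - a3 - (a2 - a4) by ring.
  by rewrite [X in f X - _ - _]addrCA swap.
have [_ /(_ false)] := H _ (small _ _ j i a01 b01); rewrite -addrA /= E.
have [_ /(_ true)] := H _ (small _ _ i j a01' b01'); rewrite -addrA /=.
exact: close.
Qed.

End Differentiability.

(** * Iterated integrals of compactly supported continuous functions *)

Section CompactlySupportedLine.
Context {R : realType}.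
Local Notation mu := (@lebesgue_measure R).
Implicit Types (g : R -> R) (B M : R).

Lemma restrict_segment g B : (forall t, B < `|t| -> g t = 0) ->
  g \_ `[- B, B] = g.
Proof.
move=> g0; apply/funext => t; rewrite patchE; case: ifPn => // /negP tB.
rewrite g0 // ltNge; apply/negP; rewrite ler_norml => tB'.
by apply: tB; rewrite inE /= in_itv.
Qed.

Lemma continuous_integrable_segment g (a b : R) : continuous g ->
  mu.-integrable `[a, b] (EFin \o g).
Proof.
move=> cg; apply: continuous_compact_integrable; first exact: segment_compact.
exact: continuous_subspaceT.
Qed.

Lemma compact_support_integrable g B : continuous g ->
  (forall t, B < `|t| -> g t = 0) -> mu.-integrable setT (EFin \o g).
Proof.
move=> cg g0; rewrite -(restrict_segment g0) -restrict_EFin -integrable_mkcond //.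
exact: continuous_integrable_segment.
Qed.

Lemma segment_length (a b : R) : a <= b -> fine (mu `[a, b]) = b - a.
Proof.
move=> ab; rewrite lebesgue_measure_itv /= lte_fin.
by case: ltgtP ab => [|//|->] //=; rewrite subrr.
Qed.

Lemma Rintegral_bound g B M : continuous g -> 0 <= B ->
  (forall t, B < `|t| -> g t = 0) -> (forall t, `|g t| <= M) ->
  `|\int[mu]_t g t| <= 2 * B * M.
Proof.
move=> cg B0 g0 gM.
have ig := @continuous_integrable_segment g (- B) B cg.
rewrite -[in leLHS](restrict_segment g0) -Rintegral_mkcond.
apply: le_trans (le_normr_Rintegral _ ig) _ => //.
apply: (@le_trans _ _ (\int[mu]_(t in `[- B, B]) M)).
  apply: le_Rintegral => //.
    apply: (@continuous_integrable_segment (fun t => `|g t|)) => t.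
    by apply: continuous_comp; [exact: cg|exact: norm_continuous].
  by apply: continuous_integrable_segment => t; exact: cst_continuous.
rewrite Rintegral_cst // segment_length; last by lra.
by rewrite opprK mulrC mulr_natl mulr2n.
Qed.

(** A positive value persists on a segment of positive length. *)
Lemma Rintegral_eq0 g B : continuous g -> (forall t, B < `|t| -> g t = 0) ->
  (forall t, 0 <= g t) -> \int[mu]_t g t = 0 -> forall t, g t = 0.
Proof.
move=> cg g0 gge0 Ig t; apply/eqP; rewrite eq_le gge0 andbT leNgt; apply/negP => gt0.
have : \forall s \near t, g t / 2 <= g s.
  have /cvgrPdist_le/(_ (g t / 2)) := cg t; rewrite divr_gt0 // => /(_ isT).
  apply: filterS => s; rewrite ler_norml => /andP[_]; lra.
move=> /nbhs_ballP[d /= d0 H].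
have gd s : `[t - d / 2, t + d / 2]%classic s -> g t / 2 <= g s.
  rewrite /= in_itv /= => /andP[s1 s2]; apply: H; rewrite /ball /= ltr_norml.
  by apply/andP; split; lra.
have ig := compact_support_integrable cg g0.
have : \int[mu]_(s in `[t - d / 2, t + d / 2]) (g t / 2) <= \int[mu]_s g s.
  apply: (@le_trans _ _ (\int[mu]_(s in `[t - d / 2, t + d / 2]) g s)).
    apply: le_Rintegral => //.
      by apply: continuous_integrable_segment => s; exact: cst_continuous.
    exact: continuous_integrable_segment.
  rewrite Rintegral_mkcond; apply: le_Rintegral => //.
    rewrite -restrict_EFin -integrable_mkcond //.
    exact: continuous_integrable_segment.
  by move=> s _; rewrite patchE; case: ifP.
rewrite Ig Rintegral_cst // segment_length; last by lra.
have : 0 < g t / 2 * (t + d / 2 - (t - d / 2)) by rewrite mulr_gt0 //; lra.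
by move=> /lt_le_trans /[apply]; rewrite ltxx.
Qed.

End CompactlySupportedLine.

Section IteratedIntegral.
Context {R : realType}.
Local Notation mu := (@lebesgue_measure R).

Definition supported_in_ball n (B : R) (f : 'rV[R]_n -> R) : Prop :=
  forall x, B < `|x| -> f x = 0.

(** A class of integrands that slicing and partial integration preserve. *)
Definition test_function n (f : 'rV[R]_n -> R) : Prop :=
  continuous f /\ exists2 B, 0 <= B & supported_in_ball B f.

Lemma test_function_lin n a (f h : 'rV[R]_n -> R) :
  test_function f -> test_function h -> test_function (fun x => a * f x + h x).
Proof.
move=> [cf [B B0 fB]] [ch [C C0 hC]]; split.
  move=> x; apply: (@continuousD _ _ _ (fun x => a * f x) h); last exact: ch.
  by apply: (@continuousM _ _ (cst a) f x); [exact: cst_continuous|exact: cf].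
exists (B + C); first exact: addr_ge0.
move=> x xBC; rewrite fB ?hC ?mulr0 ?addr0 //; apply: le_lt_trans xBC.
  by rewrite lerDr.
by rewrite lerDl.
Qed.

Section Slices.
Context {n : nat}.
Implicit Types (f : 'rV[R]_n.+1 -> R) (t s : R) (x y : 'rV[R]_n).

Definition cons_coord t y : 'rV[R]_n.+1 := row_mx (t%:M : 'rV[R]_1) y.

Definition slice f t y : R := f (cons_coord t y).

Lemma cons_coord0 t y : cons_coord t y 0 0 = t.
Proof.
rewrite /cons_coord; have -> : (0 : 'I_n.+1) = lshift n (0 : 'I_1) by apply: val_inj.
by rewrite (row_mxEl (t%:M : 'rV[R]_1)) mxE.
Qed.

Lemma cons_coordS t y j : cons_coord t y 0 (rshift 1 j) = y 0 j.
Proof. by rewrite /cons_coord (row_mxEr (t%:M : 'rV[R]_1)). Qed.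

Lemma norm_head_le t y : `|t| <= `|cons_coord t y|.
Proof. by rewrite -{1}(cons_coord0 t y) coord_norm_le. Qed.

Lemma norm_tail_le t y : `|y| <= `|cons_coord t y|.
Proof.
apply: rV_norm_le => // j; rewrite -(cons_coordS t); exact: coord_norm_le.
Qed.

Lemma ordS_ind (P : 'I_n.+1 -> Prop) :
  P 0 -> (forall j : 'I_n, P (rshift 1 j)) -> forall i, P i.
Proof.
move=> P0 PS i; case: (@split_ordP 1 n i) => j ->; last exact: PS.
by have -> : lshift n j = 0 :> 'I_n.+1 by apply: val_inj; rewrite /= ord1.
Qed.

Lemma cons_coord_continuous :
  continuous (fun ty : R * 'rV[R]_n => cons_coord ty.1 ty.2).
Proof.
move=> [s y]; apply: continuous_mx => a; rewrite ord1 {a}; apply: ordS_ind => [|j].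
  have -> : (fun ty : R * 'rV[R]_n => cons_coord ty.1 ty.2 0 0) = fst.
    by apply/funext => ty; exact: cons_coord0.
  exact: cvg_fst.
have -> : (fun ty : R * 'rV[R]_n => cons_coord ty.1 ty.2 0 (rshift 1 j)) =
    (fun y => y 0 j) \o snd.
  by apply/funext => ty; exact: cons_coordS.
by apply: continuous_comp; [exact: cvg_snd|exact: coord_continuous].
Qed.

Lemma cons_coord_continuousr t : continuous (cons_coord t).
Proof.
move=> y; apply: continuous_mx => a; rewrite ord1 {a}; apply: ordS_ind => [|j].
  have -> : (fun y => cons_coord t y 0 0) = cst t.
    by apply/funext => z; exact: cons_coord0.
  exact: cst_continuous.
have -> : (fun y => cons_coord t y 0 (rshift 1 j)) = (fun y => y 0 j).
  by apply/funext => z; exact: cons_coordS.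
exact: coord_continuous.
Qed.

Lemma slice_continuous f t : continuous f -> continuous (slice f t).
Proof.
move=> cf y; apply: (@continuous_comp _ _ _ (cons_coord t) f); last exact: cf.
exact: cons_coord_continuousr.
Qed.

Lemma slice_supported f B t : supported_in_ball B f -> supported_in_ball B (slice f t).
Proof. by move=> fB y yB; apply: fB; apply: lt_le_trans yB (norm_tail_le t y). Qed.

Lemma slice_test f t : test_function f -> test_function (slice f t).
Proof.
move=> [cf [B B0 fB]]; split; first exact: slice_continuous.
by exists B => //; exact: slice_supported.
Qed.

Lemma ball_compact B : compact [set y : 'rV[R]_n | `|y| <= B].
Proof.
apply: bounded_closed_compact.
  by exists B; split; [exact: num_real|move=> C BC y /le_trans; apply; exact: ltW].
apply: (preimage_closed _ (@closed_le _ B)) => y _; exact: norm_continuous.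
Qed.

(** Joint continuity at the points [(s, y)] becomes uniform in [y] because the
    slices vanish outside a compact ball. *)
Lemma slice_uniform f B s e : continuous f -> supported_in_ball B f -> 0 < e ->
  \forall t \near s, forall y, `|slice f t y - slice f s y| <= e.
Proof.
move=> cf fB e0; have e20 : 0 < e / 2 by rewrite divr_gt0.
have : \forall t \near s, [set y : 'rV[R]_n | `|y| <= B] `<=`
    (fun y => `|slice f t y - slice f s y| <= e).
  have /compact_near_coveringP cover := @ball_compact B.
  apply: (cover R (nbhs s) (fun t y => `|slice f t y - slice f s y| <= e)).
  move=> y _.
  have cy : {for (s, y), continuous (fun ty : R * 'rV[R]_n => f (cons_coord ty.1 ty.2))}.
    by apply: continuous_comp; [exact: cons_coord_continuous|exact: cf].
  have /cvgrPdist_le/(_ _ e20)[[P Q] /= [Ps Qy] PQ] := cy.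
  exists (Q, P) => //= -[y' t] [/= Qy' Pt].
  have A : `|f (cons_coord s y) - f (cons_coord t y')| <= e / 2 by apply: (PQ (t, y')).
  have C : `|f (cons_coord s y) - f (cons_coord s y')| <= e / 2.
    by apply: (PQ (s, y')); split => //; exact: nbhs_singleton.
  rewrite /slice -(subrKA (f (cons_coord s y))) (le_trans (ler_normD _ _)) //.
  by rewrite [leRHS]splitr lerD // distrC.
apply: filterS => t H y; have [yB|yB] := leP `|y| B; first exact: H.
by rewrite !(slice_supported _ fB) // subrr normr0 ltW.
Qed.

End Slices.

Definition integral_linear n := forall a (f h : 'rV[R]_n -> R),
  test_function f -> test_function h ->
  iterated_integral (fun x => a * f x + h x) =
  a * iterated_integral f + iterated_integral h.

Definition integral_bounded n := forall (f : 'rV[R]_n -> R) B M,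
  test_function f -> 0 <= B -> supported_in_ball B f -> (forall x, `|f x| <= M) ->
  `|iterated_integral f| <= (2 * B) ^+ n * M.

Lemma iterated_integralS n (f : 'rV[R]_n.+1 -> R) :
  iterated_integral f = \int[mu]_t iterated_integral (slice f t).
Proof. by []. Qed.

(** Close slices have close integrals, by the bound applied to their
    difference. *)
Lemma slice_integral_test n (f : 'rV[R]_n.+1 -> R) :
  integral_linear n -> integral_bounded n -> test_function f ->
  continuous (fun t => iterated_integral (slice f t)) /\
  forall B, 0 <= B -> supported_in_ball B f ->
    forall t, B < `|t| -> iterated_integral (slice f t) = 0.
Proof.
move=> lin bnd tf; have [cf [B B0 fB]] := tf; split; last first.
  move=> C C0 fC t tC; apply/eqP; rewrite -normr_le0.
  rewrite -(mulr0 ((2 * C) ^+ n)); apply: bnd => //; first exact: slice_test.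
    exact: slice_supported.
  by move=> y; rewrite /slice fC ?normr0 // (lt_le_trans tC) // norm_head_le.
move=> s; apply/cvgrPdist_le => e e0.
(* adding 1 covers the degenerate ball [B = 0] *)
have K0 : 0 < (2 * B) ^+ n + 1 by rewrite ltr_wpDl // exprn_ge0 // mulr_ge0.
have d0 : 0 < e / ((2 * B) ^+ n + 1) by rewrite divr_gt0.
near=> t; rewrite distrC.
have -> : iterated_integral (slice f t) - iterated_integral (slice f s) =
    iterated_integral (fun y => (-1) * slice f s y + slice f t y).
  by rewrite lin ?mulN1r 1?addrC //; exact: slice_test.
apply: le_trans (bnd _ B (e / ((2 * B) ^+ n + 1)) _ B0 _ _) _.
- by apply: test_function_lin; exact: slice_test.
- by move=> y yB; rewrite !(slice_supported _ fB) // mulr0 addr0.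
- move=> y; rewrite mulN1r addrC; move: y; near: t; exact: slice_uniform fB d0.
- by rewrite mulrCA ger_pMr // ler_pdivrMr // mul1r lerDl.
Unshelve. all: by end_near. Qed.

(** Linearity and the bound are proved together: in dimension [n] both are used
    to see that the partial integrals in dimension [n.+1] are continuous, hence
    integrable. *)
Lemma iterated_integral_lin_bnd n : integral_linear n /\ integral_bounded n.
Proof.
elim: n => [|n [lin bnd]].
  by split => // f B M _ _ _ fM /=; rewrite expr0 mul1r; exact: fM.
split.
- move=> a f h tf th; rewrite !iterated_integralS.
  have [cf sf] := slice_integral_test lin bnd tf.
  have [ch sh] := slice_integral_test lin bnd th.
  have [_ [B B0 fB]] := tf; have [_ [C C0 hC]] := th.
  have intf := compact_support_integrable cf (sf _ B0 fB).
  have inth := compact_support_integrable ch (sh _ C0 hC).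
  rewrite -RintegralZl // -RintegralD //; last first.
    apply: (@compact_support_integrable _ (fun t => a * iterated_integral (slice f t)) B).
      move=> t; apply: (@continuousM _ _ (cst a) (fun t => iterated_integral (slice f t))).
        exact: cst_continuous.
      exact: cf.
    by move=> t tB; rewrite (sf _ B0 fB) // mulr0.
  by apply: eq_Rintegral => t _; rewrite -lin //; exact: slice_test.
- move=> f B M tf B0 fB fM; rewrite iterated_integralS.
  have [cf sf] := slice_integral_test lin bnd tf.
  rewrite exprS -mulrA; apply: Rintegral_bound => //; first exact: sf.
  move=> t; apply: bnd => //; [exact: slice_test|exact: slice_supported|].
  by move=> y; exact: fM.
Qed.

Lemma iterated_integral_linear n a (f h : 'rV[R]_n -> R) :
  test_function f -> test_function h ->
  iterated_integral (fun x => a * f x + h x) =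
  a * iterated_integral f + iterated_integral h.
Proof. exact: (iterated_integral_lin_bnd n).1. Qed.

Lemma iterated_integral_bounded n (f : 'rV[R]_n -> R) B M :
  test_function f -> 0 <= B -> supported_in_ball B f -> (forall x, `|f x| <= M) ->
  `|iterated_integral f| <= (2 * B) ^+ n * M.
Proof. exact: (iterated_integral_lin_bnd n).2. Qed.

Lemma iterated_integral_ge0 n (f : 'rV[R]_n -> R) :
  (forall x, 0 <= f x) -> 0 <= iterated_integral f.
Proof.
elim: n f => [|n IH] f f0; first exact: f0.
by rewrite iterated_integralS; apply: Rintegral_ge0 => t _; apply: IH => y; exact: f0.
Qed.

Lemma iterated_integral_eq0 n (f : 'rV[R]_n -> R) : test_function f ->
  (forall x, 0 <= f x) -> iterated_integral f = 0 -> forall x, f x = 0.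
Proof.
elim: n f => [|n IH] f tf f0 If x; first by rewrite -If /= [x]thinmx0.
have [lin bnd] := iterated_integral_lin_bnd n.
have [cf sf] := slice_integral_test lin bnd tf.
have [_ [B B0 fB]] := tf.
have S0 t : iterated_integral (slice f t) = 0.
  apply: (Rintegral_eq0 cf (sf _ B0 fB)) => // s.
  by apply: iterated_integral_ge0 => y; exact: f0.
have -> : x = cons_coord (x 0 0) (\row_j x 0 (rshift 1 j)).
  apply/rowP; apply: ordS_ind => [|j]; first by rewrite cons_coord0.
  by rewrite cons_coordS mxE.
apply: (IH (slice f _)) => //; first exact: slice_test.
by move=> y; exact: f0.
Qed.

End IteratedIntegral.

(** * Positive definite matrices *)

Section LinearAlgebra.
Context {R : realType}.

Section Inner.
Context {n : nat}.
Implicit Types (A B : 'M[R]_n) (u v w : 'rV[R]_n).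

Lemma innerE A u v : inner A u v = \sum_i \sum_j u 0 i * A i j * v 0 j.
Proof.
rewrite /inner mxE exchange_big /=; apply: eq_bigr => j _.
by rewrite !mxE mulr_suml.
Qed.

Lemma innerDl A u v w : inner A (u + v) w = inner A u w + inner A v w.
Proof. by rewrite /inner !mulmxDl mxE. Qed.

Lemma innerDm A B u v : inner (A + B) u v = inner A u v + inner B u v.
Proof. by rewrite /inner mulmxDr mulmxDl mxE. Qed.

Lemma inner0l A v : inner A 0 v = 0.
Proof. by rewrite /inner !mul0mx mxE. Qed.

Lemma inner0r A v : inner A v 0 = 0.
Proof. by rewrite /inner trmx0 mulmx0 mxE. Qed.

Lemma inner0m u v : inner 0 u v = 0.
Proof. by rewrite /inner mulmx0 mul0mx mxE. Qed.

Lemma innerZl A a u v : inner A (a *: u) v = a * inner A u v.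
Proof. by rewrite /inner -!scalemxAl mxE. Qed.

Lemma innerZr A a u v : inner A u (a *: v) = a * inner A u v.
Proof. by rewrite /inner linearZ /= -scalemxAr mxE. Qed.

Lemma innerZm A a u v : inner (a *: A) u v = a * inner A u v.
Proof. by rewrite /inner -scalemxAr -scalemxAl mxE. Qed.

Lemma inner_suml A (I : Type) (r : seq I) (P : pred I) (F : I -> 'rV[R]_n) v :
  inner A (\sum_(i <- r | P i) F i) v = \sum_(i <- r | P i) inner A (F i) v.
Proof. by rewrite /inner !mulmx_suml summxE. Qed.

Lemma inner_sumr A (I : Type) (r : seq I) (P : pred I) (F : I -> 'rV[R]_n) v :
  inner A v (\sum_(i <- r | P i) F i) = \sum_(i <- r | P i) inner A v (F i).
Proof. by rewrite /inner linear_sum mulmx_sumr summxE. Qed.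

Lemma inner_summ (I : Type) (r : seq I) (P : pred I) (F : I -> 'M[R]_n) u v :
  inner (\sum_(i <- r | P i) F i) u v = \sum_(i <- r | P i) inner (F i) u v.
Proof. by rewrite /inner mulmx_sumr mulmx_suml summxE. Qed.

Lemma innerC A u v : A^T = A -> inner A u v = inner A v u.
Proof.
move=> As; transitivity ((u *m A *m v^T)^T 0 0); first by rewrite mxE.
by rewrite !trmx_mul trmxK As mulmxA.
Qed.

Lemma inner_delta A i j : inner A (delta_mx 0 i) (delta_mx 0 j) = A i j.
Proof. by rewrite /inner -rowE trmx_delta -colE !mxE. Qed.

Lemma inner_deltar A u j : inner A u (delta_mx 0 j) = (u *m A) 0 j.
Proof. by rewrite /inner trmx_delta -colE mxE. Qed.

Lemma inner_congr m (B : 'M[R]_(n, m)) (A : 'M[R]_m) u v :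
  inner (B *m A *m B^T) u v = inner A (u *m B) (v *m B).
Proof. by rewrite /inner trmx_mul !mulmxA. Qed.

(** Lowering the index of a vector is an isometry onto covectors. *)
Lemma inner_invmx A u : A \in unitmx -> A^T = A ->
  inner (invmx A) (u *m A) (u *m A) = inner A u u.
Proof.
by move=> Au As; rewrite /inner mulmxK // trmx_mul As mulmxA.
Qed.

End Inner.

Definition posdef n (A : 'M[R]_n) : Prop := forall v, v != 0 -> 0 < inner A v v.

Lemma posdef_ge0 n (A : 'M[R]_n) v : posdef A -> 0 <= inner A v v.
Proof.
by move=> Ap; case: (eqVneq v 0) => [->|/Ap/ltW //]; rewrite inner0l.
Qed.

Lemma posdef_eq0 n (A : 'M[R]_n) v : posdef A -> inner A v v = 0 -> v = 0.
Proof.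
move=> Ap v0; apply/eqP; apply: contraT => /Ap; by rewrite v0 ltxx.
Qed.

Lemma posdef_unitmx n (A : 'M[R]_n) : posdef A -> A \in unitmx.
Proof.
move=> Ap; rewrite -row_free_unit -kermx_eq0; apply/eqP/row_matrixP => i.
rewrite row0; apply: (posdef_eq0 Ap).
by rewrite /inner -row_mul mulmx_ker row0 mul0mx mxE.
Qed.

(** Peel off one coordinate at a time: the Schur complement of a positive
    definite matrix is positive definite. *)
Lemma posdef_factor n (A : 'M[R]_n) : A^T = A -> posdef A ->
  exists C : 'M[R]_n, A = C *m C^T.
Proof.
elim: n A => [|n IH] A As Ap.
  by exists 0; apply/matrixP => -[].
pose A' : 'M[R]_(1 + n) := A.
have Ap' : @posdef (1 + n) A' by [].
pose a := ulsubmx A'; pose b := ursubmx A'; pose D := drsubmx A'.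
have bT : dlsubmx A' = b^T by rewrite /b trmx_ursub; congr dlsubmx.
have DT : D^T = D by rewrite /D trmx_drsub; congr drsubmx.
have EA : A' = block_mx a b b^T D by rewrite -bT submxK.
pose al := a 0 0.
have aE : a = al%:M by rewrite [a]mx11_scalar.
have al0 : 0 < al.
  have e0 : (row_mx 1%:M 0 : 'rV[R]_(1 + n)) != 0.
    apply/eqP => /(congr1 (fun v : 'rV_(1 + n) => v 0 (lshift n 0))).
    by rewrite row_mxEl !mxE eqxx => /eqP; rewrite oner_eq0.
  have := Ap' _ e0; rewrite /inner EA mul_row_block tr_row_mx mul_row_col.
  by rewrite !mul1mx !mul0mx addr0 trmx0 mulmx0 addr0 trmx1 mulmx1.
pose S := D - al^-1 *: (b^T *m b).
have ST : S^T = S.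
  by rewrite /S linearB /= DT linearZ /= trmx_mul trmxK.
have Sp : posdef S.
  move=> w w0; pose v : 'rV[R]_(1 + n) := row_mx (- al^-1 *: (w *m b^T)) w.
  have v0 : v != 0.
    apply: contra w0 => /eqP /(congr1 (@rsubmx R 1 1 n)).
    by rewrite row_mxKr => ->; apply/eqP/rowP => j; rewrite !mxE.
  have := Ap' _ v0; suff -> : inner A' v v = inner S w w by [].
  rewrite /inner EA mul_row_block tr_row_mx mul_row_col aE.
  rewrite mul_mx_scalar scalerA mulrN mulfV ?gt_eqF // scaleN1r addNr mul0mx add0r.
  by rewrite /S mulmxBr -scalemxAl -scalemxAr mulmxA scaleNr addrC.
have [C' SC] := IH S ST Sp.
pose s := Num.sqrt al.
have s0 : s != 0 by rewrite gt_eqF // sqrtr_gt0.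
have ss : s * s = al by rewrite -expr2 sqr_sqrtr // ltW.
pose C : 'M[R]_(1 + n) := block_mx (s%:M : 'M[R]_1) 0 (s^-1 *: b^T) C'.
suff factA : A' = C *m C^T by exists C.
rewrite EA /C tr_block_mx mulmx_block trmx0 !mulmx0 !mul0mx !addr0.
rewrite tr_scalar_mx -scalar_mxM ss aE; congr block_mx.
- by rewrite linearZ /= trmxK mul_scalar_mx scalerA mulfV // scale1r.
- by rewrite mul_mx_scalar scalerA mulfV // scale1r.
- rewrite -SC linearZ /= trmxK -scalemxAl -scalemxAr scalerA -invfM ss.
  by rewrite /S addrCA subrr addr0.
Qed.

Lemma posdef_det_gt0 n (A : 'M[R]_n) : A^T = A -> posdef A -> 0 < \det A.
Proof.
move=> As Ap; have [C factA] := posdef_factor As Ap.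
rewrite lt0r -unitfE -unitmxE posdef_unitmx // factA det_mulmx det_tr.
by rewrite -expr2 sqr_ge0.
Qed.

Lemma posdef_invmx n (A : 'M[R]_n) : A^T = A -> posdef A -> posdef (invmx A).
Proof.
move=> As Ap v v0; have Au := posdef_unitmx Ap.
rewrite -[v](mulmxKV Au) inner_invmx //; apply: Ap.
by apply: contra v0 => /eqP v0; rewrite -[v](mulmxKV Au) v0 mul0mx.
Qed.

Lemma sym_invmx n (A : 'M[R]_n) : A^T = A -> (invmx A)^T = invmx A.
Proof. by move=> As; rewrite trmx_inv As. Qed.

(** Squared norm of a matrix whose rows are measured by [B] and whose row
    indices are contracted by [A]. *)
Definition double_norm m n (A : 'M[R]_m) (B : 'M[R]_n) (N : 'M[R]_(m, n)) : R :=
  \sum_i \sum_j A i j * inner B (row i N) (row j N).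

(** A factor [C] of the metric plays the role of an orthonormal frame. *)
Lemma double_norm_factor m n (C : 'M[R]_m) (B : 'M[R]_n) (N : 'M[R]_(m, n)) :
  double_norm (C *m C^T) B N = \sum_k inner B (row k (C^T *m N)) (row k (C^T *m N)).
Proof.
have rowE k : row k (C^T *m N) = \sum_i C i k *: row i N.
  by rewrite row_mul mulmx_sum_row; apply: eq_bigr => i _; rewrite !mxE.
transitivity (\sum_k \sum_i \sum_j C i k * C j k * inner B (row i N) (row j N)).
  rewrite exchange_big /=; apply: eq_bigr => i _.
  rewrite exchange_big /=; apply: eq_bigr => j _.
  by rewrite mxE mulr_suml; apply: eq_bigr => k _; rewrite mxE.
apply: eq_bigr => k _; rewrite rowE inner_suml; apply: eq_bigr => i _.
rewrite innerZl inner_sumr mulr_sumr; apply: eq_bigr => j _.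
by rewrite innerZr mulrA.
Qed.

Lemma double_norm_ge0 m n (A : 'M[R]_m) (B : 'M[R]_n) (N : 'M[R]_(m, n)) :
  A^T = A -> posdef A -> posdef B -> 0 <= double_norm A B N.
Proof.
move=> As Ap Bp; have [C ->] := posdef_factor As Ap.
by rewrite double_norm_factor; apply: sumr_ge0 => k _; exact: posdef_ge0.
Qed.

Lemma double_norm_eq0 m n (A : 'M[R]_m) (B : 'M[R]_n) (N : 'M[R]_(m, n)) :
  A^T = A -> posdef A -> posdef B -> double_norm A B N = 0 -> N = 0.
Proof.
move=> As Ap Bp; have Au := posdef_unitmx Ap.
have [C factA] := posdef_factor As Ap; rewrite factA double_norm_factor => /eqP.
rewrite psumr_eq0 => [/allP rows0|k _]; last exact: posdef_ge0.
have CN : C^T *m N = 0.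
  apply/row_matrixP => k; rewrite row0; apply: (posdef_eq0 Bp).
  by have /eqP := rows0 k (mem_index_enum k).
by rewrite -[N](mulKmx Au) [in A *m N]factA -(mulmxA C) CN !mulmx0.
Qed.

End LinearAlgebra.

(** * Partial derivatives of matrix-valued functions *)

Section PartialRules.
Context {R : realType} {n : nat}.
Implicit Types (U : set 'rV[R]_n) (x : 'rV[R]_n) (i : 'I_n).

Lemma partialD {V : normedModType R} (f g : 'rV[R]_n -> V) x i :
  derivable f x (delta_mx 0 i) -> derivable g x (delta_mx 0 i) ->
  partial i (fun y => f y + g y) x = partial i f x + partial i g x.
Proof. by move=> df dg; rewrite /partial deriveD. Qed.

Lemma partialM (f g : 'rV[R]_n -> R) x i :
  derivable f x (delta_mx 0 i) -> derivable g x (delta_mx 0 i) ->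
  partial i (fun y => f y * g y) x = partial i f x * g x + f x * partial i g x.
Proof.
move=> df dg; apply: etrans (deriveM df dg) _; rewrite addrC.
by congr (_ + _); exact: mulrC.
Qed.

Lemma partial_cst {V : normedModType R} (a : V) x i : partial i (cst a) x = 0.
Proof. exact: derive_cst. Qed.

Lemma partialZ (a : R) (f : 'rV[R]_n -> R) x i :
  derivable f x (delta_mx 0 i) ->
  partial i (fun y => a * f y) x = a * partial i f x.
Proof. by move=> df; exact: (deriveZ a df). Qed.

Lemma partial_sum p (f : 'I_p -> 'rV[R]_n -> R) x i :
  (forall k, derivable (f k) x (delta_mx 0 i)) ->
  partial i (fun y => \sum_k f k y) x = \sum_k partial i (f k) x.
Proof.
move=> df; apply: etrans (derive_sum df); congr (derive _ _ _).
by apply/funext => y; rewrite fct_sumE.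
Qed.

Lemma smooth_on_mulmx p q r U (A : 'rV[R]_n -> 'M[R]_(p, q)) (B : 'rV[R]_n -> 'M[R]_(q, r)) :
  open U -> smooth_on U A -> smooth_on U B -> smooth_on U (fun x => A x *m B x).
Proof.
move=> oU sA sB; apply: (smooth_on_mx oU) => a b.
have -> : (fun x => (A x *m B x) a b) = (fun x => \sum_j A x a j * B x j b).
  by apply/funext => x; rewrite mxE.
apply: (smooth_on_sum _ _ oU) => j.
exact: (smooth_onM oU (smooth_on_entry a j oU sA) (smooth_on_entry j b oU sB)).
Qed.

Lemma smooth_on_trmx p q U (A : 'rV[R]_n -> 'M[R]_(p, q)) :
  open U -> smooth_on U A -> smooth_on U (fun x => (A x)^T).
Proof.
move=> oU sA; apply: (smooth_on_mx oU) => a b.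
have -> : (fun x => (A x)^T a b) = (fun x => A x b a) by apply/funext => x; rewrite mxE.
exact: smooth_on_entry.
Qed.

Lemma derivable_mulmx p q r (A : 'rV[R]_n -> 'M[R]_(p, q))
    (B : 'rV[R]_n -> 'M[R]_(q, r)) x i :
  derivable A x (delta_mx 0 i) -> derivable B x (delta_mx 0 i) ->
  derivable (fun y => A y *m B y) x (delta_mx 0 i) /\
  partial i (fun y => A y *m B y) x = partial i A x *m B x + A x *m partial i B x.
Proof.
move=> dA dB; have dAe := (derivable_mxP A x (delta_mx 0 i)).1 dA.
have dBe := (derivable_mxP B x (delta_mx 0 i)).1 dB.
have entryE a b : (fun y => (A y *m B y) a b) = (fun y => \sum_j A y a j * B y j b).
  by apply/funext => y; rewrite mxE.
have dABe a b j := derivableM (dAe a j) (dBe j b).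
have dAB : derivable (fun y => A y *m B y) x (delta_mx 0 i).
  apply/derivable_mxP => a b; rewrite entryE.
  have -> : (fun y => \sum_j A y a j * B y j b) = \sum_j (fun y => A y a j * B y j b).
    by apply/funext => y; rewrite fct_sumE.
  exact: derivable_sum (dABe a b).
split=> //; apply/matrixP => a b; rewrite (partial_entry a b dAB) entryE.
rewrite partial_sum => [|j]; last exact: dABe.
rewrite !mxE -big_split /=; apply: eq_bigr => j _.
rewrite partialM; [|exact: dAe|exact: dBe].
by rewrite -(partial_entry a j dA) -(partial_entry j b dB).
Qed.

Lemma partial_mulmx p q r U (A : 'rV[R]_n -> 'M[R]_(p, q))
    (B : 'rV[R]_n -> 'M[R]_(q, r)) x i :
  open U -> smooth_on U A -> smooth_on U B -> U x ->
  partial i (fun y => A y *m B y) x = partial i A x *m B x + A x *m partial i B x.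
Proof.
move=> oU sA sB Ux.
exact: (derivable_mulmx (smooth_on_derivable sA Ux) (smooth_on_derivable sB Ux)).2.
Qed.

Lemma derivable_trmx p q (A : 'rV[R]_n -> 'M[R]_(p, q)) x i :
  derivable A x (delta_mx 0 i) ->
  derivable (fun y => (A y)^T) x (delta_mx 0 i) /\
  partial i (fun y => (A y)^T) x = (partial i A x)^T.
Proof.
move=> dA; have entryE a b : (fun y => (A y)^T a b) = (fun y => A y b a).
  by apply/funext => y; rewrite mxE.
have dT : derivable (fun y => (A y)^T) x (delta_mx 0 i).
  by apply/derivable_mxP => a b; rewrite entryE; exact: (derivable_mxP A _ _).1.
split=> //; apply/matrixP => a b; rewrite (partial_entry a b dT) entryE.
by rewrite mxE (partial_entry b a dA).
Qed.

Lemma partial_trmx p q U (A : 'rV[R]_n -> 'M[R]_(p, q)) x i :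
  smooth_on U A -> U x ->
  partial i (fun y => (A y)^T) x = (partial i A x)^T.
Proof. by move=> sA Ux; exact: (derivable_trmx (smooth_on_derivable sA Ux)).2. Qed.

Lemma derivable_coord x i j : derivable (fun y : 'rV[R]_n => y 0 j) x (delta_mx 0 i).
Proof. by apply: (derivable_mxP id x (delta_mx 0 i)).1; exact: derivable_id. Qed.

Lemma partial_coord x i j : partial i (fun y : 'rV[R]_n => y 0 j) x = (i == j)%:R.
Proof.
rewrite -(@partial_entry _ _ _ _ id) /partial; last exact: derivable_id.
by rewrite derive_id mxE eqxx eq_sym.
Qed.

Lemma smooth_on_coord U j : open U -> smooth_on U (fun x => x 0 j).
Proof.
move=> oU.
apply: (@smooth_on_coind _ _ _ U (fun f : 'rV[R]_n -> R =>
  f = (fun x => x 0 j) \/ smooth_on U f) oU) => [f [->|sf] x Ux|f [->|sf] i|].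
- exact: coord_continuous.
- exact: smooth_on_continuous sf Ux.
- split; first by move=> x _; exact: derivable_coord.
  exists (cst (i == j)%:R); last by move=> x _; exact: partial_coord.
  by right; exact: (smooth_on_cst _ oU).
- split; first by move=> x Ux; exact: smooth_on_derivable sf Ux.
  exists (partial i f); last by [].
  by right; exact: (smooth_on_partial i sf).
- by left.
Qed.

End PartialRules.

Section Submatrices.
Context {R : realType} {p q : nat} {V : normedModType R}.
Implicit Types (f : 'rV[R]_p -> V) (h : 'rV[R]_q -> V).

Lemma lsubmx_continuous : continuous (@lsubmx R 1 p q).
Proof.
move=> z; apply: continuous_mx => a b.
have -> : (fun z : 'rV[R]_(p + q) => lsubmx z a b) = (fun z => z a (lshift q b)).
  by apply/funext => y; rewrite mxE.
exact: coord_continuous.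
Qed.

Lemma rsubmx_continuous : continuous (@rsubmx R 1 p q).
Proof.
move=> z; apply: continuous_mx => a b.
have -> : (fun z : 'rV[R]_(p + q) => rsubmx z a b) = (fun z => z a (rshift p b)).
  by apply/funext => y; rewrite mxE.
exact: coord_continuous.
Qed.

Lemma lsubmx_delta_l (k : 'I_p) : lsubmx (delta_mx 0 (lshift q k) : 'rV[R]_(p + q)) = delta_mx 0 k.
Proof. by apply/rowP => j; rewrite !mxE (inj_eq (@lshift_inj _ _)). Qed.

Lemma lsubmx_delta_r (k : 'I_q) : lsubmx (delta_mx 0 (rshift p k) : 'rV[R]_(p + q)) = 0.
Proof. by apply/rowP => j; rewrite !mxE eq_lrshift andbF. Qed.

Lemma rsubmx_delta_l (k : 'I_p) : rsubmx (delta_mx 0 (lshift q k) : 'rV[R]_(p + q)) = 0.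
Proof. by apply/rowP => j; rewrite !mxE eq_rlshift andbF. Qed.

Lemma rsubmx_delta_r (k : 'I_q) : rsubmx (delta_mx 0 (rshift p k) : 'rV[R]_(p + q)) = delta_mx 0 k.
Proof. by apply/rowP => j; rewrite !mxE (inj_eq (@rshift_inj _ _)). Qed.

Lemma smooth_on_lsubmx U f : open U -> smooth_on U f ->
  smooth_on ((@lsubmx R 1 p q) @^-1` U) (fun z => f (lsubmx z)).
Proof.
move=> oU sf.
apply: (@smooth_on_affine _ _ _ _ (@lsubmx R 1 p q)
  (fun i => if fintype.split i is inl k then Some k else None) U f _ _ oU sf).
  exact: lsubmx_continuous.
move=> i z h; rewrite linearD linearZ /=; congr (_ *: _ + _).
by case: split_ordP => k ->; rewrite ?lsubmx_delta_l ?lsubmx_delta_r.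
Qed.

Lemma smooth_on_rsubmx U h : open U -> smooth_on U h ->
  smooth_on ((@rsubmx R 1 p q) @^-1` U) (fun z => h (rsubmx z)).
Proof.
move=> oU sf.
apply: (@smooth_on_affine _ _ _ _ (@rsubmx R 1 p q)
  (fun i => if fintype.split i is inr k then Some k else None) U h _ _ oU sf).
  exact: rsubmx_continuous.
move=> i z t; rewrite linearD linearZ /=; congr (_ *: _ + _).
by case: split_ordP => k ->; rewrite ?rsubmx_delta_l ?rsubmx_delta_r.
Qed.

Lemma partial_lsubmx_l f (k : 'I_p) (z : 'rV[R]_(p + q)) :
  partial (lshift q k) (fun z => f (lsubmx z)) z = partial k f (lsubmx z).
Proof.
have L t : lsubmx (t *: delta_mx 0 (lshift q k) + z) =
    t *: delta_mx 0 k + lsubmx z :> 'rV[R]_p.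
  by rewrite linearD linearZ /= lsubmx_delta_l.
exact: (derive_affine f L).1.
Qed.

Lemma partial_lsubmx_r f (k : 'I_q) (z : 'rV[R]_(p + q)) :
  partial (rshift p k) (fun z => f (lsubmx z)) z = 0.
Proof.
have L t : lsubmx (t *: delta_mx 0 (rshift p k) + z) = t *: 0 + lsubmx z :> 'rV[R]_p.
  by rewrite linearD linearZ /= lsubmx_delta_r.
by apply: etrans (derive_affine f L).1 _; rewrite derive0.
Qed.

End Submatrices.

(** * The tension field with a lowered index *)

Section LoweredTension.
Context {R : realType}.

(** Defined from the partial derivatives, so as to be linear in [v] without any
    differentiability of [F]. *)
Definition dirpartial {V : normedModType R} n (v : 'rV[R]_n) (F : 'rV[R]_n -> V) (z : 'rV[R]_n) : V :=
  \sum_b v 0 b *: partial b F z.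

Lemma lowered_christoffel n (H : 'rV[R]_n -> 'M[R]_n) z b c d :
  H z \in unitmx -> (H z)^T = H z ->
  \sum_a christoffel H z a b c * H z a d =
  2^-1 * (partial b H z c d + partial c H z b d - partial d H z b c).
Proof.
move=> Hu Hs.
pose X l := partial b H z c l + partial c H z b l - partial l H z b c.
have E a : christoffel H z a b c * H z a d =
    2^-1 * \sum_l H z d a * invmx (H z) a l * X l.
  rewrite /christoffel -mulrA mulr_suml; congr (_ * _); apply: eq_bigr => l _.
  by rewrite -{2}Hs mxE mulrC mulrA.
rewrite (eq_bigr _ (fun a _ => E a)) -mulr_sumr exchange_big /=; congr (_ * _).
have delta l : \sum_a H z d a * invmx (H z) a l * X l = (d == l)%:R * X l.
  rewrite -mulr_suml; congr (_ * _).
  by have := mulmxV Hu => /matrixP/(_ d l); rewrite !mxE => ->.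
rewrite (eq_bigr _ (fun l _ => delta l)).
rewrite (bigD1 d) // eqxx mul1r big1 => [|l ld]; first exact: addr0.
by rewrite eq_sym (negbTE ld) mul0r.
Qed.

Definition trilinear n (S : 'I_n -> 'I_n -> 'I_n -> R) (u v w : 'rV[R]_n) : R :=
  \sum_b \sum_c \sum_d u 0 b * v 0 c * w 0 d * S b c d.

Lemma trilinear_christoffel n (S : 'I_n -> 'I_n -> 'I_n -> R) (u v w : 'rV[R]_n) :
  trilinear (fun b c d => 2^-1 * (S b c d + S c b d - S d b c)) u v w =
  2^-1 * (trilinear S u v w + trilinear S v u w - trilinear S w u v).
Proof.
have E1 : trilinear S v u w = trilinear (fun b c d => S c b d) u v w.
  rewrite /trilinear exchange_big /=; apply: eq_bigr => b _; apply: eq_bigr => c _.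
  by apply: eq_bigr => d _; rewrite (mulrC (v 0 c)).
have E2 : trilinear S w u v = trilinear (fun b c d => S d b c) u v w.
  rewrite /trilinear exchange_big /=; apply: eq_bigr => b _; rewrite exchange_big /=.
  by apply: eq_bigr => c _; apply: eq_bigr => d _; ring.
rewrite E1 E2 /trilinear -sumrN -!big_split mulr_sumr /=; apply: eq_bigr => b _.
rewrite -sumrN -!big_split mulr_sumr /=; apply: eq_bigr => c _.
rewrite -sumrN -!big_split mulr_sumr /=; apply: eq_bigr => d _; ring.
Qed.

Lemma inner_dirpartial n (H : 'rV[R]_n -> 'M[R]_n) z v al be :
  inner (dirpartial v H z) al be =
  trilinear (fun b c d => partial b H z c d) v al be.
Proof.
rewrite /dirpartial inner_summ; apply: eq_bigr => b _.
rewrite innerZm innerE mulr_sumr; apply: eq_bigr => c _.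
rewrite mulr_sumr; apply: eq_bigr => d _; ring.
Qed.

(** Lowering an index replaces the Christoffel symbols of the target by those
    of the first kind, which involve no inverse matrix. *)
Lemma inner_tension n p (G : 'rV[R]_n -> 'M[R]_n) (H : 'rV[R]_p -> 'M[R]_p)
    (f : 'rV[R]_n -> 'rV[R]_p) x (W : 'rV[R]_p) :
  H (f x) \in unitmx -> (H (f x))^T = H (f x) ->
  inner (H (f x)) (tension G H f x) W =
  \sum_i \sum_j invmx (G x) i j *
    (inner (H (f x)) (partial i (partial j f) x) W
     - \sum_k christoffel G x k i j * inner (H (f x)) (partial k f x) W
     + 2^-1 * (inner (dirpartial (partial i f x) H (f x)) (partial j f x) W
             + inner (dirpartial (partial j f x) H (f x)) (partial i f x) W
             - inner (dirpartial W H (f x)) (partial i f x) (partial j f x))).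
Proof.
move=> Hu Hs.
pose q i j : 'rV[R]_p := \row_a \sum_b \sum_c christoffel H (f x) a b c
         * partial i f x 0 b * partial j f x 0 c.
have tE : tension G H f x = \sum_i \sum_j invmx (G x) i j *:
   (partial i (partial j f) x - \sum_k christoffel G x k i j *: partial k f x + q i j).
  apply/rowP => a; rewrite mxE summxE; apply: eq_bigr => i _.
  rewrite summxE; apply: eq_bigr => j _; rewrite !mxE summxE.
  by congr (_ * (_ - _ + _)); apply: eq_bigr => k _; rewrite mxE.
rewrite tE inner_suml; apply: eq_bigr => i _; rewrite inner_suml; apply: eq_bigr => j _.
rewrite innerZl !innerDl; congr (_ * (_ + _ + _)).
  rewrite -scaleN1r innerZl mulN1r inner_suml; congr (- _).
  by apply: eq_bigr => k _; rewrite innerZl.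
set fi := partial i f x; set fj := partial j f x.
pose S b c d := partial b H (f x) c d.
transitivity (2^-1 * (trilinear S fi fj W + trilinear S fj fi W - trilinear S W fi fj));
  last by congr (2^-1 * (_ + _ - _)); exact/esym/inner_dirpartial.
apply: etrans (trilinear_christoffel S fi fj W).
rewrite innerE exchange_big /=.
transitivity (\sum_d \sum_b \sum_c fi 0 b * fj 0 c * W 0 d *
    (2^-1 * (partial b H (f x) c d + partial c H (f x) b d - partial d H (f x) b c))).
  apply: eq_bigr => d _.
  transitivity (\sum_a \sum_b \sum_c fi 0 b * fj 0 c * W 0 d *
     (christoffel H (f x) a b c * H (f x) a d)).
    apply: eq_bigr => a _; rewrite mxE -mulrA mulr_suml; apply: eq_bigr => b _.
    rewrite mulr_suml; apply: eq_bigr => c _; rewrite -/fi -/fj; ring.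
  rewrite exchange_big /=; apply: eq_bigr => b _.
  rewrite exchange_big /=; apply: eq_bigr => c _.
  by rewrite -mulr_sumr lowered_christoffel.
rewrite exchange_big /=; apply: eq_bigr => b _; rewrite exchange_big /=.
by apply: eq_bigr => c _.
Qed.

End LoweredTension.

(** * Derivatives of the Sasaki metric *)

Section DirectionalPartial.
Context {R : realType} {n : nat}.
Implicit Types (v z : 'rV[R]_n).

Lemma dirpartial_delta {V : normedModType R} (F : 'rV[R]_n -> V) i z :
  dirpartial (delta_mx 0 i) F z = partial i F z.
Proof.
rewrite /dirpartial (bigD1 i) // mxE !eqxx scale1r big1 => [|j ji]; first exact: addr0.
by rewrite mxE eqxx /= (negbTE ji) scale0r.
Qed.

Lemma sum_mulmx p q r s (A : 'M[R]_(p, q)) (B : 'M[R]_(r, s)) v (X : 'I_n -> 'M[R]_(q, r)) :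
  \sum_b v 0 b *: (A *m X b *m B) = A *m (\sum_b v 0 b *: X b) *m B.
Proof.
rewrite mulmx_sumr mulmx_suml; apply: eq_bigr => b _.
by rewrite -scalemxAr -scalemxAl.
Qed.

End DirectionalPartial.

Section SasakiDerivative.
Context {R : realType} {m : nat}.
Variables (U : set 'rV[R]_m) (G : 'rV[R]_m -> 'M[R]_m).
Hypothesis oU : open U.
Hypothesis sG : smooth_on U G.
Hypothesis Gsym : forall x, U x -> (G x)^T = G x.
Hypothesis Gpos : forall x, U x -> posdef (G x).

Let W : set 'rV[R]_(m + m) := (@lsubmx R 1 m m) @^-1` U.

Lemma open_total : open W.
Proof. by apply: open_comp => // z _; exact: lsubmx_continuous. Qed.

Lemma smooth_metric_entry i j : smooth_on U (fun x => G x i j).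
Proof. exact: smooth_on_entry. Qed.

Lemma smooth_metric_inv i j : smooth_on U (fun x => invmx (G x) i j).
Proof.
apply: (smooth_on_invmx oU) => [k l|x Ux]; first exact: smooth_metric_entry.
exact: posdef_unitmx (Gpos Ux).
Qed.

Lemma smooth_metric_partial i j k : smooth_on U (fun x => partial i G x j k).
Proof. exact: (smooth_on_entry j k oU (smooth_on_partial i sG)). Qed.

Lemma smooth_christoffel k i j : smooth_on U (fun x => christoffel G x k i j).
Proof.
apply: (smooth_onM oU (smooth_on_cst _ oU)).
apply: (smooth_on_sum _ _ oU) => l.
apply: (smooth_onM oU (smooth_metric_inv k l)).
apply: (smooth_onB oU); last exact: smooth_metric_partial.
by apply: (smooth_onD oU); exact: smooth_metric_partial.
Qed.

Lemma smooth_fibre_coord j : smooth_on W (fun z : 'rV[R]_(m + m) => rsubmx z 0 j).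
Proof.
have -> : (fun z : 'rV[R]_(m + m) => rsubmx z 0 j) = (fun z => z 0 (rshift m j)).
  by apply/funext => z; rewrite mxE.
exact: smooth_on_coord open_total.
Qed.

Lemma christoffel_mx_entry i k (z : 'rV[R]_(m + m)) :
  christoffel_mx G z i k = \sum_j christoffel G (lsubmx z) k i j * rsubmx z 0 j.
Proof. by rewrite mxE. Qed.

Lemma smooth_christoffel_mx : smooth_on W (christoffel_mx G).
Proof.
apply: (smooth_on_mx open_total) => i k; under eq_fun do rewrite christoffel_mx_entry.
apply: (smooth_on_sum _ _ open_total) => j.
apply: (smooth_onM open_total _ (smooth_fibre_coord j)).
exact: (smooth_on_lsubmx (f := fun x => christoffel G x k i j) oU (smooth_christoffel k i j)).
Qed.

Lemma partial_christoffel_mx_base z i k p : W z ->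
  partial (lshift m p) (christoffel_mx G) z i k =
  \sum_j partial p (fun x => christoffel G x k i j) (lsubmx z) * rsubmx z 0 j.
Proof.
move=> Wz; rewrite (partial_entry _ _ (smooth_on_derivable smooth_christoffel_mx Wz)).
under eq_fun do rewrite christoffel_mx_entry.
have sL j := smooth_on_lsubmx (q := m) (f := fun x => christoffel G x k i j) oU
  (smooth_christoffel k i j).
have dL j b := smooth_on_derivable (i := b) (sL j) Wz.
have dR j b := smooth_on_derivable (i := b) (smooth_fibre_coord j) Wz.
rewrite partial_sum => [|j]; last exact: (derivableM (dL j _) (dR j _)).
apply: eq_bigr => j _; rewrite partialM; [|exact: dL|exact: dR].
rewrite (partial_lsubmx_l (fun x => christoffel G x k i j)).
have -> : (fun z : 'rV[R]_(m + m) => rsubmx z 0 j) = (fun z => z 0 (rshift m j)).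
  by apply/funext => y; rewrite mxE.
by rewrite partial_coord eq_lrshift mulr0 addr0.
Qed.

Lemma partial_christoffel_mx_fibre z i k q : W z ->
  partial (rshift m q) (christoffel_mx G) z i k = christoffel G (lsubmx z) k i q.
Proof.
move=> Wz; rewrite (partial_entry _ _ (smooth_on_derivable smooth_christoffel_mx Wz)).
under eq_fun do rewrite christoffel_mx_entry.
have sL j := smooth_on_lsubmx (q := m) (f := fun x => christoffel G x k i j) oU
  (smooth_christoffel k i j).
have dL j b := smooth_on_derivable (i := b) (sL j) Wz.
have dR j b := smooth_on_derivable (i := b) (smooth_fibre_coord j) Wz.
rewrite partial_sum => [|j]; last exact: (derivableM (dL j _) (dR j _)).
have E j : partial (rshift m q) (fun z : 'rV[R]_(m + m) =>
    christoffel G (lsubmx z) k i j * rsubmx z 0 j) z =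
    christoffel G (lsubmx z) k i j * (q == j)%:R.
  rewrite partialM; [|exact: dL|exact: dR].
  rewrite (partial_lsubmx_r (fun x => christoffel G x k i j)) mul0r add0r.
  have -> : (fun z : 'rV[R]_(m + m) => rsubmx z 0 j) = (fun z => z 0 (rshift m j)).
    by apply/funext => y; rewrite mxE.
  by rewrite partial_coord (inj_eq (@rshift_inj _ _)).
rewrite (eq_bigr _ (fun j _ => E j)).
rewrite (bigD1 q) // eqxx mulr1 big1 => [|j jq]; first exact: addr0.
by rewrite eq_sym (negbTE jq) mulr0.
Qed.

Lemma dirpartial_christoffel_mx v z i k : W z ->
  dirpartial v (christoffel_mx G) z i k =
  \sum_p lsubmx v 0 p *
    (\sum_j partial p (fun x => christoffel G x k i j) (lsubmx z) * rsubmx z 0 j) +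
  \sum_q christoffel G (lsubmx z) k i q * rsubmx v 0 q.
Proof.
move=> Wz; rewrite /dirpartial summxE big_split_ord /=; congr (_ + _).
  by apply: eq_bigr => p _; rewrite mxE partial_christoffel_mx_base // mxE.
by apply: eq_bigr => q _; rewrite mxE partial_christoffel_mx_fibre // mxE mulrC.
Qed.

Lemma smooth_connector : smooth_on W (connector_mx G).
Proof.
apply: (smooth_on_mx open_total) => a k; case: (@split_ordP m m a) => i ->.
  have -> : (fun z => connector_mx G z (lshift m i) k) = (fun z => christoffel_mx G z i k).
    by apply/funext => z; rewrite col_mxEu.
  exact: (smooth_on_entry i k open_total smooth_christoffel_mx).
have -> : (fun z => connector_mx G z (rshift m i) k) = cst ((1%:M : 'M[R]_m) i k).
  by apply/funext => z; rewrite col_mxEd.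
exact: (smooth_on_cst _ open_total).
Qed.

Lemma partial_connector b z : W z ->
  partial b (connector_mx G) z = col_mx (partial b (christoffel_mx G) z) 0.
Proof.
move=> Wz; apply/matrixP => a k.
rewrite (partial_entry _ _ (smooth_on_derivable smooth_connector Wz)).
case: (@split_ordP m m a) => i ->.
  rewrite col_mxEu (partial_entry _ _ (smooth_on_derivable smooth_christoffel_mx Wz)).
  have -> : (fun z => connector_mx G z (lshift m i) k) = (fun z => christoffel_mx G z i k).
    by apply/funext => y; rewrite col_mxEu.
  reflexivity.
rewrite col_mxEd mxE; have -> : (fun z => connector_mx G z (rshift m i) k) =
    cst ((1%:M : 'M[R]_m) i k) by apply/funext => y; rewrite col_mxEd.
exact: partial_cst.
Qed.

Lemma dirpartial_connector v z : W z ->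
  dirpartial v (connector_mx G) z = col_mx (dirpartial v (christoffel_mx G) z) 0.
Proof.
move=> Wz; rewrite /dirpartial.
have E b : v 0 b *: partial b (connector_mx G) z =
    col_mx (1%:M : 'M[R]_m) 0 *m (v 0 b *: partial b (christoffel_mx G) z).
  by rewrite partial_connector // mul_col_mx mul1mx mul0mx scale_col_mx scaler0.
by rewrite (eq_bigr _ (fun b _ => E b)) -mulmx_sumr mul_col_mx mul1mx mul0mx.
Qed.

Lemma dirpartial_base v z : W z ->
  dirpartial v (fun z : 'rV[R]_(m + m) => G (lsubmx z)) z =
  dirpartial (lsubmx v) G (lsubmx z).
Proof.
move=> Wz; rewrite /dirpartial big_split_ord /= [X in _ + X]big1 => [|q _]; last first.
  by rewrite partial_lsubmx_r scaler0.
by rewrite addr0; apply: eq_bigr => p _; rewrite partial_lsubmx_l mxE.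
Qed.

(** Leibniz rule for the two summands of the Sasaki metric; the projection
    [bundle_proj_mx] is constant. *)
Lemma dirpartial_sasaki v z : W z ->
  let P := bundle_proj_mx : 'M[R]_(m + m, m) in
  let K := connector_mx G z in
  let dK := dirpartial v (connector_mx G) z in
  let g := G (lsubmx z) in
  let dg := dirpartial (lsubmx v) G (lsubmx z) in
  dirpartial v (sasaki G) z =
  P *m dg *m P^T + (dK *m g *m K^T + K *m dg *m K^T + K *m g *m dK^T).
Proof.
move=> Wz P K dK g dg.
pose gW (z : 'rV[R]_(m + m)) := G (lsubmx z).
have sP : smooth_on W (fun=> P) by exact: (smooth_on_cst _ open_total).
have sPT : smooth_on W (fun=> P^T) by exact: (smooth_on_cst _ open_total).
have sg : smooth_on W gW by exact: (smooth_on_lsubmx oU sG).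
have sK := smooth_connector.
have sKT := smooth_on_trmx open_total sK.
have sPg := smooth_on_mulmx open_total sP sg.
have sKg := smooth_on_mulmx open_total sK sg.
have sPgP := smooth_on_mulmx open_total sPg sPT.
have sKgK := smooth_on_mulmx open_total sKg sKT.
have E b : v 0 b *: partial b (sasaki G) z =
    v 0 b *: (P *m partial b gW z *m P^T) +
    (v 0 b *: (1%:M *m partial b (connector_mx G) z *m (g *m K^T)) +
     v 0 b *: (K *m partial b gW z *m K^T) +
     v 0 b *: (K *m g *m (partial b (connector_mx G) z)^T *m 1%:M)).
  rewrite -!scalerDr; congr (_ *: _).
  apply: etrans (partialD (smooth_on_derivable sPgP Wz) (smooth_on_derivable sKgK Wz)) _.
  congr (_ + _).
    rewrite (partial_mulmx b open_total sPg sPT Wz) (partial_mulmx b open_total sP sg Wz).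
    by rewrite !partial_cst mul0mx add0r mulmx0 addr0.
  rewrite (partial_mulmx b open_total sKg sKT Wz) (partial_mulmx b open_total sK sg Wz).
  rewrite (partial_trmx b sK Wz) mulmxDl mul1mx mulmx1 -!mulmxA.
  by [].
rewrite {1}/dirpartial (eq_bigr _ (fun b _ => E b)) !big_split /= !sum_mulmx.
rewrite -!/(dirpartial _ _ _) dirpartial_base // -/dK -/dg.
congr (_ + (_ + _ + _)); first by rewrite mul1mx mulmxA.
rewrite mulmx1; congr (_ *m _); rewrite /dK /dirpartial linear_sum /=.
by apply: eq_bigr => b _; rewrite linearZ.
Qed.

(** In the connector only the Christoffel block varies, and it acts on the base
    part of a vector. *)
Lemma inner_dirpartial_sasaki v z al be : W z ->
  let P := bundle_proj_mx : 'M[R]_(m + m, m) in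
  let K := connector_mx G z in
  let dC := dirpartial v (christoffel_mx G) z in
  let g := G (lsubmx z) in
  let dg := dirpartial (lsubmx v) G (lsubmx z) in
  inner (dirpartial v (sasaki G) z) al be =
  inner dg (al *m P) (be *m P) + inner dg (al *m K) (be *m K)
  + inner g (al *m P *m dC) (be *m K) + inner g (al *m K) (be *m P *m dC).
Proof.
move=> Wz P K dC g dg; rewrite dirpartial_sasaki // dirpartial_connector //.
rewrite -/P -/K -/dC -/g -/dg.
have colE (w : 'rV[R]_(m + m)) (X : 'M[R]_m) : w *m col_mx X 0 = w *m P *m X.
  by rewrite -mulmxA mul_col_mx mul1mx mul0mx.
have E1 : inner (P *m dg *m P^T) al be = inner dg (al *m P) (be *m P) by exact: inner_congr.
have E2 : inner (K *m dg *m K^T) al be = inner dg (al *m K) (be *m K) by exact: inner_congr.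
have E3 : inner (col_mx dC 0 *m g *m K^T) al be = inner g (al *m P *m dC) (be *m K).
  by rewrite /inner trmx_mul -colE !mulmxA.
have E4 : inner (K *m g *m (col_mx dC 0)^T) al be = inner g (al *m K) (be *m P *m dC).
  by rewrite /inner -[in RHS]colE (trmx_mul be) !mulmxA.
rewrite !innerDm E1 E2 E3 E4; ring.
Qed.

Lemma sasaki_sym z : W z -> (sasaki G z)^T = sasaki G z.
Proof.
by move=> Wz; rewrite /sasaki linearD /= !trmx_mul !trmxK Gsym // !mulmxA.
Qed.

(** A vector whose horizontal and vertical parts vanish is zero. *)
Lemma sasaki_posdef z : W z -> posdef (sasaki G z).
Proof.
move=> Wz v v0; rewrite sasakiE; have gp := Gpos Wz.
have hor_ge0 := posdef_ge0 (v *m bundle_proj_mx) gp.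
have ver_ge0 := posdef_ge0 (v *m connector_mx G z) gp.
rewrite lt0r addr_ge0 // andbT; apply: contra v0; rewrite paddr_eq0 //.
move=> /andP[/eqP/(posdef_eq0 gp) vP /eqP/(posdef_eq0 gp) vK].
move: vP vK; rewrite -[v]hsubmxK !mul_row_col mulmx1 mulmx0 addr0 mulmx1 => ->.
by rewrite mul0mx add0r => ->; apply/eqP; exact: row_mx0.
Qed.

End SasakiDerivative.

(** * Energy densities of the graph of a vector field *)

Lemma sum_delta_l (R : realType) n (i : 'I_n) (F : 'I_n -> R) :
  \sum_p (delta_mx 0 i : 'rV[R]_n) 0 p * F p = F i.
Proof.
rewrite (bigD1 i) //= mxE !eqxx mul1r big1 ?addr0 // => p pi.
by rewrite mxE eqxx (negbTE pi) mul0r.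
Qed.

Lemma sum_delta_r (R : realType) n (i : 'I_n) (F : 'I_n -> R) :
  \sum_p F p * (delta_mx 0 i : 'rV[R]_n) 0 p = F i.
Proof. by rewrite -[RHS](sum_delta_l i F); apply: eq_bigr => p _; rewrite mulrC. Qed.

Lemma partial_id (R : realType) n (i : 'I_n) x :
  partial i (@id 'rV[R]_n) x = delta_mx 0 i.
Proof. exact: derive_id. Qed.

Section Densities.
Context {R : realType} {m : nat}.
Variables (G : 'rV[R]_m -> 'M[R]_m) (Y : 'rV[R]_m -> 'rV[R]_m).

(** The order zero part of the covariant derivative of [Y], which is the sum of
    the Jacobian matrix of [Y] and of this matrix. *)
Definition conn (x : 'rV[R]_m) : 'M[R]_m := christoffel_mx G (graph_map Y x).

Definition nabla_flat (x : 'rV[R]_m) : 'M[R]_m := nabla G Y x *m G x.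

(** The covector dual to minus the rough Laplacian of [Y]: the trace of the
    second covariant derivative of the covector field dual to [Y]. *)
Definition vertical_tension (x : 'rV[R]_m) : 'rV[R]_m :=
  \row_k \sum_i \sum_j invmx (G x) i j *
    (partial i (fun y => nabla_flat y j k) x
     - \sum_p christoffel G x p i j * nabla_flat x p k
     - \sum_l christoffel G x l i k * nabla_flat x j l).

(** The covector dual to minus the curvature term [S(Y)], before the derivatives
    of the Christoffel symbols are assembled into the curvature tensor. Every
    summand is quadratic in [Y] and contains [nabla G Y]. *)
Definition horizontal_tension (x : 'rV[R]_m) : 'rV[R]_m :=
  \row_k \sum_i \sum_j invmx (G x) i j *
    (\sum_l partial i (fun y => conn y k l) x * nabla_flat x j l
     - 2^-1 * inner (partial k G x) (row i (nabla G Y x)) (row j (nabla G Y x))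
     - \sum_l (\sum_p partial k (fun y => christoffel G y l i p) x * Y x 0 p
               - \sum_p christoffel G x l i p * conn x k p) * nabla_flat x j l).

Definition dirichlet_density (x : 'rV[R]_m) : R :=
  double_norm (invmx (G x)) (G x) (nabla G Y x).

Definition vertical_density (x : 'rV[R]_m) : R :=
  inner (invmx (G x)) (vertical_tension x) (vertical_tension x).

Definition horizontal_density (x : 'rV[R]_m) : R :=
  inner (invmx (G x)) (horizontal_tension x) (horizontal_tension x).

End Densities.

Section GraphTension.
Context {R : realType} {m : nat}.
Variables (U : set 'rV[R]_m) (G : 'rV[R]_m -> 'M[R]_m).
Hypothesis oU : open U.
Hypothesis sG : smooth_on U G.
Hypothesis Gsym : forall x, U x -> (G x)^T = G x.
Hypothesis Gpos : forall x, U x -> posdef (G x).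
Variable Y : 'rV[R]_m -> 'rV[R]_m.
Hypothesis sY : smooth_on U Y.

Local Notation f := (graph_map Y).
Local Notation N := (nabla G Y).
Local Notation C := (conn G Y).

Lemma partial_row_mx p q (a : 'rV[R]_m -> 'rV[R]_p) (b : 'rV[R]_m -> 'rV[R]_q) x i :
  derivable a x (delta_mx 0 i) -> derivable b x (delta_mx 0 i) ->
  partial i (fun y => row_mx (a y) (b y)) x = row_mx (partial i a x) (partial i b x).
Proof.
move=> da db.
have daj j := (derivable_mxP a x (delta_mx 0 i)).1 da 0 j.
have dbj j := (derivable_mxP b x (delta_mx 0 i)).1 db 0 j.
have El j : (fun y => row_mx (a y) (b y) 0 (lshift q j)) = (fun y => a y 0 j).
  by apply/funext => y; rewrite row_mxEl.
have Er j : (fun y => row_mx (a y) (b y) 0 (rshift p j)) = (fun y => b y 0 j).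
  by apply/funext => y; rewrite row_mxEr.
have dab : derivable (fun y => row_mx (a y) (b y)) x (delta_mx 0 i).
  apply/derivable_mxP => k j; rewrite ord1; case: (@split_ordP p q j) => l ->.
    by rewrite El.
  by rewrite Er.
apply/rowP => j; rewrite partial_entry //; case: (@split_ordP p q j) => l ->.
  by rewrite El row_mxEl partial_entry.
by rewrite Er row_mxEr partial_entry.
Qed.

Lemma partial_graph x i : U x ->
  partial i f x = row_mx (delta_mx 0 i) (partial i Y x).
Proof.
move=> Ux; rewrite /graph_map (@partial_row_mx _ _ id).
- by congr row_mx; exact: partial_id.
- exact: derivable_id.
- exact: smooth_on_derivable sY Ux.
Qed.

Lemma partial_graph2 x i j : U x ->
  partial i (partial j f) x = vertical_lift (partial i (partial j Y) x).
Proof.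
move=> Ux; rewrite (partial_eq_on i oU (fun y Uy => partial_graph j Uy) Ux).
rewrite (@partial_row_mx _ _ (cst (delta_mx 0 j))).
- by congr row_mx; exact: partial_cst.
- exact: derivable_cst.
- exact: (smooth_on_derivable (smooth_on_partial j sY) Ux).
Qed.

Lemma graph_base x : lsubmx (f x) = x.
Proof. exact: row_mxKl. Qed.

Lemma graph_fibre x : rsubmx (f x) = Y x.
Proof. exact: row_mxKr. Qed.

Lemma graph_proj x i : U x ->
  partial i f x *m bundle_proj_mx = delta_mx 0 i.
Proof. by move=> Ux; rewrite partial_graph // mul_row_col mulmx1 mulmx0 addr0. Qed.

(** The graph of [Y] sends a coordinate field to its horizontal lift plus the
    vertical lift of its covariant derivative. *)
Lemma graph_connector x i : U x ->
  partial i f x *m connector_mx G (f x) = row i (N x).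
Proof.
move=> Ux; rewrite partial_graph // mul_row_col mulmx1 -rowE.
apply/rowP => k; rewrite !mxE addrC; congr (_ + _).
by apply: eq_bigr => j _; rewrite graph_base graph_fibre.
Qed.

Lemma inner_sasaki_split z u v a b c d :
  u *m bundle_proj_mx = a -> v *m bundle_proj_mx = b ->
  u *m connector_mx G z = c -> v *m connector_mx G z = d ->
  inner (sasaki G z) u v = inner (G (lsubmx z)) a b + inner (G (lsubmx z)) c d.
Proof. by move=> <- <- <- <-; exact: sasakiE. Qed.

Lemma inner_dirpartial_sasaki_split v z u w a b c d :
  U (lsubmx z) ->
  u *m bundle_proj_mx = a -> w *m bundle_proj_mx = b ->
  u *m connector_mx G z = c -> w *m connector_mx G z = d ->
  let dC : 'M[R]_m := dirpartial v (christoffel_mx G) z in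
  let g := G (lsubmx z) in
  let dg := dirpartial (lsubmx v) G (lsubmx z) in
  inner (dirpartial v (sasaki G) z) u w =
  inner dg a b + inner dg c d + inner g (a *m dC) d + inner g c (b *m dC).
Proof.
by move=> Uz <- <- <- <-; exact: (inner_dirpartial_sasaki oU sG Gpos _ _ _ Uz).
Qed.

Lemma sqnorm_diff_graph x : U x ->
  sqnorm_diff G (sasaki G) f x = m%:R + dirichlet_density G Y x.
Proof.
move=> Ux; rewrite /sqnorm_diff /dirichlet_density /double_norm.
have E i j : invmx (G x) i j * inner (sasaki G (f x)) (partial i f x) (partial j f x) =
    invmx (G x) i j * G x j i + invmx (G x) i j * inner (G x) (row i (N x)) (row j (N x)).
  rewrite (inner_sasaki_split (graph_proj i Ux) (graph_proj j Ux)
    (graph_connector i Ux) (graph_connector j Ux)) graph_base inner_delta mulrDr.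
  by rewrite -{2}(Gsym Ux) mxE.
transitivity (\sum_i \sum_j (invmx (G x) i j * G x j i +
    invmx (G x) i j * inner (G x) (row i (N x)) (row j (N x)))).
  by apply: eq_bigr => i _; apply: eq_bigr => j _.
under eq_bigr do rewrite big_split; rewrite big_split /=; congr (_ + _).
rewrite -(@mxtrace1 R m) -(mulVmx (posdef_unitmx (Gpos Ux))).
by apply: eq_bigr => i _; rewrite mxE.
Qed.

Lemma conn_entry x i k :
  C x i k = \sum_j christoffel G x k i j * Y x 0 j.
Proof. by rewrite mxE graph_base graph_fibre. Qed.

Lemma smooth_conn_entry i k : smooth_on U (fun x => C x i k).
Proof.
under eq_fun do rewrite conn_entry.
apply: (smooth_on_sum _ _ oU) => j.
apply: (smooth_onM oU (smooth_christoffel oU sG Gpos k i j)).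
exact: (smooth_on_entry 0 j oU sY).
Qed.

Lemma smooth_conn : smooth_on U C.
Proof. apply: (smooth_on_mx oU) => i k; exact: smooth_conn_entry. Qed.

Lemma nablaE x : N x = \matrix_(i, k) partial i Y x 0 k + C x.
Proof.
apply/matrixP => i k; rewrite !mxE; congr (_ + _); apply: eq_bigr => j _.
by rewrite graph_base graph_fibre.
Qed.

Lemma smooth_nabla_entry i k : smooth_on U (fun x => N x i k).
Proof.
have -> : (fun x => N x i k) = (fun x => partial i Y x 0 k + C x i k).
  by apply/funext => x; rewrite nablaE !mxE.
exact: (smooth_onD oU (smooth_on_entry 0 k oU (smooth_on_partial i sY))
  (smooth_conn_entry i k)).
Qed.

Lemma smooth_nabla : smooth_on U N.
Proof. apply: (smooth_on_mx oU) => i k; exact: smooth_nabla_entry. Qed.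

Lemma row_partial_nabla x i j : U x ->
  row j (partial i N x) = partial i (partial j Y) x + row j (partial i C x).
Proof.
move=> Ux; apply/rowP => k.
rewrite !mxE (partial_entry _ _ (smooth_on_derivable smooth_nabla Ux)).
have -> : (fun x => N x j k) = (fun x => partial j Y x 0 k + C x j k).
  by apply/funext => y; rewrite nablaE !mxE.
rewrite partialD.
- rewrite -(partial_entry 0 k (smooth_on_derivable (smooth_on_partial j sY) Ux)).
  by rewrite -(partial_entry j k (smooth_on_derivable smooth_conn Ux)).
- exact: (smooth_on_derivable (smooth_on_entry 0 k oU (smooth_on_partial j sY)) Ux).
- exact: (smooth_on_derivable (smooth_conn_entry j k) Ux).
Qed.

Lemma smooth_nabla_flat : smooth_on U (nabla_flat G Y).
Proof. exact: (smooth_on_mulmx oU smooth_nabla sG). Qed.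

(** The connection term is linear in the fibre coordinate, so the product rule
    replaces the chain rule. *)
Lemma dirpartial_graph x i : U x ->
  dirpartial (partial i f x) (christoffel_mx G) (f x) = partial i C x.
Proof.
move=> Ux; apply/matrixP => a k.
have UW : (@lsubmx R 1 m m @^-1` U) (f x) by rewrite /= graph_base.
rewrite (dirpartial_christoffel_mx oU sG Gpos _ a k UW).
rewrite (partial_entry _ _ (smooth_on_derivable smooth_conn Ux)).
under [in RHS]eq_fun do rewrite conn_entry.
have dG j := smooth_on_derivable (i := i) (smooth_christoffel oU sG Gpos k a j) Ux.
have dY j := smooth_on_derivable (i := i) (smooth_on_entry 0 j oU sY) Ux.
rewrite partial_sum => [|j]; last exact: (derivableM (dG j) (dY j)).
rewrite graph_base graph_fibre partial_graph // row_mxKl row_mxKr.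
rewrite sum_delta_l -big_split; apply: eq_bigr => j _ /=.
rewrite partialM; [|exact: dG|exact: dY].
by rewrite -(partial_entry 0 j (smooth_on_derivable sY Ux)).
Qed.

(** The second fundamental form matters only up to its antisymmetric part, as it
    is contracted with a symmetric matrix. *)
Lemma symmetrize (S : 'M[R]_m) (A B : 'I_m -> 'I_m -> R) : S^T = S ->
  \sum_i \sum_j S i j * (A i j + 2^-1 * (B i j + B j i)) =
  \sum_i \sum_j S i j * (A i j + B i j).
Proof.
move=> Ss.
have E : \sum_i \sum_j S i j * B j i = \sum_i \sum_j S i j * B i j.
  rewrite exchange_big /=; apply: eq_bigr => i _; apply: eq_bigr => j _.
  by rewrite -{1}Ss mxE.
transitivity (\sum_i \sum_j S i j * A i j +
  2^-1 * (\sum_i \sum_j S i j * B i j + \sum_i \sum_j S i j * B j i)).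
  rewrite -big_split /= mulr_sumr -big_split /=; apply: eq_bigr => i _.
  rewrite -big_split /= mulr_sumr -big_split /=; apply: eq_bigr => j _; ring.
have half (b : R) : 2^-1 * (b + b) = b by field.
rewrite E half -big_split /=; apply: eq_bigr => i _.
by rewrite -big_split /=; apply: eq_bigr => j _; rewrite mulrDr.
Qed.

Lemma nabla_flatE x j k : nabla_flat G Y x j k = inner (G x) (row j (N x)) (delta_mx 0 k).
Proof. by rewrite inner_deltar -row_mul [RHS]mxE. Qed.

Lemma inner_nabla_flat x (v : 'rV[R]_m) j : U x ->
  inner (G x) v (row j (N x)) = \sum_l v 0 l * nabla_flat G Y x j l.
Proof.
move=> Ux; rewrite innerC ?Gsym // /inner mxE; apply: eq_bigr => l _.
by rewrite mulrC [v^T _ _]mxE -row_mul mxE.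
Qed.

(** The derivatives of the Sasaki metric along the graph complete the second
    derivative of [Y] to the derivative of [nabla_flat]; those in the fibre
    direction give the last Christoffel term. *)
Lemma tension_vertical x k : U x ->
  inner (sasaki G (f x)) (tension G (sasaki G) f x) (vertical_lift (delta_mx 0 k)) =
  vertical_tension G Y x 0 k.
Proof.
move=> Ux; have UW : (@lsubmx R 1 m m @^-1` U) (f x) by rewrite /= graph_base.
set W := vertical_lift _.
have Wproj : W *m bundle_proj_mx = 0 by exact: vertical_lift_proj.
have Wconn : W *m connector_mx G (f x) = delta_mx 0 k by exact: vertical_lift_connector.
have Wl : lsubmx W = 0 by exact: row_mxKl.
have Wr : rsubmx W = delta_mx 0 k by exact: row_mxKr.
have WC i : row i (dirpartial W (christoffel_mx G) (f x)) = \row_l christoffel G x l i k.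
  apply/rowP => l; rewrite 2!mxE (dirpartial_christoffel_mx oU sG Gpos _ i l UW).
  rewrite Wl Wr big1 ?add0r => [|p _]; last by rewrite mxE mul0r.
  by rewrite graph_base; exact: sum_delta_r.
apply: etrans (inner_tension _ _ (posdef_unitmx (sasaki_posdef Gpos UW))
  (sasaki_sym Gsym UW)) _.
rewrite [RHS]mxE.
pose B i j := inner (partial i G x) (row j (N x)) (delta_mx 0 k) +
  inner (G x) (row j (partial i C x)) (delta_mx 0 k) -
  \sum_l christoffel G x l i k * nabla_flat G Y x j l.
pose A i j := inner (G x) (partial i (partial j Y) x) (delta_mx 0 k) -
  \sum_p christoffel G x p i j * nabla_flat G Y x p k.
transitivity (\sum_i \sum_j invmx (G x) i j * (A i j + 2^-1 * (B i j + B j i))).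
  apply: eq_bigr => i _; apply: eq_bigr => j _; congr (_ * (_ + _ * _)).
    congr (_ - _).
      by rewrite partial_graph2 // sasaki_vv graph_base.
    apply: eq_bigr => p _; congr (_ * _).
    rewrite (inner_sasaki_split (graph_proj p Ux) Wproj (graph_connector p Ux) Wconn).
    by rewrite inner0r add0r graph_base nabla_flatE.
  have DH a b : inner (dirpartial (partial a f x) (sasaki G) (f x)) (partial b f x) W =
      inner (partial a G x) (row b (N x)) (delta_mx 0 k) +
      inner (G x) (row b (partial a C x)) (delta_mx 0 k).
    rewrite (inner_dirpartial_sasaki_split _ UW (graph_proj b Ux) Wproj
      (graph_connector b Ux) Wconn) mul0mx !inner0r add0r addr0.
    rewrite dirpartial_graph // graph_base.
    by rewrite partial_graph // row_mxKl dirpartial_delta -rowE.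
  have DW : inner (dirpartial W (sasaki G) (f x)) (partial i f x) (partial j f x) =
      \sum_l christoffel G x l i k * nabla_flat G Y x j l +
      \sum_l christoffel G x l j k * nabla_flat G Y x i l.
    rewrite (inner_dirpartial_sasaki_split _ UW (graph_proj i Ux) (graph_proj j Ux)
      (graph_connector i Ux) (graph_connector j Ux)).
    have -> : dirpartial (lsubmx W) G (lsubmx (f x)) = 0.
      by rewrite Wl /dirpartial big1 // => p _; rewrite mxE scale0r.
    rewrite !inner0m !add0r -!rowE !WC graph_base; congr (_ + _).
      by rewrite inner_nabla_flat //; apply: eq_bigr => l _; rewrite mxE.
    rewrite innerC ?Gsym // inner_nabla_flat //.
    by apply: eq_bigr => l _; rewrite mxE.
  apply: etrans (congr2 (fun s t => s - t) (congr2 +%R (DH i j) (DH j i)) DW) _.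
  have alg (b1 d1 b2 d2 : R) : b1 + b2 - (d1 + d2) = b1 - d1 + (b2 - d2) by ring.
  exact: alg.
rewrite symmetrize ?sym_invmx ?Gsym //.
apply: eq_bigr => i _; apply: eq_bigr => j _; congr (_ * _).
have -> : partial i (fun y => nabla_flat G Y y j k) x =
    inner (partial i G x) (row j (N x)) (delta_mx 0 k) +
    (inner (G x) (partial i (partial j Y) x) (delta_mx 0 k) +
     inner (G x) (row j (partial i C x)) (delta_mx 0 k)).
  rewrite -(partial_entry _ _ (smooth_on_derivable smooth_nabla_flat Ux)).
  rewrite (partial_mulmx i oU smooth_nabla sG Ux) mxE addrC; congr (_ + _).
    by rewrite inner_deltar -row_mul [RHS]mxE.
  by rewrite -innerDl -row_partial_nabla // inner_deltar -row_mul [RHS]mxE.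
have alg (a1 a2 b1 b2 b3 : R) : b1 + (a1 + b2) - a2 - b3 = a1 - a2 + (b1 + b2 - b3) by ring.
exact/esym/alg.
Qed.

(** The terms free of [Y] are the lowered Christoffel symbols of the base, with
    opposite signs. *)
Lemma tension_horizontal x k : U x ->
  inner (sasaki G (f x)) (tension G (sasaki G) f x)
    (horizontal_lift G (f x) (delta_mx 0 k)) = horizontal_tension G Y x 0 k.
Proof.
move=> Ux; have UW : (@lsubmx R 1 m m @^-1` U) (f x) by rewrite /= graph_base.
set W := horizontal_lift _ _ _.
have Wproj : W *m bundle_proj_mx = delta_mx 0 k by exact: horizontal_lift_proj.
have Wconn : W *m connector_mx G (f x) = 0 by exact: horizontal_lift_connector.
have Wl : lsubmx W = delta_mx 0 k by exact: row_mxKl.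
have Wr q : rsubmx W 0 q = - C x k q by rewrite row_mxKr -rowE !mxE.
pose dW i l := \sum_p partial k (fun y => christoffel G y l i p) x * Y x 0 p
               - \sum_p christoffel G x l i p * C x k p.
have WC i : row i (dirpartial W (christoffel_mx G) (f x)) = \row_l dW i l.
  apply/rowP => l; rewrite 2!mxE (dirpartial_christoffel_mx oU sG Gpos _ i l UW).
  rewrite Wl graph_base graph_fibre; congr (_ + _).
    exact: sum_delta_l.
  by rewrite -sumrN; apply: eq_bigr => q _; rewrite Wr mulrN.
apply: etrans (inner_tension _ _ (posdef_unitmx (sasaki_posdef Gpos UW))
  (sasaki_sym Gsym UW)) _.
rewrite [RHS]mxE.
pose B i j := \sum_l partial i (fun y => C y k l) x * nabla_flat G Y x j l -
  \sum_l dW i l * nabla_flat G Y x j l.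
pose A i j := - (2^-1 * inner (partial k G x) (row i (N x)) (row j (N x))).
transitivity (\sum_i \sum_j invmx (G x) i j * (A i j + 2^-1 * (B i j + B j i))); last first.
  rewrite symmetrize ?sym_invmx ?Gsym //.
  apply: eq_bigr => i _; apply: eq_bigr => j _; congr (_ * _).
  have alg (a b c : R) : - a + (b - c) = b - a - c by ring.
  exact: alg.
apply: eq_bigr => i _; apply: eq_bigr => j _; congr (_ * _).
have -> : inner (sasaki G (f x)) (partial i (partial j f) x) W = 0.
  by rewrite partial_graph2 // sasaki_vh.
have -> : \sum_p christoffel G x p i j * inner (sasaki G (f x)) (partial p f x) W =
    2^-1 * (partial i G x j k + partial j G x i k - partial k G x i j).
  rewrite -(lowered_christoffel _ _ _ (posdef_unitmx (Gpos Ux)) (Gsym Ux)).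
  apply: eq_bigr => p _; congr (_ * _).
  rewrite (inner_sasaki_split (graph_proj p Ux) Wproj (graph_connector p Ux) Wconn).
  by rewrite inner0r addr0 graph_base inner_delta.
have DH a b : inner (dirpartial (partial a f x) (sasaki G) (f x)) (partial b f x) W =
    partial a G x b k + \sum_l partial a (fun y => C y k l) x * nabla_flat G Y x b l.
  rewrite (inner_dirpartial_sasaki_split _ UW (graph_proj b Ux) Wproj
    (graph_connector b Ux) Wconn) !inner0r !addr0.
  rewrite dirpartial_graph // graph_base.
  rewrite partial_graph // row_mxKl dirpartial_delta inner_delta -rowE.
  congr (_ + _); rewrite innerC ?Gsym // inner_nabla_flat //.
  apply: eq_bigr => l _; rewrite mxE.
  by rewrite (partial_entry _ _ (smooth_on_derivable smooth_conn Ux)).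
have DW : inner (dirpartial W (sasaki G) (f x)) (partial i f x) (partial j f x) =
    partial k G x i j + inner (partial k G x) (row i (N x)) (row j (N x)) +
    \sum_l dW i l * nabla_flat G Y x j l + \sum_l dW j l * nabla_flat G Y x i l.
  rewrite (inner_dirpartial_sasaki_split _ UW (graph_proj i Ux) (graph_proj j Ux)
    (graph_connector i Ux) (graph_connector j Ux)).
  rewrite Wl dirpartial_delta graph_base inner_delta -!rowE !WC; congr (_ + _ + _).
    by rewrite inner_nabla_flat //; apply: eq_bigr => l _; rewrite mxE.
  rewrite innerC ?Gsym // inner_nabla_flat //.
  by apply: eq_bigr => l _; rewrite mxE.
apply: etrans (congr1 (fun s => 0 - _ + 2^-1 * s)
  (congr2 (fun s t => s - t) (congr2 +%R (DH i j) (DH j i)) DW)) _.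
have alg (g1 g2 g3 q b1 b2 c1 c2 : R) :
    0 - 2^-1 * (g1 + g2 - g3) +
      2^-1 * (g1 + b1 + (g2 + b2) - (g3 + q + c1 + c2)) =
    - (2^-1 * q) + 2^-1 * (b1 - c1 + (b2 - c2)) by field.
exact: alg.
Qed.

Lemma sqnorm_tension_graph x : U x ->
  let tau := tension G (sasaki G) f x in
  inner (sasaki G (f x)) tau tau = horizontal_density G Y x + vertical_density G Y x.
Proof.
move=> Ux tau.
have EP : tau *m bundle_proj_mx *m G x = horizontal_tension G Y x.
  apply/rowP => k; rewrite -tension_horizontal // sasakiE horizontal_lift_proj.
  by rewrite horizontal_lift_connector inner0r addr0 graph_base inner_deltar.
have EK : tau *m connector_mx G (f x) *m G x = vertical_tension G Y x.
  apply/rowP => k; rewrite -tension_vertical // sasakiE vertical_lift_proj.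
  by rewrite vertical_lift_connector inner0r add0r graph_base inner_deltar.
rewrite sasakiE graph_base /horizontal_density /vertical_density -EP -EK.
by rewrite !inner_invmx ?Gsym // posdef_unitmx //; exact: Gpos.
Qed.

End GraphTension.

(** * Dilations and parallel fields *)

Section Scaling.
Context {R : realType} {m : nat}.
Variables (U : set 'rV[R]_m) (G : 'rV[R]_m -> 'M[R]_m).
Hypothesis oU : open U.
Hypothesis sG : smooth_on U G.
Hypothesis Gsym : forall x, U x -> (G x)^T = G x.
Hypothesis Gpos : forall x, U x -> posdef (G x).
Variable Y : 'rV[R]_m -> 'rV[R]_m.

Lemma dirichlet_density_ge0 x : U x -> 0 <= dirichlet_density G Y x.
Proof.
move=> Ux; apply: double_norm_ge0; [|exact: posdef_invmx (Gsym Ux) (Gpos Ux)|exact: Gpos].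
exact: sym_invmx (Gsym Ux).
Qed.

Lemma dirichlet_density_eq0 x : U x -> dirichlet_density G Y x = 0 -> nabla G Y x = 0.
Proof.
move=> Ux; apply: double_norm_eq0; [|exact: posdef_invmx (Gsym Ux) (Gpos Ux)|exact: Gpos].
exact: sym_invmx (Gsym Ux).
Qed.

Lemma vertical_density_ge0 x : U x -> 0 <= vertical_density G Y x.
Proof. by move=> Ux; apply: posdef_ge0; exact: posdef_invmx (Gsym Ux) (Gpos Ux). Qed.

Lemma horizontal_density_ge0 x : U x -> 0 <= horizontal_density G Y x.
Proof. by move=> Ux; apply: posdef_ge0; exact: posdef_invmx (Gsym Ux) (Gpos Ux). Qed.

Section Parallel.
Hypothesis nablaY : forall x, U x -> nabla G Y x = 0.

Lemma parallel_nabla_flat x : U x -> nabla_flat G Y x = 0.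
Proof. by move=> Ux; rewrite /nabla_flat nablaY // mul0mx. Qed.

Lemma parallel_dirichlet x : U x -> dirichlet_density G Y x = 0.
Proof.
move=> Ux; rewrite /dirichlet_density /double_norm big1 // => i _; rewrite big1 // => j _.
by rewrite nablaY // row0 inner0l mulr0.
Qed.

Lemma parallel_vertical x : U x -> vertical_density G Y x = 0.
Proof.
move=> Ux; suff t0 : vertical_tension G Y x = 0 by rewrite /vertical_density t0 inner0l.
apply/rowP => k; rewrite !mxE big1 // => i _; rewrite big1 // => j _.
rewrite (@partial_eq_on _ _ _ U _ (cst 0)) //; last first.
  by move=> y Uy; rewrite parallel_nabla_flat // mxE.
rewrite partial_cst parallel_nabla_flat // big1 => [|p _]; last by rewrite mxE mulr0.
by rewrite big1 => [|p _]; rewrite ?subrr ?mulr0 // mxE mulr0.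
Qed.

Lemma parallel_horizontal x : U x -> horizontal_density G Y x = 0.
Proof.
move=> Ux; suff t0 : horizontal_tension G Y x = 0 by rewrite /horizontal_density t0 inner0l.
apply/rowP => k; rewrite !mxE big1 // => i _; rewrite big1 // => j _.
rewrite nablaY // row0 inner0l mulr0 parallel_nabla_flat //.
rewrite big1 => [|p _]; last by rewrite mxE mulr0.
by rewrite big1 => [|p _]; rewrite ?subrr ?mulr0 // mxE mulr0.
Qed.

End Parallel.

Hypothesis sY : smooth_on U Y.
Variable s : R.
Local Notation sY' := (fun y => s *: Y y).

Lemma conn_scale x : conn G sY' x = s *: conn G Y x.
Proof.
apply/matrixP => i k; rewrite [RHS]mxE !conn_entry mulr_sumr; apply: eq_bigr => j _.
by rewrite mxE mulrCA.
Qed.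

Lemma nabla_scale x : U x -> nabla G sY' x = s *: nabla G Y x.
Proof.
move=> Ux; rewrite !nablaE conn_scale scalerDr; congr (_ + _).
apply/matrixP => i k; rewrite !mxE.
have -> : partial i sY' x = s *: partial i Y x.
  exact: (deriveZ s (smooth_on_derivable sY Ux)).
by rewrite mxE.
Qed.

Lemma nabla_flat_scale x : U x -> nabla_flat G sY' x = s *: nabla_flat G Y x.
Proof. by move=> Ux; rewrite /nabla_flat nabla_scale // scalemxAl. Qed.

Lemma vertical_tension_scale x : U x ->
  vertical_tension G sY' x = s *: vertical_tension G Y x.
Proof.
move=> Ux; apply/rowP => k; rewrite !mxE mulr_sumr; apply: eq_bigr => i _.
rewrite mulr_sumr; apply: eq_bigr => j _; rewrite mulrCA; congr (_ * _).
have -> : partial i (fun y => nabla_flat G sY' y j k) x =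
    s * partial i (fun y => nabla_flat G Y y j k) x.
  rewrite (@partial_eq_on _ _ _ U _ (fun y => s * nabla_flat G Y y j k)) //.
    apply: partialZ.
    exact: (smooth_on_derivable
      (smooth_on_entry j k oU (smooth_nabla_flat oU sG Gpos sY)) Ux).
  by move=> y Uy; rewrite nabla_flat_scale // mxE.
rewrite nabla_flat_scale // !mulrBr !mulr_sumr; congr (_ - _ - _).
  by apply: eq_bigr => p _; rewrite mxE mulrCA.
by apply: eq_bigr => p _; rewrite mxE mulrCA.
Qed.

Lemma horizontal_tension_scale x : U x ->
  horizontal_tension G sY' x = s ^+ 2 *: horizontal_tension G Y x.
Proof.
move=> Ux; apply/rowP => k; rewrite !mxE mulr_sumr; apply: eq_bigr => i _.
rewrite mulr_sumr; apply: eq_bigr => j _; rewrite mulrCA; congr (_ * _).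
have dC l : partial i (fun y => conn G sY' y k l) x = s * partial i (fun y => conn G Y y k l) x.
  have -> : (fun y => conn G sY' y k l) = (fun y => s * conn G Y y k l).
    by apply/funext => y; rewrite conn_scale mxE.
  apply: partialZ; exact: (smooth_on_derivable (smooth_conn_entry oU sG Gpos sY k l) Ux).
have linZ a b : row a (s *: b : 'M[R]_m) = s *: row a b by rewrite linearZ.
rewrite nabla_scale // nabla_flat_scale // !linZ innerZl innerZr !mulrBr !mulr_sumr.
congr (_ - _ - _).
- by apply: eq_bigr => l _; rewrite dC mxE expr2; ring.
- by rewrite expr2; ring.
- apply: eq_bigr => l _.
  have -> : \sum_p partial k (fun y => christoffel G y l i p) x * (s *: Y x) 0 p =
      s * \sum_p partial k (fun y => christoffel G y l i p) x * Y x 0 p.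
    by rewrite mulr_sumr; apply: eq_bigr => p _; rewrite mxE mulrCA.
  have -> : \sum_p christoffel G x l i p * conn G sY' x k p =
      s * \sum_p christoffel G x l i p * conn G Y x k p.
    by rewrite mulr_sumr; apply: eq_bigr => p _; rewrite conn_scale mxE mulrCA.
  rewrite mxE expr2 -mulrBr; ring.
Qed.

Lemma dirichlet_density_scale x : U x ->
  dirichlet_density G sY' x = s ^+ 2 * dirichlet_density G Y x.
Proof.
move=> Ux; rewrite /dirichlet_density /double_norm mulr_sumr; apply: eq_bigr => i _.
rewrite mulr_sumr; apply: eq_bigr => j _; rewrite nabla_scale //.
have linZ a b : row a (s *: b : 'M[R]_m) = s *: row a b by rewrite linearZ.
rewrite !linZ innerZl innerZr expr2; ring.
Qed.

Lemma vertical_density_scale x : U x ->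
  vertical_density G sY' x = s ^+ 2 * vertical_density G Y x.
Proof.
by move=> Ux; rewrite /vertical_density vertical_tension_scale // innerZl innerZr mulrA -expr2.
Qed.

Lemma horizontal_density_scale x : U x ->
  horizontal_density G sY' x = s ^+ 4 * horizontal_density G Y x.
Proof.
move=> Ux; rewrite /horizontal_density horizontal_tension_scale // innerZl innerZr mulrA.
by rewrite -exprD.
Qed.

End Scaling.

(** * Smooth families *)

Section Families.
Context {R : realType} {m : nat}.
Implicit Types (t : R) (x : 'rV[R]_m) (z : 'rV[R]_(1 + m)).

Definition joint {V : Type} (F : R -> 'rV[R]_m -> V) z : V := F (lsubmx z 0 0) (rsubmx z).

Definition joint_dom (e : R) (U : set 'rV[R]_m) : set 'rV[R]_(1 + m) :=
  [set z | `|lsubmx z 0 0| < e /\ U (rsubmx z)].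

Lemma time_cons t x : lsubmx (cons_coord t x : 'rV[R]_(1 + m)) 0 0 = t.
Proof. by rewrite (row_mxKl (t%:M : 'rV[R]_1)) mxE. Qed.

Lemma space_cons t x : rsubmx (cons_coord t x : 'rV[R]_(1 + m)) = x.
Proof. exact: (row_mxKr (t%:M : 'rV[R]_1)). Qed.

Lemma joint_cons {V : Type} (F : R -> 'rV[R]_m -> V) t x : joint F (cons_coord t x) = F t x.
Proof. by rewrite /joint time_cons space_cons. Qed.

Lemma joint_dom_cons e U t x : `|t| < e -> U x -> joint_dom e U (cons_coord t x).
Proof. by move=> te Ux; split; rewrite ?time_cons ?space_cons. Qed.

Lemma time_continuous : continuous (fun z : 'rV[R]_(1 + m) => lsubmx z 0 0).
Proof.
move=> z; apply: (@continuous_comp _ _ _ (@lsubmx R 1 1 m) (fun M : 'rV[R]_1 => M 0 0)).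
  exact: lsubmx_continuous.
exact: coord_continuous.
Qed.

Lemma open_joint_dom e U : open U -> open (joint_dom e U).
Proof.
move=> oU; apply: openI.
  apply: (@open_comp _ _ (fun z : 'rV[R]_(1 + m) => `|lsubmx z 0 0|) [set t | t < e]).
    move=> z _; apply: (@continuous_comp _ _ _ (fun z : 'rV[R]_(1 + m) => lsubmx z 0 0)).
      exact: time_continuous.
    exact: norm_continuous.
  exact: open_lt.
by apply: open_comp => // z _; exact: rsubmx_continuous.
Qed.

Lemma partial_joint {V : normedModType R} (F : R -> 'rV[R]_m -> V) i :
  partial (rshift 1 i) (joint F) = joint (fun t => partial i (F t)).
Proof.
apply/funext => z; rewrite /partial /joint /derive.
set k1 := fun h => h^-1 *: _; set k2 := fun h => h^-1 *: _.
suff -> : k1 = k2 by [].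
apply/funext => h; rewrite /k1 /k2; congr (_ *: (F _ _ - _)).
  by rewrite linearD linearZ /= lsubmx_delta_r scaler0 add0r.
by rewrite linearD linearZ /= rsubmx_delta_r.
Qed.

Section SmoothFamilies.
Variables (e : R) (U : set 'rV[R]_m) (G : 'rV[R]_m -> 'M[R]_m).
Hypothesis oU : open U.
Hypothesis sG : smooth_on U G.
Hypothesis Gpos : forall x, U x -> posdef (G x).

Definition smooth_family {V : normedModType R} (F : R -> 'rV[R]_m -> V) : Prop :=
  smooth_on (joint_dom e U) (joint F).

Let oW : open (joint_dom e U). Proof. exact: open_joint_dom. Qed.

Lemma smooth_family_cst {V : normedModType R} (f : 'rV[R]_m -> V) :
  smooth_on U f -> smooth_family (fun=> f).
Proof.
move=> sf s z [_ Uz]; have sW := smooth_on_rsubmx (p := 1) oU sf.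
exact: (sW s z Uz).
Qed.

Lemma smooth_family_partial {V : normedModType R} (F : R -> 'rV[R]_m -> V) i :
  smooth_family F -> smooth_family (fun t => partial i (F t)).
Proof. by move=> sF; rewrite /smooth_family -partial_joint; exact: smooth_on_partial. Qed.

Lemma smooth_family_entry p q (F : R -> 'rV[R]_m -> 'M[R]_(p, q)) a b :
  smooth_family F -> smooth_family (fun t x => F t x a b).
Proof. by move=> sF; exact: (smooth_on_entry a b oW sF). Qed.

Lemma smooth_familyD (F H : R -> 'rV[R]_m -> R) :
  smooth_family F -> smooth_family H -> smooth_family (fun t x => F t x + H t x).
Proof. exact: (smooth_onD oW). Qed.

Lemma smooth_familyB (F H : R -> 'rV[R]_m -> R) :
  smooth_family F -> smooth_family H -> smooth_family (fun t x => F t x - H t x).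
Proof. exact: (smooth_onB oW). Qed.

Lemma smooth_familyM (F H : R -> 'rV[R]_m -> R) :
  smooth_family F -> smooth_family H -> smooth_family (fun t x => F t x * H t x).
Proof. exact: (smooth_onM oW). Qed.

Lemma smooth_family_sum n (F : 'I_n -> R -> 'rV[R]_m -> R) :
  (forall k, smooth_family (F k)) -> smooth_family (fun t x => \sum_k F k t x).
Proof. exact: (smooth_on_sum (F := fun k => joint (F k)) _ _ oW). Qed.

Variable Z : R -> 'rV[R]_m -> 'rV[R]_m.
Hypothesis sZ : smooth_family Z.

Let sinv i j : smooth_family (fun=> fun x => invmx (G x) i j).
Proof. exact: (smooth_family_cst (smooth_metric_inv oU sG Gpos i j)). Qed.

Let sgam k i j : smooth_family (fun=> fun x => christoffel G x k i j).
Proof. exact: (smooth_family_cst (smooth_christoffel oU sG Gpos k i j)). Qed.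

Let sg i j : smooth_family (fun=> fun x => G x i j).
Proof. exact: (smooth_family_cst (smooth_metric_entry oU sG i j)). Qed.

Lemma smooth_family_conn i k : smooth_family (fun t x => conn G (Z t) x i k).
Proof.
have -> : (fun t x => conn G (Z t) x i k) =
    (fun t x => \sum_j christoffel G x k i j * Z t x 0 j).
  by apply/funext => t; apply/funext => x; rewrite conn_entry.
apply: smooth_family_sum => j.
exact: (smooth_familyM (sgam k i j) (smooth_family_entry 0 j sZ)).
Qed.

Lemma smooth_family_nabla i k : smooth_family (fun t x => nabla G (Z t) x i k).
Proof.
have -> : (fun t x => nabla G (Z t) x i k) =
    (fun t x => partial i (Z t) x 0 k + conn G (Z t) x i k).
  by apply/funext => t; apply/funext => x; rewrite nablaE !mxE.
exact: (smooth_familyD (smooth_family_entry 0 k (smooth_family_partial i sZ))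
  (smooth_family_conn i k)).
Qed.

Lemma smooth_family_nabla_flat j k : smooth_family (fun t x => nabla_flat G (Z t) x j k).
Proof.
have -> : (fun t x => nabla_flat G (Z t) x j k) =
    (fun t x => \sum_l nabla G (Z t) x j l * G x l k).
  by apply/funext => t; apply/funext => x; rewrite mxE.
apply: smooth_family_sum => l.
exact: (smooth_familyM (smooth_family_nabla j l) (sg l k)).
Qed.

Lemma smooth_family_inner n (A : R -> 'rV[R]_m -> 'M[R]_n) (u v : R -> 'rV[R]_m -> 'rV[R]_n) :
  (forall i j, smooth_family (fun t x => A t x i j)) ->
  (forall i, smooth_family (fun t x => u t x 0 i)) ->
  (forall j, smooth_family (fun t x => v t x 0 j)) ->
  smooth_family (fun t x => inner (A t x) (u t x) (v t x)).
Proof.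
move=> sA su sv.
have -> : (fun t x => inner (A t x) (u t x) (v t x)) =
    (fun t x => \sum_i \sum_j u t x 0 i * A t x i j * v t x 0 j).
  by apply/funext => t; apply/funext => x; rewrite innerE.
apply: smooth_family_sum => i; apply: smooth_family_sum => j.
exact: (smooth_familyM (smooth_familyM (su i) (sA i j)) (sv j)).
Qed.

Let snabla_row i j : smooth_family (fun t x => row i (nabla G (Z t) x) 0 j).
Proof.
have -> : (fun t x => row i (nabla G (Z t) x) 0 j) = (fun t x => nabla G (Z t) x i j).
  by apply/funext => t; apply/funext => x; rewrite mxE.
exact: smooth_family_nabla.
Qed.

Lemma smooth_family_dirichlet : smooth_family (fun t x => dirichlet_density G (Z t) x).
Proof.
apply: smooth_family_sum => i; apply: smooth_family_sum => j.
apply: (smooth_familyM (sinv i j)).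
apply: (@smooth_family_inner _ (fun=> G)) => [a b|k|k]; first exact: sg.
  exact: snabla_row.
exact: snabla_row.
Qed.

Lemma smooth_family_vertical : smooth_family (fun t x => vertical_density G (Z t) x).
Proof.
have sV k : smooth_family (fun t x => vertical_tension G (Z t) x 0 k).
  rewrite /vertical_tension.
  have -> : (fun t x => vertical_tension G (Z t) x 0 k) =
    (fun t x => \sum_i \sum_j invmx (G x) i j *
    (partial i (fun y => nabla_flat G (Z t) y j k) x
     - \sum_p christoffel G x p i j * nabla_flat G (Z t) x p k
     - \sum_l christoffel G x l i k * nabla_flat G (Z t) x j l)).
    by apply/funext => t; apply/funext => x; rewrite mxE.
  apply: smooth_family_sum => i; apply: smooth_family_sum => j.
  apply: (smooth_familyM (sinv i j)); apply: smooth_familyB.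
    apply: smooth_familyB.
      exact: (smooth_family_partial i (smooth_family_nabla_flat j k)).
    apply: smooth_family_sum => p.
    exact: (smooth_familyM (sgam p i j) (smooth_family_nabla_flat p k)).
  apply: smooth_family_sum => l.
  exact: (smooth_familyM (sgam l i k) (smooth_family_nabla_flat j l)).
apply: (@smooth_family_inner _ (fun t x => invmx (G x))) => [a b|k|k]; first exact: sinv.
  exact: sV.
exact: sV.
Qed.

Lemma smooth_family_horizontal : smooth_family (fun t x => horizontal_density G (Z t) x).
Proof.
have sH k : smooth_family (fun t x => horizontal_tension G (Z t) x 0 k).
  have -> : (fun t x => horizontal_tension G (Z t) x 0 k) =
    (fun t x => \sum_i \sum_j invmx (G x) i j *
    (\sum_l partial i (fun y => conn G (Z t) y k l) x * nabla_flat G (Z t) x j l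
     - 2^-1 * inner (partial k G x) (row i (nabla G (Z t) x)) (row j (nabla G (Z t) x))
     - \sum_l (\sum_p partial k (fun y => christoffel G y l i p) x * Z t x 0 p
               - \sum_p christoffel G x l i p * conn G (Z t) x k p)
          * nabla_flat G (Z t) x j l)).
    by apply/funext => t; apply/funext => x; rewrite mxE.
  apply: smooth_family_sum => i; apply: smooth_family_sum => j.
  apply: (smooth_familyM (sinv i j)); apply: smooth_familyB.
    apply: smooth_familyB.
      apply: smooth_family_sum => l.
      exact: (smooth_familyM (smooth_family_partial i (smooth_family_conn k l))
        (smooth_family_nabla_flat j l)).
    apply: (smooth_familyM (smooth_family_cst (smooth_on_cst (2^-1 : R) oU))).
    apply: (@smooth_family_inner _ (fun=> partial k G)) => [a b|a|a].
    - exact: (smooth_family_cst (smooth_metric_partial oU sG k a b)).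
    - exact: snabla_row.
    - exact: snabla_row.
  apply: smooth_family_sum => l.
  apply: (fun H => smooth_familyM H (smooth_family_nabla_flat j l)).
  apply: smooth_familyB; apply: smooth_family_sum => p.
    apply: (fun H => smooth_familyM H (smooth_family_entry 0 p sZ)).
    exact: (smooth_family_partial k (sgam l i p)).
  exact: (smooth_familyM (sgam l i p) (smooth_family_conn k p)).
apply: (@smooth_family_inner _ (fun t x => invmx (G x))) => [a b|k|k]; first exact: sinv.
  exact: sH.
exact: sH.
Qed.

End SmoothFamilies.

Section FamilyEstimates.
Variables (e : R) (U : set 'rV[R]_m).
Hypothesis e0 : 0 < e.
Hypothesis oU : open U.
Variable F : R -> 'rV[R]_m -> R.
Hypothesis sF : smooth_family e U F.

Lemma smooth_family_continuous t x : `|t| < e -> U x -> {for x, continuous (F t)}.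
Proof.
move=> te Ux.
have -> : F t = (fun y => joint F (cons_coord t y)).
  by apply/funext => y; rewrite joint_cons.
apply: (@continuous_comp _ _ _ (cons_coord t) (joint F)).
  exact: cons_coord_continuousr.
exact: (smooth_on_continuous sF (joint_dom_cons te Ux)).
Qed.

Lemma cons_coord_line t s x :
  t *: (delta_mx 0 (lshift m (0 : 'I_1)) : 'rV[R]_(1 + m)) + (cons_coord s x : 'rV[R]_(1 + m))
  = cons_coord (t + s) x.
Proof.
apply/rowP; apply: ordS_ind => [|j].
  have -> : (0 : 'I_m.+1) = lshift m (0 : 'I_1) by apply: val_inj.
  rewrite mxE [X in X + _]mxE [X in _ * X]mxE !eqxx mulr1.
  by rewrite !(row_mxEl (_%:M : 'rV[R]_1)) !mxE.
rewrite mxE [X in X + _]mxE [X in _ * X]mxE eq_rlshift andbF mulr0 add0r.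
by rewrite !cons_coordS.
Qed.

Hypothesis F_ge0 : forall t x, `|t| < e -> U x -> 0 <= F t x.
Hypothesis F0 : forall x, U x -> F 0 x = 0.

Let time : 'I_(1 + m) := lshift m (0 : 'I_1).

(** Time zero is a minimum of [F] at every point. *)
Lemma time_derivative_at0 x : U x -> partial time (joint F) (cons_coord 0 x) = 0.
Proof.
move=> Ux; pose f t := joint F (t *: delta_mx 0 time + cons_coord 0 x).
have fE t : f t = F t x by rewrite /f cons_coord_line addr0 joint_cons.
have df t : `|t| < e -> is_derive t 1 f
    ('D_(delta_mx 0 time) (joint F) (t *: delta_mx 0 time + cons_coord 0 x)).
  move=> te; apply: derivable_along_line; rewrite cons_coord_line addr0.
  exact: (smooth_on_derivable sF (joint_dom_cons te Ux)).
have e00 : `|0 : R| < e by rewrite normr0.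
have : is_derive (0 : R) 1 f 0.
  apply: (@derive1_at_min _ f (- e) e 0).
  - by rewrite ge0_cp // ltW.
  - by move=> t; rewrite in_itv /= -ltr_norml => /df [].
  - by rewrite in_itv /= oppr_lt0 e0.
  - move=> t; rewrite in_itv /= -ltr_norml => te; rewrite !fE F0 //.
    exact: F_ge0.
move=> [_ D0]; have [_] := df 0 e00.
by rewrite D0 scale0r add0r => /esym.
Qed.

(** Mean value theorem in time: the time derivative vanishes at time zero, and
    compactness keeps it small on [K] for all small times at once. *)
Lemma family_little_o (K : set 'rV[R]_m) (d : R) : compact K -> K `<=` U -> 0 < d ->
  \forall t \near (0 : R), forall x, K x -> `|F t x| <= d * `|t|.
Proof.
move=> cK KU d0.
pose good t x := joint_dom e U (cons_coord t x) /\
  `|partial time (joint F) (cons_coord t x)| <= d.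
have : \forall t \near (0 : R), K `<=` good t.
  have /compact_near_coveringP cover := cK.
  apply: (cover R (nbhs (0 : R)) good) => x Kx; have Ux := KU _ Kx.
  have Wx : joint_dom e U (cons_coord 0 x) by apply: joint_dom_cons => //; rewrite normr0.
  have : \forall z \near (cons_coord 0 x : 'rV[R]_(1 + m)),
      joint_dom e U z /\ `|partial time (joint F) z| <= d.
    have cp := smooth_on_continuous (smooth_on_partial time sF) Wx.
    have /cvgrPdist_le/(_ _ d0) := cp; rewrite time_derivative_at0 //.
    have nW : nbhs (cons_coord 0 x : 'rV[R]_(1 + m)) (joint_dom e U).
      by apply: open_nbhs_nbhs; split; first exact: open_joint_dom.
    by apply: filterS2 nW => z Wz; rewrite sub0r normrN.
  move=> /(@cons_coord_continuous R m (0, x))[[P Q] /= [P0 Qx] PQ].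
  by exists (Q, P) => //= -[x' t] [/= Qx' Pt]; exact: (PQ (t, x')).
move=> /nbhs_ballP[r r0 H]; apply/nbhs_ballP; exists r => // t rt x Kx.
have Ux := KU _ Kx.
have good_seg (a : R) : 0 <= a <= 1 ->
    good (a * t) x.
  move=> /andP[a0 a1]; apply: H => //; move: rt; rewrite /ball /= !sub0r !normrN.
  by apply: le_lt_trans; rewrite normrM ger0_norm // ler_piMl.
have [|a [a01 Ea]] := @partial_mvt _ _ (joint F) (cons_coord 0 x) time t.
  move=> a a01; rewrite cons_coord_line addr0.
  exact: (smooth_on_derivable sF (good_seg a a01).1).
move: Ea; rewrite !cons_coord_line !addr0 !joint_cons F0 // subr0 => ->.
by rewrite normrM mulrC ler_wpM2r // (good_seg a a01).2.
Qed.

End FamilyEstimates.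

End Families.

(** * Tensoriality of the covariant derivative *)

Section LoweredNabla.
Context {R : realType}.

Definition christoffel1 n (G : 'rV[R]_n -> 'M[R]_n) (x : 'rV[R]_n) (i j l : 'I_n) : R :=
  2^-1 * (partial i G x j l + partial j G x i l - partial l G x i j).

(** With its last index lowered, the covariant derivative involves only the
    Christoffel symbols of the first kind, hence no inverse matrix. *)
Lemma inner_nabla_flat_mx n (G : 'rV[R]_n -> 'M[R]_n) (X : 'rV[R]_n -> 'rV[R]_n) x u w :
  G x \in unitmx -> (G x)^T = G x ->
  inner (nabla_flat G X x) u w =
  inner (G x) (dirpartial u X x) w + trilinear (christoffel1 G x) u (X x) w.
Proof.
move=> Gu Gs; pose D : 'M[R]_n := \matrix_(i, k) partial i X x 0 k.
pose T : 'M[R]_n := \matrix_(i, l) \sum_j christoffel1 G x i j l * X x 0 j.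
have E : nabla_flat G X x = D *m G x + T.
  apply/matrixP => i l; rewrite mxE [RHS]mxE [X in _ = X + _]mxE [X in _ = _ + X]mxE.
  transitivity (\sum_k (partial i X x 0 k * G x k l +
      \sum_j christoffel G x k i j * X x 0 j * G x k l)).
    by apply: eq_bigr => k _; rewrite mxE mulrDl mulr_suml.
  rewrite big_split /=; congr (_ + _); first by apply: eq_bigr => k _; rewrite mxE.
  rewrite exchange_big /=; apply: eq_bigr => j _.
  rewrite -[christoffel1 _ _ _ _ _](lowered_christoffel i j l Gu Gs) mulr_suml.
  by apply: eq_bigr => k _; rewrite mulrAC.
rewrite E innerDm; congr (_ + _).
  have -> : dirpartial u X x = u *m D.
    apply/rowP => k; rewrite summxE mxE; apply: eq_bigr => b _; by rewrite !mxE.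
  by rewrite /inner mulmxA.
rewrite innerE /trilinear; apply: eq_bigr => b _; rewrite exchange_big /=.
apply: eq_bigr => d _; rewrite mxE mulr_sumr mulr_suml; apply: eq_bigr => c _.
ring.
Qed.

Lemma trilinear_sumr n (S : 'I_n -> 'I_n -> 'I_n -> R) (u w : 'rV[R]_n) (a : 'I_n -> R)
    (v : 'I_n -> 'rV[R]_n) :
  \sum_j a j * trilinear S u (v j) w = trilinear S u (\sum_j a j *: v j) w.
Proof.
rewrite /trilinear; under eq_bigr do rewrite mulr_sumr.
rewrite exchange_big /=; apply: eq_bigr => b _.
under eq_bigr do rewrite mulr_sumr.
rewrite exchange_big /=; apply: eq_bigr => c _.
under eq_bigr do rewrite mulr_sumr.
rewrite exchange_big /=; apply: eq_bigr => d _.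
rewrite summxE mulr_sumr !mulr_suml; apply: eq_bigr => j _; rewrite mxE; ring.
Qed.

Lemma trilinear_delta n (S : 'I_n -> 'I_n -> 'I_n -> R) i l (v : 'rV[R]_n) :
  trilinear S (delta_mx 0 i) v (delta_mx 0 l) = \sum_j v 0 j * S i j l.
Proof.
rewrite /trilinear.
transitivity (\sum_b (delta_mx 0 i : 'rV[R]_n) 0 b * (\sum_j v 0 j * S b j l)).
  apply: eq_bigr => b _; rewrite mulr_sumr; apply: eq_bigr => c _.
  transitivity (\sum_d ((delta_mx 0 i : 'rV[R]_n) 0 b * (v 0 c * S b c d)) *
    (delta_mx 0 l : 'rV[R]_n) 0 d); last exact: (sum_delta_r l).
  by apply: eq_bigr => d _; ring.
exact: (sum_delta_l i).
Qed.

End LoweredNabla.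

Section ChainRule.
Context {R : realType} {n p : nat}.
Variables (O : set 'rV[R]_n) (U : set 'rV[R]_p) (phi : 'rV[R]_n -> 'rV[R]_p).
Hypothesis oO : open O.
Hypothesis oU : open U.
Hypothesis sphi : smooth_on O phi.
Hypothesis phiU : forall x, O x -> U (phi x).

Lemma jacobian_row x i : O x -> row i ('J phi x) = partial i phi x.
Proof.
move=> Ox; have dphi := smooth_on_differentiable_rV oO sphi Ox.
by rewrite rowE; exact: (esym (deriveEjacobian _ dphi)).
Qed.

Lemma jacobian_entry x i a : O x -> 'J phi x i a = partial i phi x 0 a.
Proof. by move=> Ox; rewrite -jacobian_row // [RHS]mxE. Qed.

Lemma chain_rule_scalar (h : 'rV[R]_p -> R) x i : smooth_on U h -> O x ->
  derivable (h \o phi) x (delta_mx 0 i) /\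
  partial i (h \o phi) x = dirpartial (row i ('J phi x)) h (phi x).
Proof.
move=> sh Ox; have dphi := smooth_on_differentiable_rV oO sphi Ox.
have dh := smooth_on_differentiable oU sh (phiU Ox).
have dc : differentiable (h \o phi) x by exact: differentiable_comp.
split; first exact: diff_derivable.
apply: etrans (deriveE _ dc) _; rewrite diff_comp //=.
rewrite -(deriveE (delta_mx 0 i) dphi) -/(partial i phi x) -(jacobian_row i Ox).
rewrite [row i ('J phi x) in LHS]row_sum_delta linear_sum; apply: eq_bigr => b _.
by rewrite linearZ /= -(deriveE _ dh).
Qed.

Lemma chain_rule q r (F : 'rV[R]_p -> 'M[R]_(q, r)) x i : smooth_on U F -> O x ->
  derivable (F \o phi) x (delta_mx 0 i) /\
  partial i (F \o phi) x = dirpartial (row i ('J phi x)) F (phi x).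
Proof.
move=> sF Ox.
have C a b := chain_rule_scalar i (smooth_on_entry a b oU sF) Ox.
have dF : derivable (F \o phi) x (delta_mx 0 i).
  by apply/derivable_mxP => a b; exact: (C a b).1.
split=> //; apply/matrixP => a b; rewrite (partial_entry a b dF).
apply: etrans (C a b).2 _; rewrite /dirpartial summxE; apply: eq_bigr => c _.
by rewrite [RHS]mxE (partial_entry a b (smooth_on_derivable sF (phiU Ox))).
Qed.

Lemma smooth_jacobian : smooth_on O (fun x => 'J phi x).
Proof.
apply: (smooth_on_mx oO) => i a.
apply: (smooth_on_eq oO _ (smooth_on_entry 0 a oO (smooth_on_partial i sphi))).
by move=> x Ox; rewrite jacobian_entry.
Qed.

(** Symmetry of the second derivatives of the components of [phi]. *)
Lemma partial_jacobian_sym x i j : O x ->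
  row j (partial i (fun y => 'J phi y) x) = row i (partial j (fun y => 'J phi y) x).
Proof.
move=> Ox; apply/rowP => a.
have E k l : row l (partial k (fun y => 'J phi y) x) 0 a =
    partial k (partial l (fun y => phi y 0 a)) x.
  rewrite mxE (partial_entry _ _ (smooth_on_derivable smooth_jacobian Ox)).
  apply: (partial_eq_on k oO) Ox => y Oy.
  by rewrite jacobian_entry // (partial_entry 0 a (smooth_on_derivable sphi Oy)).
apply: etrans (E i j) _.
apply: etrans _ (esym (E j i)).
exact: (partialC i j oO (smooth_on_entry 0 a oO sphi) Ox).
Qed.

End ChainRule.

Section Tensoriality.
Context {R : realType} {m : nat}.
Variables (O U U' : set 'rV[R]_m) (phi : 'rV[R]_m -> 'rV[R]_m).
Variables (G G' : 'rV[R]_m -> 'M[R]_m) (X X' : 'rV[R]_m -> 'rV[R]_m).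
Hypotheses (oO : open O) (oU' : open U').
Hypotheses (OU : forall x, O x -> U x) (OU' : forall x, O x -> U' (phi x)).
Hypothesis sphi : smooth_on O phi.
Hypothesis sG' : smooth_on U' G'.
Hypotheses (sX : smooth_on U X) (sX' : smooth_on U' X').
Hypotheses (Gs : forall x, U x -> (G x)^T = G x) (Gp : forall x, U x -> posdef (G x)).
Hypotheses (Gs' : forall x, U' x -> (G' x)^T = G' x) (Gp' : forall x, U' x -> posdef (G' x)).
Hypothesis GE : forall x, O x -> G x = 'J phi x *m G' (phi x) *m ('J phi x)^T.
Hypothesis XE : forall x, O x -> X' (phi x) = X x *m 'J phi x.

Local Notation J := (fun y => 'J phi y).

Lemma mulmx3_entry n p q (A : 'M[R]_(n, q)) (B : 'M[R]_q) (C : 'M[R]_(p, q)) i j :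
  (A *m B *m C^T) i j = inner B (row i A) (row j C).
Proof.
rewrite /inner tr_row -row_mul; move: (A *m B) (C^T) => D E.
by rewrite mxE [RHS]mxE; apply: eq_bigr => k _; rewrite !mxE.
Qed.

Lemma partial_metric_transition x i j l : O x ->
  partial i G x j l =
  inner (G' (phi x)) (row j (partial i J x)) (row l (J x)) +
  inner (G' (phi x)) (row j (J x)) (row l (partial i J x)) +
  trilinear (fun a b c => partial a G' (phi x) b c) (row i (J x)) (row j (J x)) (row l (J x)).
Proof.
move=> Ox.
rewrite (partial_eq_on i oO GE Ox).
have dJ := smooth_on_derivable (i := i) (smooth_jacobian oO sphi) Ox.
have [dg' Eg'] := chain_rule oO oU' sphi OU' i sG' Ox.
have [dJT EJT] := derivable_trmx dJ.
have [dJg EJg] := derivable_mulmx dJ dg'.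
rewrite (derivable_mulmx dJg dJT).2 EJg EJT Eg' mulmxDl.
rewrite mxE [X in X + _]mxE addrAC; congr (_ + _ + _); try exact: mulmx3_entry.
by apply: etrans (mulmx3_entry _ _ _ _ _) _; exact: inner_dirpartial.
Qed.

Lemma koszul_sum n (H T : 'I_n -> 'I_n -> 'I_n -> R) i j l :
  (forall a b c, H a b c = H b a c) ->
  2^-1 * (H i j l + H i l j + T i j l + (H j i l + H j l i + T j i l) -
          (H l i j + H l j i + T l i j)) =
  H i j l + 2^-1 * (T i j l + T j i l - T l i j).
Proof. by move=> Hs; rewrite (Hs j i l) (Hs l i j) (Hs l j i); field. Qed.

(** The second derivatives of the transition map enter the three terms
    symmetrically, so that a single one survives. *)
Lemma christoffel1_transition x i j l : O x ->
  christoffel1 G x i j l =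
  inner (G' (phi x)) (row j (partial i J x)) (row l (J x)) +
  trilinear (christoffel1 G' (phi x)) (row i (J x)) (row j (J x)) (row l (J x)).
Proof.
move=> Ox; have g's := Gs' (OU' Ox).
pose H a b c := inner (G' (phi x)) (row b (partial a J x)) (row c (J x)).
pose S a b c := partial a G' (phi x) b c.
pose T a b c := trilinear S (row a (J x)) (row b (J x)) (row c (J x)).
have Hs a b c : H a b c = H b a c.
  exact: (congr1 (fun r => inner (G' (phi x)) r (row c (J x)))
    (partial_jacobian_sym oO sphi a b Ox)).
have P a b c : partial a G x b c = H a b c + H a c b + T a b c.
  apply: etrans (partial_metric_transition a b c Ox) _.
  by congr (_ + _ + _); exact: innerC.
apply: etrans (congr1 (fun s => 2^-1 * s) (congr2 (fun u v => u - v)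
  (congr2 +%R (P i j l) (P j i l)) (P l i j))) _.
apply: etrans (koszul_sum T i j l Hs) _; congr (_ + _).
exact: (esym (trilinear_christoffel S _ _ _)).
Qed.

(** The second derivatives of the transition map that come from the field and
    those that come from the Christoffel symbols recombine into the derivative
    of [X *m J = X' \o phi]. *)
Lemma nabla_flat_transition x i l : O x ->
  nabla_flat G X x i l =
  inner (nabla_flat G' X' (phi x)) (row i (J x)) (row l (J x)).
Proof.
move=> Ox; have Ux := OU Ox; have U'x := OU' Ox.
have Gu := posdef_unitmx (Gp Ux); have Gu' := posdef_unitmx (Gp' U'x).
rewrite -inner_delta (inner_nabla_flat_mx _ _ _ Gu (Gs Ux)).
apply: etrans _ (esym (inner_nabla_flat_mx _ _ _ Gu' (Gs' U'x))).
have dX := smooth_on_derivable (i := i) sX Ux.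
have dJ := smooth_on_derivable (i := i) (smooth_jacobian oO sphi) Ox.
have [_ EX'] := chain_rule oO oU' sphi OU' i sX' Ox.
have dX' : dirpartial (row i (J x)) X' (phi x) =
    partial i X x *m J x + X x *m partial i J x.
  by rewrite -EX' (partial_eq_on i oO XE Ox) (derivable_mulmx dX dJ).2.
rewrite dX' dirpartial_delta innerDl -addrA; congr (_ + _).
  rewrite (GE Ox); apply: etrans (inner_congr _ _ _ _) _.
  by rewrite -rowE.
rewrite trilinear_delta (XE Ox).
transitivity (\sum_j X x 0 j * inner (G' (phi x)) (row j (partial i J x)) (row l (J x)) +
  \sum_j X x 0 j * trilinear (christoffel1 G' (phi x)) (row i (J x)) (row j (J x))
    (row l (J x))).
  rewrite -big_split /=; apply: eq_bigr => j _.
  by rewrite -mulrDr; congr (_ * _); exact: christoffel1_transition.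
have rowsE (A : 'M[R]_m) : X x *m A = \sum_j X x 0 j *: row j A by exact: mulmx_sum_row.
congr (_ + _).
  rewrite rowsE inner_suml; apply: eq_bigr => j _; by rewrite innerZl.
by rewrite trilinear_sumr rowsE.
Qed.

Lemma nabla_transition x : O x -> nabla G' X' (phi x) = 0 -> nabla G X x = 0.
Proof.
move=> Ox N'0; have Gu := posdef_unitmx (Gp (OU Ox)).
rewrite -[LHS](mulmxK Gu) -/(nabla_flat G X x).
suff -> : nabla_flat G X x = 0 by rewrite mul0mx.
apply/matrixP => i l; rewrite nabla_flat_transition // mxE /nabla_flat N'0 mul0mx.
exact: inner0m.
Qed.

End Tensoriality.

(** * Charts and partitions of unity *)

Section ChartDomains.
Context {R : realType} {M : topologicalType} {m : nat}.
Implicit Types (c d : chart R M m) (p : M) (x : 'rV[R]_m).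

Lemma chart_im_inv c x : chart_im c x ->
  chart_dom c (chart_inv c x) /\ chart_map c (chart_inv c x) = x.
Proof. by move=> [p pc <-]; rewrite chart_mapK. Qed.

Lemma chart_map_im c p : chart_dom c p -> chart_im c (chart_map c p).
Proof. by move=> pc; exists p. Qed.

Lemma open_chart_im c : open (chart_im c).
Proof. exact: chart_map_open. Qed.

Lemma chart_inv_continuous_at c x : chart_im c x -> {for x, continuous (chart_inv c)}.
Proof.
move=> cx; have := @chart_inv_continuous _ _ _ c.
rewrite continuous_open_subspace; last exact: chart_map_open.
by apply; rewrite inE.
Qed.

Lemma overlapE c d : overlap c d = chart_im c `&` chart_inv c @^-1` chart_dom d.
Proof.
apply/seteqP; split => x.
  by move=> [p [pc pd] <-]; split; [exact: chart_map_im|rewrite /= chart_mapK].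
by move=> [[p pc <-]]; rewrite /= chart_mapK // => pd; exists p.
Qed.

Lemma overlap_im c d x : overlap c d x -> chart_im c x.
Proof. by rewrite overlapE => -[]. Qed.

Lemma transition_im c d x : overlap c d x -> chart_im d (transition c d x).
Proof. by rewrite overlapE => -[_ xd]; exact: chart_map_im. Qed.

Lemma open_overlap c d : open (overlap c d).
Proof.
rewrite openE => x ov; have cx := overlap_im ov; move: ov; rewrite overlapE => -[_ xd].
apply: filterI; first by apply: open_nbhs_nbhs; split => //; exact: open_chart_im.
apply: (chart_inv_continuous_at cx); apply: open_nbhs_nbhs.
by split; [exact: chart_dom_open|].
Qed.

End ChartDomains.

Section PartitionOfUnity.
Context {R : realType} {M : topologicalType} {m : nat}.
Hypothesis hM : hausdorff_space M.
Hypothesis cM : compact [set: M].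
Variable A : set (chart R M m).
Hypothesis coverA : forall p : M, exists2 c, A c & chart_dom c p.

(** A Urysohn function supported in a neighbourhood [V] of [p] that is disjoint
    from a neighbourhood [W] of the complement of a chart domain: the closure of
    [V] still avoids that complement. *)
Lemma bump_function (p : M) : exists ch : chart R M m * (M -> R),
  [/\ A ch.1, continuous ch.2, forall q, 0 <= ch.2 q,
      closure [set q | ch.2 q != 0] `<=` chart_dom ch.1 & 0 < ch.2 p].
Proof.
have [c Ac pc] := coverA p; have nM := compact_normal hM cM.
have clp : closed [set p] by apply: compact_closed => //; exact: compact_set1.
have clc : closed (~` chart_dom c) by apply: open_closedC; exact: chart_dom_open.
have pc0 : [set p] `&` ~` chart_dom c = set0.
  by apply/seteqP; split => // q [-> /(_ pc)].
have [V [W [oV oW pV cW VW]]] := (@normal_openP R M).1 nM _ _ clp clc pc0.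
have VC : closed (~` V) by exact: open_closedC.
have Vp0 : ~` V `&` [set p] = set0.
  by apply/seteqP; split => // q [Vq qp]; apply: Vq; exact: pV.
have /(@uniform_separatorP M R)[h [ch hr h0 h1]] :=
  (@normal_separatorP R M).1 nM _ _ VC clp Vp0.
have hV q : h q != 0 -> V q.
  by move=> hq; apply: contrapT => Vq; move/eqP: hq; apply; apply: h0; exists q.
exists (c, h); split => //=.
- move=> q; have /hr : range h (h q) by exists q.
  by rewrite /= in_itv /= => /andP[].
- apply: (@subset_trans _ (~` W)).
    rewrite (_ : ~` W = closure (~` W)); last by apply/closure_id; exact: open_closedC.
    apply: closureS => q /hV Vq Wq.
    by have : (V `&` W) q by []; rewrite VW.
  by move=> q Wq; apply: contrapT => cq; exact: Wq (cW _ cq).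
- by have -> : h p = 1 by apply: h1; exists p.
Qed.

Lemma partition_of_unity_exists : exists P, partition_of_unity A P.
Proof.
have [F HF] := choice bump_function.
(* a finite subcover is a list that is eventually large enough for all points *)
pose eventually_large : set_system (seq M) :=
  [set P : set (seq M) | exists s0 : seq M, forall s : seq M, {subset s0 <= s} -> P s].
have ff : Filter eventually_large.
  split.
  - by exists [::].
  - move=> P Q [s0 H0] [s1 H1]; exists (s0 ++ s1) => s sub; split.
      by apply: H0 => p ps; apply: sub; rewrite mem_cat ps.
    by apply: H1 => p ps; apply: sub; rewrite mem_cat ps orbT.
  - by move=> P Q PQ [s0 H0]; exists s0 => s /H0 /PQ.
have /compact_near_coveringP cover := cM.
have [|s0 H0] := cover _ eventually_large
    (fun s q => exists2 p, p \in s & 0 < (F p).2 q) ff.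
  move=> q _; have [_ cF _ _ Fq] := HF q.
  exists ([set q' | 0 < (F q).2 q'], [set s : seq M | q \in s]); last first.
    by move=> [q' s] [/= Fq' qs]; exists q.
  split; last by exists [:: q] => s /=; apply; rewrite mem_head.
  apply: open_nbhs_nbhs; split => //.
  by apply: (@open_comp _ _ (F q).2 [set t : R | 0 < t]) => [q' _|];
    [exact: cF|exact: open_gt].
pose s := s0; have covD q : exists2 p, p \in s & 0 < (F p).2 q by apply: (H0 s).
pose pt (k : 'I_(size s)) := tnth (in_tuple s) k.
pose S q := \sum_(k < size s) (F (pt k)).2 q.
have F0 k q : 0 <= (F (pt k)).2 q by have [] := HF (pt k).
have S0 q : 0 < S q.
  have [p pD pq] := covD q.
  have /tnthP[k pk] : p \in in_tuple s by [].
  rewrite /S (bigD1 k) //= ltr_pwDl //; last by apply: sumr_ge0.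
  by rewrite /pt -pk.
have cS : continuous S.
  move=> q; apply: (@cvg_big _ _ +%R 0 xpredT _ _ (nbhs q) _ (fun k => (F (pt k)).2)
    (fun k => (F (pt k)).2 q)) => [|k _]; first exact: add_continuous.
  by have [_ cF _ _ _] := HF (pt k); exact: cF.
exists (PartitionData (fun k => (F (pt k)).1) (fun k q => (F (pt k)).2 q / S q)).
split=> [k|q] /=.
  have [AF cF _ clF _] := HF (pt k); split=> //.
  - move=> q; apply: continuousM; first exact: cF.
    by apply: continuousV; [rewrite gt_eqF|exact: cS].
  - by move=> q; rewrite divr_ge0 // ltW.
  - suff -> : [set q | (F (pt k)).2 q / S q != 0] = [set q | (F (pt k)).2 q != 0] by [].
    apply/seteqP; split=> q /=; rewrite mulf_eq0 invr_eq0 (gt_eqF (S0 q)) orbF //.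
by rewrite -mulr_suml -/(S q) mulfV // (gt_eqF (S0 q)).
Qed.

Lemma chosen_partitionP : partition_of_unity A (chosen_partition A).
Proof.
rewrite /chosen_partition; case: pselect => [e|/(_ partition_of_unity_exists)//].
exact: projT2 (cid e).
Qed.

End PartitionOfUnity.

(** * Integration on the manifold *)

Lemma test_function_bounded (R : realType) n (f : 'rV[R]_n -> R) : test_function f ->
  exists2 B, 0 <= B & forall x, `|f x| <= B.
Proof.
move=> [cf [r r0 fr]].
have : compact (f @` [set x : 'rV[R]_n | `|x| <= r]).
  by apply: continuous_compact; [exact: continuous_subspaceT|exact: ball_compact].
move=> /compact_bounded[b [_ Hb]]; exists (Num.max 0 (b + 1)).
  by rewrite le_max lexx.
move=> x; rewrite le_max; have [xr|xr] := leP `|x| r; last first.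
  by rewrite fr // normr0 lexx.
have b1 : b < b + 1 by rewrite ltrDl.
by apply/orP; right; apply: (Hb _ b1); exists x.
Qed.

Lemma is_derive_little_o (R : realType) (f : R -> R) :
  (forall e, 0 < e -> \forall t \near (0 : R), `|f t - f 0| <= e * `|t|) ->
  is_derive (0 : R) (1 : R) f 0.
Proof.
move=> Hf.
have q0 : h^-1 *: (f (h *: 1 + 0) - f 0) @[h --> 0^'] --> (0 : R).
  apply/cvgrPdist_le => e e0; near=> h.
  have h0 : h != 0 by near: h; exact: nbhs_dnbhs_neq.
  rewrite sub0r normrN normrZ normfV addr0 [h *: 1]mulr1 mulrC ler_pdivrMr ?normr_gt0 //.
  by near: h; apply: nbhs_dnbhs; exact: Hf.
apply: DeriveDef; first by apply/cvg_ex; exists 0.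
exact: cvg_lim.
Unshelve. all: by end_near. Qed.

Section ManifoldIntegral.
Context {R : realType} {M : topologicalType} {m : nat}.
Hypothesis hM : hausdorff_space M.
Hypothesis cM : compact [set: M].
Variables (A : set (chart R M m)) (g : metric_rep R M m).
Hypothesis oA : oriented_atlas A.
Hypothesis rg : riemannian_metric A g.
Implicit Types (f h : chart R M m -> 'rV[R]_m -> R).

Let P := chosen_partition A.
Let HP : partition_of_unity A P. Proof. exact: chosen_partitionP oA.1. Qed.
Local Notation c_ := (@pu_chart R M m P).
Local Notation rho := (@pu_fun R M m P).

Let Ac k : A (c_ k). Proof. by have [/(_ k)[]] := HP. Qed.

Lemma riemannian_sym c x : A c -> chart_im c x -> (g c x)^T = g c x.
Proof. by move=> Acc; have [_ H _ _] := rg; exact: H. Qed.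

Lemma riemannian_posdef c x : A c -> chart_im c x -> posdef (g c x).
Proof. by move=> Acc cx; have [_ _ H _] := rg; exact: H. Qed.

Lemma riemannian_smooth c : A c -> smooth_on (chart_im c) (g c).
Proof. by have [H _ _ _] := rg; exact: H. Qed.

Definition pu_support (k : 'I_(pu_size P)) : set 'rV[R]_m :=
  chart_map (c_ k) @` closure [set p | rho k p != 0].

Lemma pu_support_im k : pu_support k `<=` chart_im (c_ k).
Proof.
move=> _ [p pk <-]; apply: chart_map_im.
by have [/(_ k)[_ _ _ +] _] := HP; apply.
Qed.

Lemma pu_support_compact k : compact (pu_support k).
Proof.
have [/(_ k)[_ _ _ sub] _] := HP.
apply: continuous_compact.
  exact: continuous_subspaceW sub (@chart_map_continuous _ _ _ _).
by apply: subclosed_compact cM _ => //; exact: closed_closure.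
Qed.

Lemma pu_fun_supported k x : chart_im (c_ k) x -> ~ pu_support k x ->
  rho k (chart_inv (c_ k) x) = 0.
Proof.
move=> cx xK; apply/eqP; apply: contrapT => /negP rx; apply: xK.
exists (chart_inv (c_ k) x); first exact: subset_closure.
exact: (chart_im_inv cx).2.
Qed.

Definition integrand k (f : 'rV[R]_m -> R) (x : 'rV[R]_m) : R :=
  if x \in chart_im (c_ k) then
    rho k (chart_inv (c_ k) x) * f x * Num.sqrt (\det (g (c_ k) x)) else 0.

Lemma manifold_integralE f :
  manifold_integral A g f = \sum_k iterated_integral (integrand k (f (c_ k))).
Proof. by []. Qed.

Lemma integrand_off k (f : 'rV[R]_m -> R) x : ~ pu_support k x -> integrand k f x = 0.
Proof.
move=> xK; rewrite /integrand; case: ifPn => // /set_mem cx.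
by rewrite pu_fun_supported // !mul0r.
Qed.

Lemma integrand_supported k : exists2 B, 0 <= B &
  forall f : 'rV[R]_m -> R, supported_in_ball B (integrand k f).
Proof.
have /compact_bounded[b [_ Hb]] := @pu_support_compact k.
exists (Num.max 0 (b + 1)); first by rewrite le_max lexx.
move=> f x; rewrite gt_max => /andP[_ xb]; apply: integrand_off => xK.
have b1 : b < b + 1 by rewrite ltrDl.
by have := Hb _ b1 x xK; rewrite /= leNgt xb.
Qed.

(** The chart image and the complement of the compact support of the partition
    function are open and cover the space; the integrand is a product of
    continuous functions on the former and zero on the latter. *)
Lemma integrand_continuous k (f : 'rV[R]_m -> R) :
  (forall x, chart_im (c_ k) x -> {for x, continuous f}) -> continuous (integrand k f).
Proof.
move=> cf x; have [cx|cx] := pselect (chart_im (c_ k) x).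
  pose F y := rho k (chart_inv (c_ k) y) * f y * Num.sqrt (\det (g (c_ k) y)).
  apply: (@continuous_eq_on _ _ _ _ F _ _ (@open_chart_im _ _ _ (c_ k)) _ cx).
    by move=> y cy; rewrite /integrand mem_set.
  apply: continuousM; first apply: continuousM; last 2 first.
  - exact: cf.
  - apply: (@continuous_comp _ _ _ (fun y => \det (g (c_ k) y))); last exact: sqrt_continuous.
    apply: smooth_on_continuous cx; apply: (smooth_on_det (@open_chart_im _ _ _ _)) => i j.
    exact: (smooth_on_entry i j (@open_chart_im _ _ _ _) (riemannian_smooth (Ac k))).
  - apply: (@continuous_comp _ _ _ (chart_inv (c_ k)) (rho k)).
      exact: chart_inv_continuous_at.
    by have [/(_ k)[_ + _ _] _] := HP; apply.
have clK : closed (pu_support k).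
  by apply: compact_closed; [exact: norm_hausdorff|exact: pu_support_compact].
apply: (@continuous_eq_on _ _ _ (~` pu_support k) (cst 0)).
- exact: closed_openC.
- by move=> y yK; rewrite integrand_off.
- by move=> /pu_support_im.
- exact: cst_continuous.
Qed.

Definition chartwise_continuous f : Prop :=
  forall c, A c -> forall x, chart_im c x -> {for x, continuous (f c)}.

Lemma integrand_test k f : chartwise_continuous f -> test_function (integrand k (f (c_ k))).
Proof.
move=> cf; split; first by apply: integrand_continuous => x; exact: cf.
by have [B B0 HB] := integrand_supported k; exists B.
Qed.

Lemma manifold_integral_linear a f h :
  chartwise_continuous f -> chartwise_continuous h ->
  manifold_integral A g (fun c x => a * f c x + h c x) =
  a * manifold_integral A g f + manifold_integral A g h.
Proof.
move=> cf ch; rewrite !manifold_integralE mulr_sumr -big_split /=; apply: eq_bigr => k _.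
rewrite -iterated_integral_linear; [|exact: integrand_test..].
congr iterated_integral; apply/funext => x; rewrite /integrand.
by case: ifP => _; [ring|rewrite mulr0 addr0].
Qed.

Lemma eq_manifold_integral f h :
  (forall c, A c -> forall x, chart_im c x -> f c x = h c x) ->
  manifold_integral A g f = manifold_integral A g h.
Proof.
move=> fh; rewrite !manifold_integralE; apply: eq_bigr => k _.
congr iterated_integral; apply/funext => x; rewrite /integrand.
by case: ifPn => // /set_mem cx; rewrite fh //; exact: Ac.
Qed.

Lemma chartwise_cst (a : R) : chartwise_continuous (fun _ _ => a).
Proof. by move=> c _ x _; exact: cst_continuous. Qed.

Lemma manifold_integralD f h :
  chartwise_continuous f -> chartwise_continuous h ->
  manifold_integral A g (fun c x => f c x + h c x) =
  manifold_integral A g f + manifold_integral A g h.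
Proof.
move=> cf ch; rewrite -[in RHS](mul1r (manifold_integral A g f)).
rewrite -manifold_integral_linear //.
by apply: eq_manifold_integral => c _ x _; rewrite mul1r.
Qed.

Lemma manifold_integral0 : manifold_integral A g (fun _ _ => 0) = 0.
Proof.
have := manifold_integral_linear (-1) (@chartwise_cst 0) (@chartwise_cst 0).
have -> : (fun (_ : chart R M m) (_ : 'rV[R]_m) => -1 * 0 + 0 : R) = (fun _ _ => 0).
  by apply/funext => c; apply/funext => x; rewrite mulr0 addr0.
by rewrite mulN1r addNr.
Qed.

Lemma manifold_integralZ a f : chartwise_continuous f ->
  manifold_integral A g (fun c x => a * f c x) = a * manifold_integral A g f.
Proof.
move=> cf; rewrite -[RHS]addr0 -manifold_integral0 -manifold_integral_linear //.
  by apply: eq_manifold_integral => c _ x _; rewrite addr0.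
exact: chartwise_cst.
Qed.

Lemma integrand_ge0 k f :
  (forall c, A c -> forall x, chart_im c x -> 0 <= f c x) ->
  forall x, 0 <= integrand k (f (c_ k)) x.
Proof.
move=> f0 x; rewrite /integrand; case: ifPn => // /set_mem cx.
have [/(_ k)[_ _ r0 _] _] := HP.
by rewrite mulr_ge0 ?sqrtr_ge0 // mulr_ge0 // f0.
Qed.

Lemma manifold_integral_ge0 f :
  (forall c, A c -> forall x, chart_im c x -> 0 <= f c x) -> 0 <= manifold_integral A g f.
Proof.
move=> f0; rewrite manifold_integralE; apply: sumr_ge0 => k _.
exact: iterated_integral_ge0 (integrand_ge0 k f0).
Qed.

(** The density [Num.sqrt (\det g)] of the volume form is positive. *)
Lemma manifold_integral_eq0 f : chartwise_continuous f ->
  (forall c, A c -> forall x, chart_im c x -> 0 <= f c x) ->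
  manifold_integral A g f = 0 ->
  forall k x, chart_im (c_ k) x -> rho k (chart_inv (c_ k) x) != 0 -> f (c_ k) x = 0.
Proof.
move=> cf f0 /eqP; rewrite manifold_integralE psumr_eq0; last first.
  by move=> k _; exact: iterated_integral_ge0 (integrand_ge0 k f0).
move=> /allP I0 k x cx rx; have /eqP Ik := I0 k (mem_index_enum k).
have := iterated_integral_eq0 (integrand_test k cf) (integrand_ge0 k f0) Ik x.
rewrite /integrand mem_set // => /eqP; rewrite !mulf_eq0 (negbTE rx) /= => /orP[/eqP//|].
have det0 := posdef_det_gt0 (riemannian_sym (Ac k) cx) (riemannian_posdef (Ac k) cx).
by rewrite sqrtr_eq0 leNgt det0.
Qed.

(** The constant depends only on the compactly supported weights of the
    integral. *)
Lemma manifold_integral_small : exists2 C : R, 0 <= C &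
  forall f d, chartwise_continuous f -> 0 <= d ->
    (forall k x, pu_support k x -> `|f (c_ k) x| <= d) ->
    `|manifold_integral A g f| <= C * d.
Proof.
have H k : exists C : R, 0 <= C /\ forall f d, chartwise_continuous f -> 0 <= d ->
    (forall x, pu_support k x -> `|f (c_ k) x| <= d) ->
    `|iterated_integral (integrand k (f (c_ k)))| <= C * d.
  have [B B0 HB] := integrand_supported k.
  have [W W0 HW] := test_function_bounded (integrand_test k (@chartwise_cst 1)).
  exists ((2 * B) ^+ m * W); split; first by rewrite mulr_ge0 // exprn_ge0 // mulr_ge0.
  move=> f d cf d0 fd; rewrite -mulrA.
  apply: iterated_integral_bounded; [exact: integrand_test|exact: B0|exact: HB|].
  move=> x; have [xK|xK] := pselect (pu_support k x); last first.
    by rewrite integrand_off // normr0 mulr_ge0.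
  have -> : integrand k (f (c_ k)) x = integrand k (fun=> 1) x * f (c_ k) x.
    by rewrite /integrand; case: ifP => _; [ring|rewrite mul0r].
  rewrite normrM.
  by apply: ler_pM; [exact: normr_ge0|exact: normr_ge0|exact: HW|exact: fd].
have [C HC] := choice H; exists (\sum_k C k); first by apply: sumr_ge0 => k _; exact: (HC k).1.
move=> f d cf d0 fd; rewrite manifold_integralE mulr_suml.
apply: le_trans (ler_norm_sum _ _ _) _; apply: ler_sum => k _.
by apply: (HC k).2 => // x; exact: fd.
Qed.

End ManifoldIntegral.

(** * Critical points of the energy *)

Section Energy.
Context {R : realType} {M : topologicalType} {m : nat}.
Hypothesis hM : hausdorff_space M.
Hypothesis cM : compact [set: M].
Variables (A : set (chart R M m)) (g : metric_rep R M m).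
Hypothesis oA : oriented_atlas A.
Hypothesis rg : riemannian_metric A g.
Implicit Types (X Y : vector_field_rep R M m).

Let sg c (Ac : A c) := riemannian_smooth rg Ac.
Let gsym c (Ac : A c) x := @riemannian_sym _ _ _ A g rg c x Ac.
Let gpos c (Ac : A c) x := @riemannian_posdef _ _ _ A g rg c x Ac.
Local Notation oc c := (@open_chart_im R M m c).

Let dir Y c x := dirichlet_density (g c) (Y c) x.
Let ver Y c x := vertical_density (g c) (Y c) x.
Let hor Y c x := horizontal_density (g c) (Y c) x.

Lemma density_continuous Y : smooth_vector_field A Y ->
  [/\ chartwise_continuous A (dir Y), chartwise_continuous A (ver Y) &
      chartwise_continuous A (hor Y)].
Proof.
move=> [sY _]; have sF c (Ac : A c) := smooth_family_cst (e := 1) (oc c) (sY c Ac).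
have z1 : `|0 : R| < 1 by rewrite normr0.
split=> c Ac x cx.
- exact: (smooth_family_continuous (smooth_family_dirichlet (oc c) (sg Ac) (gpos Ac) (sF c Ac))
    z1 cx).
- exact: (smooth_family_continuous (smooth_family_vertical (oc c) (sg Ac) (gpos Ac) (sF c Ac))
    z1 cx).
- exact: (smooth_family_continuous (smooth_family_horizontal (oc c) (sg Ac) (gpos Ac) (sF c Ac))
    z1 cx).
Qed.

Lemma energy_split d1 d2 Y : smooth_vector_field A Y ->
  energy A g d1 d2 Y =
  d1 * (manifold_integral A g (fun _ _ => m%:R) + manifold_integral A g (dir Y)) +
  d2 * (manifold_integral A g (hor Y) + manifold_integral A g (ver Y)).
Proof.
move=> sY; have [cd cv ch] := density_continuous sY; rewrite /energy.
rewrite -(manifold_integralD hM cM oA rg (@chartwise_cst _ _ _ A m%:R) cd).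
rewrite -(manifold_integralD hM cM oA rg ch cv).
have [sYc _] := sY; congr (_ * _ + _ * _); apply: (eq_manifold_integral hM cM g oA) => c Ac x cx.
  exact: (sqnorm_diff_graph (gsym Ac) (gpos Ac) (sYc c Ac) cx).
exact: (sqnorm_tension_graph (oc c) (sg Ac) (gsym Ac) (gpos Ac) (sYc c Ac) cx).
Qed.

Lemma smooth_vector_field_scale X s : smooth_vector_field A X ->
  smooth_vector_field A (fun c x => s *: X c x).
Proof.
move=> [sX tX]; split=> [c Ac|c d Ac Ad x ov].
  apply: (smooth_on_mx (oc c)) => i j.
  have -> : (fun x => (s *: X c x) i j) = (fun x => cst s x * X c x i j).
    by apply/funext => x; rewrite mxE.
  exact: (smooth_onM (oc c) (smooth_on_cst s (oc c)) (smooth_on_entry i j (oc c) (sX c Ac))).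
by rewrite tX // scalemxAl.
Qed.

Lemma energy_scale d1 d2 X s : smooth_vector_field A X ->
  energy A g d1 d2 (fun c x => s *: X c x) =
  d1 * (manifold_integral A g (fun _ _ => m%:R) + s ^+ 2 * manifold_integral A g (dir X)) +
  d2 * (s ^+ 4 * manifold_integral A g (hor X) + s ^+ 2 * manifold_integral A g (ver X)).
Proof.
move=> sX; have [cd cv ch] := density_continuous sX.
have [sXc _] := sX.
rewrite energy_split; last exact: smooth_vector_field_scale.
rewrite -(manifold_integralZ hM cM oA rg (s ^+ 2) cd).
rewrite -(manifold_integralZ hM cM oA rg (s ^+ 2) cv).
rewrite -(manifold_integralZ hM cM oA rg (s ^+ 4) ch).
congr (_ * (_ + _) + _ * (_ + _)); apply: (eq_manifold_integral hM cM g oA) => c Ac x cx.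
- exact: (dirichlet_density_scale (g c) (sXc c Ac) s cx).
- exact: (horizontal_density_scale (oc c) (sg Ac) (gpos Ac) (sXc c Ac) s cx).
- exact: (vertical_density_scale (oc c) (sg Ac) (gpos Ac) (sXc c Ac) s cx).
Qed.

Lemma variation_scale X : smooth_vector_field A X ->
  Defs.variation A X 1 (fun t c x => (1 + t) *: X c x).
Proof.
move=> sX; have [sXc _] := sX; split.
- by move=> c _ x _; rewrite addr0 scale1r.
- by move=> t _; exact: smooth_vector_field_scale.
- move=> c Ac; have oW := open_joint_dom (e := 1) (oc c).
  have sj : smooth_on (joint_dom 1 (chart_im c)) (joint (fun=> X c)).
    exact: (smooth_family_cst (oc c) (sXc c Ac)).
  have st : smooth_on (joint_dom 1 (chart_im c)) (fun z : 'rV[R]_(1 + m) => lsubmx z 0 0).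
    have -> : (fun z : 'rV[R]_(1 + m) => lsubmx z 0 0) = (fun z => z 0 (lshift m 0)).
      by apply/funext => z; rewrite mxE.
    exact: (smooth_on_coord _ oW).
  apply: (smooth_on_mx oW) => i j.
  have -> : (fun z : 'rV[R]_(1 + m) => ((1 + lsubmx z 0 0) *: X c (rsubmx z)) i j) =
      (fun z => (1 + lsubmx z 0 0) * joint (fun=> X c) z i j).
    by apply/funext => z; rewrite mxE.
  apply: (smooth_onM oW _ (smooth_on_entry i j oW sj)).
  exact: (smooth_onD oW (smooth_on_cst (1 : R) oW) st).
Qed.

Lemma dilation_derivative (c0 c2 c4 : R) :
  is_derive (0 : R) 1 (fun t : R => c0 + (1 + t) ^+ 2 * c2 + (1 + t) ^+ 4 * c4) 0 ->
  2 * c2 + 4 * c4 = 0.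
Proof.
pose p : {poly R} := c0%:P + c2 *: (1%:P + 'X) ^+ 2 + c4 *: (1%:P + 'X) ^+ 4.
have -> : (fun t : R => c0 + (1 + t) ^+ 2 * c2 + (1 + t) ^+ 4 * c4) = horner p.
  apply/funext => t; rewrite /p !(hornerD, hornerZ, horner_exp, hornerC, hornerX); ring.
move=> [_ D0]; have [_ D1] := is_derive_poly p 0; move: D1; rewrite D0 => /esym.
rewrite /p !(derivD, derivC, derivZ, deriv_exp, derivX, hornerD, hornerZ, horner_exp,
  hornerC, hornerX, hornerMn, hornerM, add0r, addr0, expr1n, mulr1, mul1r) => <-; ring.
Qed.

(** The derivative of the energy along [(1 + t) X] is a sum of terms that all
    have the sign of [d1] and [d2]. *)
Lemma dirichlet_integral_eq0 d1 d2 X : (0 < d1 /\ 0 < d2) \/ (d1 < 0 /\ d2 < 0) ->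
  smooth_vector_field A X -> interpolating_sesqui_harmonic A g d1 d2 X ->
  manifold_integral A g (dir X) = 0.
Proof.
move=> sgn sX /(_ 1 _ ltr01 (variation_scale sX)).
have cvg_ := density_continuous sX.
set a := manifold_integral A g (dir X).
pose b := manifold_integral A g (hor X); pose v := manifold_integral A g (ver X).
pose c0 := d1 * manifold_integral A g (fun _ _ => m%:R).
have -> : (fun t : R => energy A g d1 d2 (fun c x => (1 + t) *: X c x)) =
    (fun t : R => c0 + (1 + t) ^+ 2 * (d1 * a + d2 * v) + (1 + t) ^+ 4 * (d2 * b)).
  by apply/funext => t; rewrite energy_scale // -/a -/b -/v /c0; ring.
move=> /dilation_derivative D.
have a0 : 0 <= a.
  apply: (manifold_integral_ge0 hM cM g oA) => c Ac x cx.
  exact: (dirichlet_density_ge0 (gsym Ac) (gpos Ac) (X c) cx).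
have v0 : 0 <= v.
  apply: (manifold_integral_ge0 hM cM g oA) => c Ac x cx.
  exact: (vertical_density_ge0 (gsym Ac) (gpos Ac) (X c) cx).
have b0 : 0 <= b.
  apply: (manifold_integral_ge0 hM cM g oA) => c Ac x cx.
  exact: (horizontal_density_ge0 (gsym Ac) (gpos Ac) (X c) cx).
apply/eqP; rewrite eq_le a0 andbT.
by case: sgn => -[s1 s2]; nra.
Qed.

(** Every point has a positive weight in some chart of the partition, where the
    covariant derivative vanishes; this passes to any other chart around the
    point. *)
Lemma parallel_of_dirichlet X : smooth_vector_field A X ->
  manifold_integral A g (dir X) = 0 -> parallel A g X.
Proof.
move=> sX I0 c Ac x cx.
have [cd _ _] := density_continuous sX; have [sXc tX] := sX.
pose p := chart_inv c x.
have [pc px] := chart_im_inv cx.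
have [HP sum1] := chosen_partitionP hM cM oA.1.
have [k rk] : exists k, @pu_fun R M m (chosen_partition A) k p != 0.
  apply: contrapT => nk; have := sum1 p; rewrite big1; last first.
    by move=> k _; apply/eqP; apply: contrapT => /negP rk; apply: nk; exists k.
  by move=> /eqP; rewrite eq_sym oner_eq0.
set d := pu_chart k.
have [Ad _ _ sub] := HP k.
have pd : chart_dom d p by apply: sub; exact: subset_closure.
have ov : overlap c d x by rewrite overlapE.
have dx : chart_im d (transition c d x) by exact: transition_im.
have N0 : nabla (g d) (X d) (transition c d x) = 0.
  apply: (dirichlet_density_eq0 (gsym Ad) (gpos Ad) dx).
  apply: (manifold_integral_eq0 hM cM oA rg cd _ I0 dx).
    move=> c' Ac' y c'y; exact: (dirichlet_density_ge0 (gsym Ac') (gpos Ac') (X c') c'y).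
  by rewrite /transition /= chart_mapK.
have [_ _ _ gT] := rg.
have ovc y (ovy : overlap c d y) := overlap_im ovy.
have ovd y (ovy : overlap c d y) := transition_im ovy.
exact: (nabla_transition (@open_overlap _ _ _ c d) (oc d) ovc ovd (oA.2 c d Ac Ad).1
  (sg Ad) (sXc c Ac) (sXc d Ad) (gsym Ac) (gpos Ac) (gsym Ad) (gpos Ad)
  (gT c d Ac Ad) (tX c d Ac Ad) ov N0).
Qed.

(** All densities vanish to first order at time zero, uniformly on the supports
    of the partition, so their integrals do, and the energy has derivative zero
    without any differentiation under the integral sign. *)
Lemma parallel_critical d1 d2 X : smooth_vector_field A X -> parallel A g X ->
  interpolating_sesqui_harmonic A g d1 d2 X.
Proof.
move=> sX pX e V e0 [V0 sV jV].
have par0 c (Ac : A c) x : chart_im c x -> nabla (g c) (V 0 c) x = 0.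
  move=> cx; rewrite -[RHS](pX c Ac x cx); apply/matrixP => i k; rewrite !mxE.
  rewrite (partial_eq_on i (oc c) (V0 c Ac) cx); congr (_ + _).
  by apply: eq_bigr => j _; rewrite (V0 c Ac x cx).
have e00 : `|0 : R| < e by rewrite normr0.
pose dens t c x := [:: dir (V t) c x; ver (V t) c x; hor (V t) c x].
pose D (n : 'I_3) t c x := nth 0 (dens t c x) n.
have ord3 (Q : 'I_3 -> Prop) : Q ord0 -> Q (lift ord0 ord0) -> Q ord_max -> forall n, Q n.
  move=> Q0 Q1 Q2 [[|[|[|//]]] n3].
  - by have -> : Ordinal n3 = ord0 by apply: val_inj.
  - by have -> : Ordinal n3 = lift ord0 ord0 by apply: val_inj.
  - by have -> : Ordinal n3 = ord_max by apply: val_inj.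
have D0 n c (Ac : A c) x : chart_im c x -> D n 0 c x = 0.
  move=> cx; move: n; apply: ord3.
  - exact: (parallel_dirichlet (par0 c Ac) cx).
  - exact: (parallel_vertical (oc c) (par0 c Ac) cx).
  - exact: (parallel_horizontal (par0 c Ac) cx).
have Dge0 n c (Ac : A c) t x : `|t| < e -> chart_im c x -> 0 <= D n t c x.
  move=> te cx; move: n; apply: ord3.
  - exact: (dirichlet_density_ge0 (gsym Ac) (gpos Ac) (V t c) cx).
  - exact: (vertical_density_ge0 (gsym Ac) (gpos Ac) (V t c) cx).
  - exact: (horizontal_density_ge0 (gsym Ac) (gpos Ac) (V t c) cx).
have Dsm n c (Ac : A c) : smooth_family e (chart_im c) (fun t => D n t c).
  have sF : smooth_family e (chart_im c) (fun t => V t c) by exact: jV.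
  move: n; apply: ord3.
  - exact: (smooth_family_dirichlet (oc c) (sg Ac) (gpos Ac) sF).
  - exact: (smooth_family_vertical (oc c) (sg Ac) (gpos Ac) sF).
  - exact: (smooth_family_horizontal (oc c) (sg Ac) (gpos Ac) sF).
have Dc n t : `|t| < e -> chartwise_continuous A (D n t).
  by move=> te c Ac x cx; exact: (smooth_family_continuous (Dsm n c Ac) te cx).
have [C C0 HC] := manifold_integral_small hM cM oA rg.
pose MI n t := manifold_integral A g (D n t).
have MI0 n : MI n 0 = 0.
  apply: etrans _ (manifold_integral0 hM cM oA rg).
  by apply: (eq_manifold_integral hM cM g oA) => c Ac x cx; exact: D0.
pose I0 := manifold_integral A g (fun _ _ => m%:R).
have EE t : `|t| < e -> energy A g d1 d2 (V t) =
    d1 * (I0 + MI ord0 t) + d2 * (MI ord_max t + MI (lift ord0 ord0) t).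
  by move=> te; rewrite energy_split; [|exact: sV].
apply: is_derive_little_o => eps eps0.
(* adding 1 makes the divisor positive when [d1], [d2] or [C] is zero *)
pose K := (`|d1| + `|d2| + `|d2|) * C + 1.
have K0 : 0 < K by rewrite ltr_wpDl // mulr_ge0 // !addr_ge0.
have dl0 : 0 < eps / K by rewrite divr_gt0.
have te_near : \forall t \near (0 : R), `|t| < e.
  by apply/nbhs_ballP; exists e => // t; rewrite /ball /= sub0r normrN.
have [HP _] := chosen_partitionP hM cM oA.1.
have Ak k : A (@pu_chart R M m (chosen_partition A) k) by have [] := HP k.
have small n k : \forall t \near (0 : R), forall x, pu_support (A := A) k x ->
    `|D n t (pu_chart k) x| <= eps / K * `|t|.
  apply: (family_little_o e0 (oc _) (Dsm n _ (Ak k))).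
  - by move=> t x te cx; exact: Dge0.
  - by move=> x cx; exact: D0.
  - exact: (pu_support_compact hM cM oA).
  - exact: (pu_support_im hM cM oA).
  - exact: dl0.
have small_near := filter_forall _ (fun nk : 'I_3 * 'I_(pu_size (chosen_partition A)) =>
  small nk.1 nk.2).
near=> t.
have te : `|t| < e by near: t.
have dt0 : 0 <= eps / K * `|t| by rewrite mulr_ge0 // ltW.
have smallt : forall (nk : 'I_3 * 'I_(pu_size (chosen_partition A))) x,
    pu_support (A := A) nk.2 x -> `|D nk.1 t (pu_chart nk.2) x| <= eps / K * `|t|.
  by near: t; exact: small_near.
have MIs n : `|MI n t| <= C * (eps / K * `|t|).
  by apply: (HC _ _ (Dc n t te) dt0) => k; exact: (smallt (n, k)).
rewrite (EE t te) (EE 0 e00) !MI0.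
have -> : d1 * (I0 + MI ord0 t) + d2 * (MI ord_max t + MI (lift ord0 ord0) t) -
    (d1 * (I0 + 0) + d2 * (0 + 0)) =
    d1 * MI ord0 t + d2 * MI ord_max t + d2 * MI (lift ord0 ord0) t by ring.
apply: (@le_trans _ _ ((`|d1| + `|d2| + `|d2|) * (C * (eps / K * `|t|)))).
  apply: le_trans (ler_normD _ _) _; rewrite [leRHS]mulrDl lerD //; last first.
    by rewrite normrM ler_wpM2l.
  apply: le_trans (ler_normD _ _) _; rewrite [leRHS]mulrDl lerD //.
    by rewrite normrM ler_wpM2l.
  by rewrite normrM ler_wpM2l.
have -> : (`|d1| + `|d2| + `|d2|) * (C * (eps / K * `|t|)) =
  (`|d1| + `|d2| + `|d2|) * C / K * (eps * `|t|) by ring.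
apply: ler_piMl; first by rewrite mulr_ge0 // ltW.
by rewrite ler_pdivrMr // mul1r /K lerDl.
Unshelve. all: by end_near. Qed.

End Energy.

Theorem theorem3p8 (R : realType) (m : nat) (M : topologicalType)
  (M_hausdorff : hausdorff_space M) (M_compact : compact [set: M])
  (A : set (chart R M m)) (A_oriented : oriented_atlas A)
  (g : metric_rep R M m) (g_riemannian : riemannian_metric A g)
  (X : vector_field_rep R M m) (X_smooth : smooth_vector_field A X)
  (d1 d2 : R) (same_sign : (0 < d1 /\ 0 < d2) \/ (d1 < 0 /\ d2 < 0)) :
  interpolating_sesqui_harmonic A g d1 d2 X <-> parallel A g X.
Proof.
split.
  move=> crit; apply: (parallel_of_dirichlet M_hausdorff M_compact A_oriented) => //.
  exact: (dirichlet_integral_eq0 M_hausdorff M_compact A_oriented g_riemannian same_sign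
    X_smooth crit).
exact: (parallel_critical M_hausdorff M_compact A_oriented).
Qed.
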